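(* Let $k$ be an algebraically closed field of characteristic $p>0$, let $e\ge 1$ with $p^e>2$, let $c\in k\setminus\{0\}$, and for $i=1,2$ let $L_i(T)=\alpha_{i,e}T^{p^e}+\alpha_{i,e-1}T^{p^{e-1}}+\cdots+\alpha_{i,0}T\in k[T]$ with $\alpha_{i,e}\alpha_{i,0}\neq 0$. Let $C\subset\mathbb{P}^2$ be the plane curve over $k$ defined in affine coordinates by $L_1(x)\cdot L_2(y)+c=0$, and let $X$ be the smooth model of $C$. Then there exists an injective group homomorphism $$\mathrm{Aut}(X)\cong \mathrm{Bir}(C)\hookrightarrow PGL(3,k).$$
   Context: $\mathrm{Aut}(X)$ is the group of automorphisms over $k$ of the smooth projective curve $X$ (the normalization of the projective closure of the affine curve). $\mathrm{Bir}(C)$ is the group of birational self-maps over $k$ of the projective plane curve $C$; it is identified with $\mathrm{Aut}(X)$ through the normalization $X\to C$. *)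

(* Defs.v *)
From HB Require Import structures.
From mathcomp Require Import all_boot all_order all_algebra.
From mathcomp Require Import boolp.
From mathcomp Require Import mpoly.

Set Implicit Arguments.
Unset Strict Implicit.
Unset Printing Implicit Defensive.

Import GRing.Theory.
Local Open Scope ring_scope.
Local Open Scope quotient_scope.

Section PGL.
Variables (n : nat) (k : fieldType).

Definition GL_rep := {A : 'M[k]_n | A \in unitmx}.

Definition GL_scal (A B : GL_rep) : bool :=
  `[< exists2 a : k, a != 0 & val A = a *: val B >].

Lemma GL_scal_refl : reflexive GL_scal.
Proof. by move=> A; apply/asboolP; exists 1; rewrite ?oner_neq0 ?scale1r. Qed.

Lemma GL_scal_sym : ssrbool.symmetric GL_scal.
Proof.
have H A B : GL_scal A B -> GL_scal B A.
  move=> /asboolP[a a0 E]; apply/asboolP; exists a^-1; rewrite ?invr_eq0 //.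
  by rewrite E scalerA mulVf ?scale1r.
by move=> A B; apply/idP/idP; apply: H.
Qed.

Lemma GL_scal_trans : transitive GL_scal.
Proof.
move=> B A C /asboolP[a a0 AB] /asboolP[b b0 BC]; apply/asboolP.
by exists (a * b); rewrite ?mulf_neq0 // AB BC scalerA.
Qed.

Canonical GL_scal_equiv := EquivRel GL_scal GL_scal_refl GL_scal_sym GL_scal_trans.

Definition PGL := {eq_quot GL_scal}.
HB.instance Definition _ := Choice.on PGL.
HB.instance Definition _ := EqQuotient.on PGL.

Definition mk_GL (A : 'M[k]_n) (uA : A \in unitmx) : GL_rep := exist _ A uA.

Definition GL_one : GL_rep := mk_GL (unitmx1 k n).

Lemma GL_mul_subproof (A B : GL_rep) : val A *m val B \in unitmx.
Proof. by rewrite unitmx_mul (valP A) (valP B). Qed.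
Definition GL_mul (A B : GL_rep) : GL_rep := mk_GL (GL_mul_subproof A B).

Lemma GL_inv_subproof (A : GL_rep) : invmx (val A) \in unitmx.
Proof. by rewrite unitmx_inv (valP A). Qed.
Definition GL_inv (A : GL_rep) : GL_rep := mk_GL (GL_inv_subproof A).

Definition PGL_one : PGL := \pi_PGL GL_one.
Definition PGL_mul (A B : PGL) : PGL := \pi_PGL (GL_mul (repr A) (repr B)).
Definition PGL_inv (A : PGL) : PGL := \pi_PGL (GL_inv (repr A)).

Lemma PGL_eqP (A B : GL_rep) :
  (exists2 a : k, a != 0 & val A = a *: val B) <-> \pi_PGL A = \pi_PGL B.
Proof.
split=> [H|/eqmodP/asboolP //].
by apply/eqmodP/asboolP.
Qed.

Lemma PGL_reprP (A : GL_rep) :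
  exists2 a : k, a != 0 & val (repr (\pi_PGL A)) = a *: val A.
Proof. by apply/PGL_eqP; rewrite reprK. Qed.

Lemma PGL_ind (T : PGL -> Prop) : (forall A, T (\pi_PGL A)) -> forall A, T A.
Proof. by move=> H A; rewrite -[A]reprK. Qed.

Lemma PGL_pi_eq (A B : GL_rep) : val A = val B -> \pi_PGL A = \pi_PGL B.
Proof. by move=> /val_inj ->. Qed.

Lemma PGL_mulE (A B : GL_rep) : PGL_mul (\pi_PGL A) (\pi_PGL B) = \pi_PGL (GL_mul A B).
Proof.
apply/PGL_eqP; have [a a0 /= ->] := PGL_reprP A; have [b b0 /= ->] := PGL_reprP B.
exists (a * b); first by rewrite mulf_neq0.
by rewrite -scalemxAl -scalemxAr scalerA.
Qed.

Lemma PGL_mulA : associative PGL_mul.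
Proof.
elim/PGL_ind=> A; elim/PGL_ind=> B; elim/PGL_ind=> C; rewrite !PGL_mulE.
by apply: PGL_pi_eq; rewrite /= mulmxA.
Qed.

Lemma PGL_mul1 : left_id PGL_one PGL_mul.
Proof.
elim/PGL_ind=> A; rewrite PGL_mulE.
by apply: PGL_pi_eq; rewrite /= mul1mx.
Qed.

Lemma PGL_mulr1 : right_id PGL_one PGL_mul.
Proof.
elim/PGL_ind=> A; rewrite PGL_mulE.
by apply: PGL_pi_eq; rewrite /= mulmx1.
Qed.

Lemma PGL_mulV : left_inverse PGL_one PGL_inv PGL_mul.
Proof.
move=> A; rewrite -{2}[A]reprK PGL_mulE.
by apply: PGL_pi_eq; rewrite /= mulVmx // (valP (repr A)).
Qed.

Lemma PGL_mulrV : right_inverse PGL_one PGL_inv PGL_mul.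
Proof.
move=> A; rewrite -{1}[A]reprK PGL_mulE.
by apply: PGL_pi_eq; rewrite /= mulmxV // (valP (repr A)).
Qed.

HB.instance Definition _ := isGroup.Build PGL
  PGL_mulA PGL_mul1 PGL_mulr1 PGL_mulV PGL_mulrV.

End PGL.

Section ProjectivePlane.
Variable k : closedFieldType.

Definition nzvec := {v : 'rV[k]_3 | v != 0}.

Definition proportional (u v : nzvec) : bool :=
  `[< exists2 a : k, a != 0 & val u = a *: val v >].

Lemma proportional_refl : reflexive proportional.
Proof. by move=> u; apply/asboolP; exists 1; rewrite ?oner_neq0 ?scale1r. Qed.

Lemma proportional_sym : ssrbool.symmetric proportional.
Proof.
have H u v : proportional u v -> proportional v u.
  move=> /asboolP[a a0 E]; apply/asboolP; exists a^-1; rewrite ?invr_eq0 //.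
  by rewrite E scalerA mulVf ?scale1r.
by move=> u v; apply/idP/idP; apply: H.
Qed.

Lemma proportional_trans : transitive proportional.
Proof.
move=> v u w /asboolP[a a0 uv] /asboolP[b b0 vw]; apply/asboolP.
by exists (a * b); rewrite ?mulf_neq0 // uv vw scalerA.
Qed.

Canonical proportional_equiv :=
  EquivRel proportional proportional_refl proportional_sym proportional_trans.

Definition P2 := {eq_quot proportional}.
HB.instance Definition _ := Choice.on P2.
HB.instance Definition _ := EqQuotient.on P2.

(* A chosen triple of homogeneous coordinates: only the vanishing of forms,   *)
(* and quotients of two forms of the same degree, are meaningful at a point.  *)
Definition coord (P : P2) : 'I_3 -> k := val (repr P) 0.

Definition has_coord (P : P2) (v : 'I_3 -> k) : Prop :=
  exists2 a : k, a != 0 & forall i, v i = a * coord P i.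

Definition curve (F : {mpoly k[3]}) := {P : P2 | F.@[coord P] == 0}.
HB.instance Definition _ F := Choice.on (curve F).

(* The affine coordinates are x = X_0 / X_2 and y = X_1 / X_2.                *)
Definition homogenize (f : {mpoly k[2]}) : {mpoly k[3]} :=
  \sum_(m <- msupp f)
     f@_m *: ('X_0 ^+ m 0 * 'X_1 ^+ m 1 * 'X_ord_max ^+ ((msize f).-1 - mdeg m)).

End ProjectivePlane.

Definition additive_poly (k : closedFieldType) (p e : nat) (a : 'I_e.+1 -> k) :
  {poly k} := \sum_(i < e.+1) a i *: 'X^(p ^ i).

(* F is meant to be irreducible, so that the curve is the variety of its      *)
(* k-points and its nonempty Zariski open subsets are exactly the cofinite    *)
(* ones.  Rational functions and rational maps are therefore represented by   *)
(* total functions, identified when they agree off a finite set: their values *)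
(* at finitely many points are junk.                                          *)

Section PlaneCurve.
Variables (k : closedFieldType) (F : {mpoly k[3]}).
Local Notation C := (curve F).
Implicit Types (P Q : C).

Definition almost_all (A : C -> Prop) : Prop :=
  exists s : seq C, forall P, P \notin s -> A P.

Lemma almost_allT (A : C -> Prop) : (forall P, A P) -> almost_all A.
Proof. by move=> H; exists [::] => P _. Qed.

Lemma almost_allS (A B : C -> Prop) :
  (forall P, A P -> B P) -> almost_all A -> almost_all B.
Proof. by move=> AB [s As]; exists s => P /As /AB. Qed.

Lemma almost_allI (A B : C -> Prop) :
  almost_all A -> almost_all B -> almost_all (fun P => A P /\ B P).
Proof.
move=> [s As] [t Bt]; exists (s ++ t) => P.
by rewrite mem_cat negb_or => /andP[/As ? /Bt ?].
Qed.

Definition is_quotient (f : C -> k) (G H : {mpoly k[3]}) : Prop :=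
  almost_all (fun P => H.@[coord (val P)] != 0 /\
                       f P = G.@[coord (val P)] / H.@[coord (val P)]).

Definition is_ratfun (f : C -> k) : Prop :=
  exists d (G H : {mpoly k[3]}),
    [/\ G \is d.-homog, H \is d.-homog & is_quotient f G H].

Definition ratfun_rep := {f : C -> k | `[< is_ratfun f >]}.

Definition ratfun_rel (f g : ratfun_rep) : bool :=
  `[< almost_all (fun P => val f P = val g P) >].

Lemma ratfun_rel_refl : reflexive ratfun_rel.
Proof. by move=> f; apply/asboolP/almost_allT. Qed.

Lemma ratfun_rel_sym : ssrbool.symmetric ratfun_rel.
Proof.
have H f g : ratfun_rel f g -> ratfun_rel g f.
  by move=> /asboolP fg; apply/asboolP; apply: almost_allS fg.
by move=> f g; apply/idP/idP; apply: H.
Qed.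

Lemma ratfun_rel_trans : transitive ratfun_rel.
Proof.
move=> g f h /asboolP fg /asboolP gh; apply/asboolP.
by apply: almost_allS (almost_allI fg gh) => P [-> ->].
Qed.

Canonical ratfun_rel_equiv :=
  EquivRel ratfun_rel ratfun_rel_refl ratfun_rel_sym ratfun_rel_trans.

Definition ratfun := {eq_quot ratfun_rel}.
HB.instance Definition _ := Choice.on ratfun.
HB.instance Definition _ := EqQuotient.on ratfun.

Lemma is_ratfun_const (a : k) : is_ratfun (fun _ => a).
Proof.
exists 0%N, a%:MP, 1; split; rewrite ?dhomog1 //.
  by rewrite -[a%:MP]mulr1 mul_mpolyC dhomogZ ?dhomog1.
by apply: almost_allT => P; rewrite meval1 mevalC divr1 oner_neq0.
Qed.

Lemma is_ratfunB f g : is_ratfun f -> is_ratfun g -> is_ratfun (fun P => f P - g P).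
Proof.
move=> [d [G [H [Gd Hd fE]]]] [d' [G' [H' [Gd' Hd' gE]]]].
exists (d + d')%N, (G * H' - G' * H), (H * H').
split.
- by apply: rpredB; [exact: dhomogM|rewrite addnC; exact: dhomogM].
- by rewrite dhomogM.
apply: almost_allS (almost_allI fE gE) => P [[H0 ->] [H'0 ->]].
rewrite mevalB !mevalM mulf_neq0 //; split=> //.
by rewrite -mulNr addf_div // mulNr.
Qed.

Lemma is_ratfunM f g : is_ratfun f -> is_ratfun g -> is_ratfun (fun P => f P * g P).
Proof.
move=> [d [G [H [Gd Hd fE]]]] [d' [G' [H' [Gd' Hd' gE]]]].
exists (d + d')%N, (G * G'), (H * H'); split; rewrite ?dhomogM //.
apply: almost_allS (almost_allI fE gE) => P [[H0 ->] [H'0 ->]].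
by rewrite !mevalM mulf_neq0 // mulf_div.
Qed.

Lemma is_ratfunN f : is_ratfun f -> is_ratfun (fun P => - f P).
Proof.
move=> /(is_ratfunB (is_ratfun_const 0)).
by congr is_ratfun; apply/funext => P; rewrite sub0r.
Qed.

Lemma is_ratfunD f g : is_ratfun f -> is_ratfun g -> is_ratfun (fun P => f P + g P).
Proof.
move=> Hf /is_ratfunN /(is_ratfunB Hf).
by congr is_ratfun; apply/funext => P; rewrite opprK.
Qed.

Definition mk_ratfun (f : C -> k) (Hf : is_ratfun f) : ratfun :=
  \pi_ratfun (exist _ f (asboolT Hf)).

Definition ratfun_val (z : ratfun) : C -> k := val (repr z).

Lemma ratfun_valP (z : ratfun) : is_ratfun (ratfun_val z).
Proof. exact/asboolP/(valP (repr z)). Qed.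

Lemma ratfun_eqP (z w : ratfun) :
  almost_all (fun P => ratfun_val z P = ratfun_val w P) <-> z = w.
Proof.
split=> [zw|->]; last exact: almost_allT.
by rewrite -[z]reprK -[w]reprK; apply/eqmodP/asboolP.
Qed.

Lemma mk_ratfunE f (Hf : is_ratfun f) :
  almost_all (fun P => ratfun_val (mk_ratfun Hf) P = f P).
Proof.
have /eqmodP/asboolP // :
  \pi_ratfun (repr (mk_ratfun Hf)) = \pi_ratfun (exist _ f (asboolT Hf)).
by rewrite reprK.
Qed.

Definition ratfun_const (a : k) : ratfun := mk_ratfun (is_ratfun_const a).
Definition ratfun_opp (z : ratfun) : ratfun := mk_ratfun (is_ratfunN (ratfun_valP z)).
Definition ratfun_add (z w : ratfun) : ratfun :=
  mk_ratfun (is_ratfunD (ratfun_valP z) (ratfun_valP w)).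
Definition ratfun_mul (z w : ratfun) : ratfun :=
  mk_ratfun (is_ratfunM (ratfun_valP z) (ratfun_valP w)).

Lemma ratfun_addA : associative ratfun_add.
Proof.
move=> x y z; apply/ratfun_eqP.
have := almost_allI (mk_ratfunE (is_ratfunD (ratfun_valP x) (ratfun_valP (ratfun_add y z))))
  (mk_ratfunE (is_ratfunD (ratfun_valP y) (ratfun_valP z))).
move=> /almost_allI /(_ (almost_allI
  (mk_ratfunE (is_ratfunD (ratfun_valP (ratfun_add x y)) (ratfun_valP z)))
  (mk_ratfunE (is_ratfunD (ratfun_valP x) (ratfun_valP y))))).
by apply: almost_allS => P [[-> ->] [-> ->]]; rewrite addrA.
Qed.

Lemma ratfun_addC : commutative ratfun_add.
Proof.
move=> x y; apply/ratfun_eqP.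
have := almost_allI (mk_ratfunE (is_ratfunD (ratfun_valP x) (ratfun_valP y)))
  (mk_ratfunE (is_ratfunD (ratfun_valP y) (ratfun_valP x))).
by apply: almost_allS => P [-> ->]; rewrite addrC.
Qed.

Lemma ratfun_add0 : left_id (ratfun_const 0) ratfun_add.
Proof.
move=> x; apply/ratfun_eqP.
have := almost_allI (mk_ratfunE (is_ratfun_const 0))
  (mk_ratfunE (is_ratfunD (ratfun_valP (ratfun_const 0)) (ratfun_valP x))).
by apply: almost_allS => P [+ ->] => ->; rewrite add0r.
Qed.

Lemma ratfun_addN : left_inverse (ratfun_const 0) ratfun_opp ratfun_add.
Proof.
move=> x; apply/ratfun_eqP.
have := almost_allI (mk_ratfunE (is_ratfun_const 0))
  (mk_ratfunE (is_ratfunD (ratfun_valP (ratfun_opp x)) (ratfun_valP x))).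
move=> /almost_allI /(_ (mk_ratfunE (is_ratfunN (ratfun_valP x)))).
by apply: almost_allS => P [[-> ->] ->]; rewrite addNr.
Qed.

HB.instance Definition _ := GRing.isZmodule.Build ratfun
  ratfun_addA ratfun_addC ratfun_add0 ratfun_addN.

Lemma ratfun_mulA : associative ratfun_mul.
Proof.
move=> x y z; apply/ratfun_eqP.
have := almost_allI (mk_ratfunE (is_ratfunM (ratfun_valP x) (ratfun_valP (ratfun_mul y z))))
  (mk_ratfunE (is_ratfunM (ratfun_valP y) (ratfun_valP z))).
move=> /almost_allI /(_ (almost_allI
  (mk_ratfunE (is_ratfunM (ratfun_valP (ratfun_mul x y)) (ratfun_valP z)))
  (mk_ratfunE (is_ratfunM (ratfun_valP x) (ratfun_valP y))))).
by apply: almost_allS => P [[-> ->] [-> ->]]; rewrite mulrA.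
Qed.

Lemma ratfun_mulC : commutative ratfun_mul.
Proof.
move=> x y; apply/ratfun_eqP.
have := almost_allI (mk_ratfunE (is_ratfunM (ratfun_valP x) (ratfun_valP y)))
  (mk_ratfunE (is_ratfunM (ratfun_valP y) (ratfun_valP x))).
by apply: almost_allS => P [-> ->]; rewrite mulrC.
Qed.

Lemma ratfun_mul1 : left_id (ratfun_const 1) ratfun_mul.
Proof.
move=> x; apply/ratfun_eqP.
have := almost_allI (mk_ratfunE (is_ratfun_const 1))
  (mk_ratfunE (is_ratfunM (ratfun_valP (ratfun_const 1)) (ratfun_valP x))).
by apply: almost_allS => P [+ ->] => ->; rewrite mul1r.
Qed.

Lemma ratfun_mulDl : left_distributive ratfun_mul ratfun_add.
Proof.
move=> x y z; apply/ratfun_eqP.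
have := almost_allI
  (mk_ratfunE (is_ratfunM (ratfun_valP (ratfun_add x y)) (ratfun_valP z)))
  (mk_ratfunE (is_ratfunD (ratfun_valP x) (ratfun_valP y))).
move=> /almost_allI /(_ (almost_allI
  (mk_ratfunE (is_ratfunM (ratfun_valP x) (ratfun_valP z)))
  (mk_ratfunE (is_ratfunM (ratfun_valP y) (ratfun_valP z))))).
move=> /almost_allI /(_ (mk_ratfunE (is_ratfunD
  (ratfun_valP (ratfun_mul x z)) (ratfun_valP (ratfun_mul y z))))).
by apply: almost_allS => P [[[-> ->] [E1 E2]] ->]; rewrite E1 E2 mulrDl.
Qed.

HB.instance Definition _ := GRing.Zmodule_isComPzRing.Build ratfun
  ratfun_mulA ratfun_mulC ratfun_mul1 ratfun_mulDl.

Definition is_ratmap (phi : C -> C) : Prop :=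
  exists d (G : 'I_3 -> {mpoly k[3]}),
    (forall i, G i \is d.-homog) /\
    almost_all (fun P => has_coord (val (phi P)) (fun i => (G i).@[coord (val P)])).

Definition inverse_ae (phi psi : C -> C) : Prop :=
  almost_all (fun P => psi (phi P) = P) /\ almost_all (fun P => phi (psi P) = P).

Definition is_birational (phi : C -> C) : Prop :=
  is_ratmap phi /\ exists psi, is_ratmap psi /\ inverse_ae phi psi.

Lemma is_ratmap_id : is_ratmap id.
Proof.
exists 1%N, (fun i => 'X_i); split; first by move=> i; rewrite dhomogX; apply/eqP; exact: mdeg1.
by apply: almost_allT => P; exists 1; rewrite ?oner_neq0 // => i; rewrite mevalXU mul1r.
Qed.

Lemma meval_homogZ d (G : {mpoly k[3]}) (v w : 'I_3 -> k) (a : k) :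
  G \is d.-homog -> (forall i, v i = a * w i) -> G.@[v] = a ^+ d * G.@[w].
Proof.
move=> /dhomogP Gd vw; rewrite !mevalE big_distrr /=.
apply: eq_big_seq => m mG; rewrite mulrCA; congr (_ * _).
under eq_bigr => i _ do rewrite vw exprMn.
rewrite big_split /=; congr (_ * _).
have <- : mdeg m = d by exact: Gd.
by rewrite mdegE expr_sum.
Qed.

Lemma comp_mpoly_homog d e (H : {mpoly k[3]}) (G : 'I_3 -> {mpoly k[3]}) :
  H \is e.-homog -> (forall i, G i \is d.-homog) ->
  H \mPo [tuple G i | i < 3] \is (d * e).-homog.
Proof.
move=> /dhomogP He Gd; rewrite comp_mpolyEX big_seq.
apply: rpred_sum => m mH; have <- : mdeg m = e by exact: He.
rewrite dhomogZ // comp_mpolyX mdegE big_distrr /=.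
apply: (big_ind2 (fun (x : {mpoly k[3]}) (n : nat) => x \is n.-homog)).
- exact: dhomog1.
- by move=> x1 n1 x2 n2; apply: dhomogM.
- by move=> i _; rewrite tnth_mktuple dhomogMn.
Qed.

Lemma almost_all_pre (phi psi : C -> C) (A : C -> Prop) :
  almost_all (fun P => psi (phi P) = P) -> almost_all A ->
  almost_all (fun P => A (phi P)).
Proof.
move=> [s Hs] [t Ht]; exists (s ++ map psi t) => P.
rewrite mem_cat negb_or => /andP[/Hs PE /negP Pt]; apply: Ht.
by apply/negP => phit; apply: Pt; rewrite -PE map_f.
Qed.

Lemma is_ratmap_comp (phi phi' psi : C -> C) :
  almost_all (fun P => psi (phi P) = P) -> is_ratmap phi -> is_ratmap phi' ->
  is_ratmap (phi' \o phi).
Proof.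
move=> inv [d [G [Gd GE]]] [e [H [He HE]]].
exists (d * e)%N, (fun i => H i \mPo [tuple G i | i < 3]).
split; first by move=> i; apply: comp_mpoly_homog.
have := almost_allI GE (almost_all_pre inv HE).
apply: almost_allS => P [[a a0 GP] [b b0 HP]].
exists (a ^+ e * b); first by rewrite mulf_neq0 ?expf_neq0.
move=> i; rewrite comp_mpoly_meval -mulrA -HP; apply: meval_homogZ => // j.
by rewrite tnth_mktuple GP.
Qed.

Lemma is_birational_id : is_birational id.
Proof.
split; first exact: is_ratmap_id.
by exists id; split; [exact: is_ratmap_id | split; apply: almost_allT].
Qed.

Lemma is_birational_comp (phi phi' : C -> C) :
  is_birational phi -> is_birational phi' -> is_birational (phi' \o phi).
Proof.
move=> [rphi [psi [rpsi [i1 i2]]]] [rphi' [psi' [rpsi' [j1 j2]]]].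
split; first exact: is_ratmap_comp i1 rphi rphi'.
exists (psi \o psi'); split; first exact: is_ratmap_comp j2 rpsi' rpsi.
split.
  by apply: almost_allS (almost_allI i1 (almost_all_pre i1 j1)) => P /= [E ->].
by apply: almost_allS (almost_allI j2 (almost_all_pre j2 i2)) => P /= [E ->].
Qed.

Definition bir_rep := {phi : C -> C | `[< is_birational phi >]}.

Definition bir_rel (phi phi' : bir_rep) : bool :=
  `[< almost_all (fun P => val phi P = val phi' P) >].

Lemma bir_rel_refl : reflexive bir_rel.
Proof. by move=> f; apply/asboolP/almost_allT. Qed.

Lemma bir_rel_sym : ssrbool.symmetric bir_rel.
Proof.
have H f g : bir_rel f g -> bir_rel g f.
  by move=> /asboolP fg; apply/asboolP; apply: almost_allS fg.
by move=> f g; apply/idP/idP; apply: H.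
Qed.

Lemma bir_rel_trans : transitive bir_rel.
Proof.
move=> g f h /asboolP fg /asboolP gh; apply/asboolP.
by apply: almost_allS (almost_allI fg gh) => P [-> ->].
Qed.

Canonical bir_rel_equiv := EquivRel bir_rel bir_rel_refl bir_rel_sym bir_rel_trans.

Definition Bir := {eq_quot bir_rel}.
HB.instance Definition _ := Choice.on Bir.
HB.instance Definition _ := EqQuotient.on Bir.

Definition bir_val (b : Bir) : C -> C := val (repr b).

Lemma bir_valP (b : Bir) : is_birational (bir_val b).
Proof. exact/asboolP/(valP (repr b)). Qed.

Definition mk_bir (phi : C -> C) (Hphi : is_birational phi) : Bir :=
  \pi_Bir (exist _ phi (asboolT Hphi)).

Lemma bir_eqP (b b' : Bir) :
  almost_all (fun P => bir_val b P = bir_val b' P) <-> b = b'.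
Proof.
split=> [bb|->]; last exact: almost_allT.
by rewrite -[b]reprK -[b']reprK; apply/eqmodP/asboolP.
Qed.

Lemma mk_birE phi (Hphi : is_birational phi) :
  almost_all (fun P => bir_val (mk_bir Hphi) P = phi P).
Proof.
have /eqmodP/asboolP // :
  \pi_Bir (repr (mk_bir Hphi)) = \pi_Bir (exist _ phi (asboolT Hphi)).
by rewrite reprK.
Qed.

Lemma bir_inv_ex (b : Bir) :
  {psi : C -> C | is_birational psi /\ inverse_ae (bir_val b) psi}.
Proof.
apply: cid; have [rb [psi [rpsi [i1 i2]]]] := bir_valP b.
by exists psi; split=> //; split=> //; exists (bir_val b).
Qed.

Definition bir_one : Bir := mk_bir is_birational_id.
Definition bir_mul (b b' : Bir) : Bir :=
  mk_bir (is_birational_comp (bir_valP b') (bir_valP b)).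
Definition bir_inv (b : Bir) : Bir := mk_bir (proj1 (projT2 (bir_inv_ex b))).

Lemma bir_pre (b : Bir) (A : C -> Prop) :
  almost_all A -> almost_all (fun P => A (bir_val b P)).
Proof.
have [rb [psi [rpsi [i1 i2]]]] := bir_valP b.
exact: almost_all_pre i1.
Qed.

Lemma bir_mulE (b b' : Bir) :
  almost_all (fun P => bir_val (bir_mul b b') P = bir_val b (bir_val b' P)).
Proof. exact: mk_birE. Qed.

Lemma bir_mulA : associative bir_mul.
Proof.
move=> x y z; apply/bir_eqP.
have := almost_allI (bir_mulE x (bir_mul y z)) (bir_mulE y z).
move=> /almost_allI /(_ (almost_allI (bir_mulE (bir_mul x y) z)
  (bir_pre z (bir_mulE x y)))).
by apply: almost_allS => P [[-> ->] [-> ->]].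
Qed.

Lemma bir_mul1 : left_id bir_one bir_mul.
Proof.
move=> x; apply/bir_eqP.
have := almost_allI (bir_mulE bir_one x) (bir_pre x (mk_birE is_birational_id)).
by apply: almost_allS => P [-> ->].
Qed.

Lemma bir_mulr1 : right_id bir_one bir_mul.
Proof.
move=> x; apply/bir_eqP.
have := almost_allI (bir_mulE x bir_one) (mk_birE is_birational_id).
by apply: almost_allS => P [-> ->].
Qed.

Lemma bir_mulV : left_inverse bir_one bir_inv bir_mul.
Proof.
move=> x; apply/bir_eqP; have [_ [i1 i2]] := projT2 (bir_inv_ex x).
have := almost_allI (bir_mulE (bir_inv x) x) (mk_birE is_birational_id).
move=> /almost_allI /(_ (almost_allI i1
  (bir_pre x (mk_birE (proj1 (projT2 (bir_inv_ex x))))))).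
by apply: almost_allS => P [[-> ->] [i ->]].
Qed.

Lemma bir_mulrV : right_inverse bir_one bir_inv bir_mul.
Proof.
move=> x; apply/bir_eqP; have [_ [i1 i2]] := projT2 (bir_inv_ex x).
have := almost_allI (bir_mulE x (bir_inv x)) (mk_birE is_birational_id).
move=> /almost_allI /(_ (almost_allI i2
  (mk_birE (proj1 (projT2 (bir_inv_ex x)))))).
by apply: almost_allS => P [[-> ->] [i ->]].
Qed.

HB.instance Definition _ := isGroup.Build Bir
  bir_mulA bir_mul1 bir_mulr1 bir_mulV bir_mulrV.

(* The smooth projective model X of C is the abstract nonsingular curve of    *)
(* k(C): its points are the valuation rings k c O c k(C), O <> k(C), of the   *)
(* function field (all of them discrete since k(C) has transcendence degree   *)
(* 1), it carries the cofinite topology, and the regular functions on an open *)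
(* U are the elements of the intersection of the O in U, seen as k-valued     *)
(* functions by taking residues (k is algebraically closed, so the residue    *)
(* fields are k).  Only the ring structure of ratfun is built here; it is a   *)
(* field when C is irreducible, and inverses are spelled out accordingly.     *)
Definition is_place (O : ratfun -> Prop) : Prop :=
  [/\ forall a : k, O (ratfun_const a),
      forall z w, O z -> O w -> O (z - w),
      forall z w, O z -> O w -> O (z * w),
      exists z, ~ O z
    & forall z, z <> 0 -> O z \/ exists2 w, O w & z * w = 1].

Definition smooth_model := {O : ratfun -> Prop | `[< is_place O >]}.
HB.instance Definition _ := Choice.on smooth_model.
Local Notation X := smooth_model.

Definition in_ring (x : X) (z : ratfun) : Prop := val x z.

Definition in_max_ideal (x : X) (z : ratfun) : Prop :=
  in_ring x z /\ ~ exists2 w, in_ring x w & z * w = 1.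

Definition residue (x : X) (z : ratfun) (a : k) : Prop :=
  in_ring x z /\ in_max_ideal x (z - ratfun_const a).

Definition zopen (U : X -> Prop) : Prop :=
  (forall x, ~ U x) \/ exists s : seq X, forall x, x \notin s -> U x.

Definition regular_on (U : X -> Prop) (g : X -> k) : Prop :=
  exists z : ratfun, forall x, U x -> residue x z (g x).

Definition is_morphism (sigma : X -> X) : Prop :=
  (forall U, zopen U -> zopen (U \o sigma)) /\
  (forall U g, zopen U -> regular_on U g -> regular_on (U \o sigma) (g \o sigma)).

Definition is_automorphism (sigma : X -> X) : Prop :=
  is_morphism sigma /\
  exists tau, [/\ is_morphism tau, cancel sigma tau & cancel tau sigma].

Definition AutX := {sigma : X -> X | `[< is_automorphism sigma >]}.
HB.instance Definition _ := Choice.on AutX.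

Lemma is_morphism_comp (sigma tau : X -> X) :
  is_morphism sigma -> is_morphism tau -> is_morphism (sigma \o tau).
Proof.
move=> [c1 r1] [c2 r2]; split=> [U oU|U g oU rg].
  exact: (c2 _ (c1 _ oU)).
exact: (r2 _ _ (c1 _ oU) (r1 _ _ oU rg)).
Qed.

Lemma is_automorphism_id : is_automorphism id.
Proof. by split; [|exists id]; split. Qed.

Lemma is_automorphism_comp (sigma tau : X -> X) :
  is_automorphism sigma -> is_automorphism tau -> is_automorphism (sigma \o tau).
Proof.
move=> [ms [s' [ms' K1 K2]]] [mt [t' [mt' J1 J2]]].
split; first exact: is_morphism_comp.
exists (t' \o s'); split; first exact: is_morphism_comp.
  by move=> x /=; rewrite K1 J1.
by move=> x /=; rewrite J2 K2.
Qed.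

Definition aut_fun (sigma : AutX) : X -> X := val sigma.

Lemma aut_funP (sigma : AutX) : is_automorphism (aut_fun sigma).
Proof. exact/asboolP/(valP sigma). Qed.

Lemma aut_inv_ex (sigma : AutX) :
  {tau : X -> X | [/\ is_automorphism tau, cancel (aut_fun sigma) tau
                    & cancel tau (aut_fun sigma)]}.
Proof.
apply: cid; have [ms [tau [mt K1 K2]]] := aut_funP sigma.
by exists tau; split=> //; split=> //; exists (aut_fun sigma).
Qed.

Lemma aut_inv_subproof (sigma : AutX) : is_automorphism (projT1 (aut_inv_ex sigma)).
Proof. by have [] := projT2 (aut_inv_ex sigma). Qed.

Definition mk_aut (sigma : X -> X) (Hsigma : is_automorphism sigma) : AutX :=
  exist _ sigma (asboolT Hsigma).

Definition aut_one : AutX := mk_aut is_automorphism_id.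
Definition aut_mul (sigma tau : AutX) : AutX :=
  mk_aut (is_automorphism_comp (aut_funP sigma) (aut_funP tau)).
Definition aut_inv (sigma : AutX) : AutX := mk_aut (aut_inv_subproof sigma).

Lemma aut_mulA : associative aut_mul.
Proof. by move=> x y z; apply: val_inj. Qed.

Lemma aut_mul1 : left_id aut_one aut_mul.
Proof. by move=> x; apply: val_inj. Qed.

Lemma aut_mulr1 : right_id aut_one aut_mul.
Proof. by move=> x; apply: val_inj. Qed.

Lemma aut_mulV : left_inverse aut_one aut_inv aut_mul.
Proof.
move=> x; apply: val_inj; apply/funext => y.
by have [_ K _] := projT2 (aut_inv_ex x); apply: K.
Qed.

Lemma aut_mulrV : right_inverse aut_one aut_inv aut_mul.
Proof.
move=> x; apply: val_inj; apply/funext => y.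
by have [_ _ K] := projT2 (aut_inv_ex x); apply: K.
Qed.

HB.instance Definition _ := isGroup.Build AutX
  aut_mulA aut_mul1 aut_mulr1 aut_mulV aut_mulrV.

Definition value_at (Q : C) (z : ratfun) (a : k) : Prop :=
  exists d (G H : {mpoly k[3]}),
    [/\ G \is d.-homog /\ H \is d.-homog, is_quotient (ratfun_val z) G H,
        H.@[coord (val Q)] != 0
      & a = G.@[coord (val Q)] / H.@[coord (val Q)]].

(* The graph of the normalization: the valuation ring x dominates the local   *)
(* ring of C at Q, i.e. Q is the centre of x on C.                            *)
Definition lies_over (x : X) (Q : C) : Prop :=
  forall z a, value_at Q z a -> residue x z a.

(* The identification of Aut(X) with Bir(C): nu o sigma = b o nu as rational  *)
(* maps, where nu : X -> C is the normalization.                              *)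
Definition induces (sigma : AutX) (b : Bir) : Prop :=
  almost_all (fun Q => forall x, lies_over x Q ->
    lies_over (aut_fun sigma x) (bir_val b Q)).

End PlaneCurve.

(* Main.v *)
(** The field k(C) has an explicit supply of places.  The curve is smooth in the
    charts (x, y), (1/x, y) and (1/y, x), so every valuation ring is the local
    ring of a chart at a point, with an explicit generator of its maximal ideal.
    The map x is unramified outside the roots of L1, where it is totally
    ramified, and symmetrically for y.  Writing a function as a polynomial in y
    of degree < q = p^e over k(x) one deduces that a function whose poles on the
    loci x = oo and y = oo have order at most m and n, with m, n < q, is a
    polynomial of bidegree at most (m, n).

    Let now (x', y') be the image of (x, y) under an automorphism of k(C).  For
    general a the function z = 1/(x' - a) has q simple poles, all at affine
    points P_1, ..., P_q.  Multiply z by y - y(P_1) and by x - s for each value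
    s of x on P_2, ..., P_q: the result is a polynomial of bidegree (m, 1) with
    m < q, and counting its zeros on the lines x = s, or on the line
    y = y(P_1) if all s coincide (this needs q > 2), makes all factors but one
    cancel.  So x' is a Moebius transform of x or of y, and so is y'.  Moebius
    transforms compatible with the equation are affine, because the roots of L2
    act by translation on the fibres of x.  Hence the automorphism acts on
    (x, y, 1) by an invertible matrix. *)

Require Import Defs.
From HB Require Import structures.
From mathcomp Require Import all_boot all_order all_algebra separable.
From mathcomp Require Import boolp mpoly.
From mathcomp Require Import ring zify.
Import GRing.Theory.
Set Implicit Arguments. Unset Strict Implicit. Unset Printing Implicit Defensive.
Local Open Scope ring_scope.

(** Everything rests on one algebraic fact. By Eisenstein at a simple root of A, the polynomial A(u)
    B(v) + D(u) is irreducible over k(u), so a polynomial g(u, v) is either a multiple of it or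
    coprime to it, and a resultant makes the coprimality explicit. This stands in for dimension
    theory: it bounds zeros and poles, makes k(C) a field and gives elements of K values at points.

    Automorphisms are compared through places because a place of K does not depend on a choice of
    coordinates: the poles of 1/(x' - a) are found in the model (x', y') and then located in the
    model (x, y).

    The condition q > 2 reflects the geometry: for q = 2 the closure in P^1 x P^1 is a smooth curve
    of bidegree (2, 2), hence of genus 1, and its translations are not all linear in (x, y, 1). *)

Lemma root_factor (k : fieldType) (p : {poly k}) a :
  root p a -> exists p1, p = ('X - a%:P) * p1.
Proof. by move=> /factor_theorem[p1 ->]; exists p1; rewrite mulrC. Qed.

Lemma coef_root_factor (k : fieldType) (r : k) (G : {poly {poly k}}) :
  map_poly (horner_eval r) G = 0 -> exists G1, G = ('X - r%:P) *: G1.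
Proof.
move=> G0.
have Gr i : root G`_i r.
  by have := congr1 (fun p : {poly k} => p`_i) G0; rewrite coef_map coef0 => /eqP.
exists (map_poly (fun p => p %/ ('X - r%:P)) G).
apply/polyP => i; rewrite coefZ coef_map_id0 ?div0p // mulrC divpK //.
by rewrite dvdp_XsubCl.
Qed.

(** * Irreducibility of A(u) B(v) + D(u) *)

Section Dichotomy.
Variables (k : fieldType) (A D B : {poly k}) (r : k).
Hypotheses (A0 : root A r) (A1 : A^`().[r] != 0) (D0 : D.[r] != 0).
Hypothesis sB : (1 < size B)%N.

Definition Psi (A D B : {poly k}) : {poly {poly k}} := A *: B^:P + D%:P.

Lemma simple_root_neq0 : A != 0.
Proof. by apply: contraNneq A1 => ->; rewrite linear0 horner0. Qed.

Lemma size_Psi : size (Psi A D B) = size B.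
Proof.
rewrite size_polyDl size_scale ?simple_root_neq0 ?size_map_polyC //.
by apply: leq_ltn_trans sB; rewrite size_polyC leq_b1.
Qed.

Lemma lead_coef_Psi : lead_coef (Psi A D B) = lead_coef B *: A.
Proof.
rewrite lead_coefDl; last first.
  rewrite size_scale ?simple_root_neq0 ?size_map_polyC //.
  by apply: leq_ltn_trans sB; rewrite size_polyC leq_b1.
by rewrite lead_coefZ lead_coef_map_inj //; [rewrite mulrC mul_polyC | exact: polyC_inj].
Qed.

(* Eisenstein's criterion at the simple root r of A. *)
Lemma Psi_irreducible (c : {poly k}) (Q h : {poly {poly k}}) :
  c != 0 -> c *: Psi A D B = Q * h -> (1 < size h)%N -> (size Q <= 1)%N.
Proof.
have [n] := ubnP (size c); elim: n c Q h => // n IH c Q h szc c0 E sh.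
have [cr|cr] := boolP (root c r); last first.
  rewrite leqNgt; apply/negP => sQ.
  (* Modulo u - r the product is the nonzero constant c(r) D(r), so both factors lose their leading
     coefficients in v. The leading coefficient of c Psi would then vanish twice at r, where A has
     only a simple zero. *)
  have Er : map_poly (horner_eval r) Q * map_poly (horner_eval r) h
      = (c.[r] * D.[r])%:P.
    rewrite -rmorphM -E /= linearZ /= /Psi.

    rewrite rmorphD /= map_polyZ map_polyC /=.
    by rewrite /horner_eval (eqP A0) scale0r add0r -mul_polyC polyCM.
  have nz : c.[r] * D.[r] != 0 by rewrite mulf_neq0.
  have Lr (G H : {poly {poly k}}) : (1 < size G)%N ->
      map_poly (horner_eval r) G * map_poly (horner_eval r) H = (c.[r] * D.[r])%:P ->
      root (lead_coef G) r.
    move=> sG EG; have G0 : map_poly (horner_eval r) G != 0.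
      by apply: contraNneq nz => H0; move: EG; rewrite H0 mul0r => /esym/polyC_inj->.
    have H0 : map_poly (horner_eval r) H != 0.
      by apply: contraNneq nz => H0; move: EG; rewrite H0 mulr0 => /esym/polyC_inj->.
    have := congr1 (fun p : {poly k} => size p) EG.
    rewrite size_mul // size_polyC nz => sz.
    have sG1 : (size (map_poly (horner_eval r) G) <= 1)%N.
      move: sz; rewrite -size_poly_gt0 in H0; move: H0.
      by case: (size (map_poly _ H)) => // m _; rewrite addnS /= => <-; rewrite leq_addr.
    have : (map_poly (horner_eval r) G)`_(size G).-1 = 0.
      by apply: nth_default; apply: leq_trans sG1 _; case: (size G) sG => [|[]].
    by rewrite coef_map /= /horner_eval -lead_coefE => /eqP.
  have rQ := Lr _ _ sQ Er.
  have rh : root (lead_coef h) r by apply: (Lr _ Q sh); rewrite mulrC.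
  have := congr1 (fun p => (lead_coef p)^`().[r]) E.
  rewrite lead_coefZ lead_coef_Psi lead_coefM !derivM derivZ !(hornerD, hornerM, hornerZ).
  rewrite (eqP rQ) (eqP rh) (eqP A0) !(mulr0, mul0r, addr0, add0r).
  move/eqP; rewrite !mulf_eq0 (negbTE A1) orbF.
  rewrite -rootE (negbTE cr) /= lead_coef_eq0 => /eqP B0.
  by move: sB; rewrite B0 size_poly0.
(* If r is a root of c, then u - r divides Q or h (Gauss's lemma at r); cancelling it lowers the
   degree of c. *)
have [c1 c1E] := root_factor cr.
have c10 : c1 != 0 by apply: contraNneq c0 => c10; rewrite c1E c10 mulr0.
have xr0 : 'X - r%:P != 0 :> {poly k} by rewrite polyXsubC_eq0.
have sc1 : (size c1 < n)%N.
  by move: szc; rewrite c1E size_monicM ?monicXsubC // size_XsubC.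
have : map_poly (horner_eval r) Q * map_poly (horner_eval r) h = 0.
  by rewrite -rmorphM -E /= linearZ /= /horner_eval (eqP cr) scale0r.
have inj : injective (fun G : {poly {poly k}} => ('X - r%:P) *: G).
  move=> G H; rewrite -!mul_polyC; apply: mulfI.
  by rewrite polyC_eq0.
move/eqP; rewrite mulf_eq0 => /orP[] /eqP /coef_root_factor[G GE].
  rewrite GE size_scale //; apply: (IH c1 G h) => //.
  by apply: inj; rewrite /= scalerA -c1E E GE scalerAl.
apply: (IH c1 Q G) => //; last by rewrite GE size_scale in sh.
by apply: inj; rewrite /= scalerA -c1E E GE scalerAr.
Qed.

(** Irreducibility makes the gcd of g and Psi over k(u) trivial or all of Psi, and the resultant
    decides. In the first alternative the factor comes from pseudo-division, so it is a constant
    times a power of A: it does not vanish at points with A(a) nonzero. *)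
Lemma Psi_dichotomy (g : {poly {poly k}}) :
  (exists n a Q, a != 0 /\ (a *: A ^+ n) *: g = Q * Psi A D B) \/
  (exists d s t, d != 0 /\ s * Psi A D B + t * g = d%:P).
Proof.
have [/size1_polyC gE|sg] := leqP (size g) 1.
  have [g0|g0] := eqVneq g`_0 0.
    by left; exists 0%N, 1, 0; rewrite oner_neq0 gE g0 mul0r scaler0.
  by right; exists g`_0, 0, 1; rewrite mul0r add0r mul1r -gE.
have sP : (1 < size (Psi A D B))%N by rewrite size_Psi.
have [R0|R0] := boolP (resultant (Psi A D B) g == 0); last first.
  right; have [[s t] _ /= E] := resultant_in_ideal sP sg.
  by exists (resultant (Psi A D B) g), s, t.
left; move: (R0); rewrite resultant_eq0 => sh.
have /Pdiv.Idomain.dvdpP[[c Q] /= c0 E] := Pdiv.Idomain.dvdp_gcdl (Psi A D B) g.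
have := Psi_irreducible c0 E sh => /size1_polyC QE.
have /Pdiv.Idomain.dvdpP[[c' Q'] /= c'0 E'] := Pdiv.Idomain.dvdp_gcdr (Psi A D B) g.
have Q0 : Q`_0 != 0.
  apply: contra_eqN E => /eqP q0; rewrite QE q0 polyC0 mul0r -mul_polyC mulf_eq0.
  by rewrite polyC_eq0 negb_or c0 -size_poly_gt0 size_Psi ltnW.
have dv : Pdiv.Idomain.dvdp (Psi A D B) g.
  apply/Pdiv.Idomain.dvdpP; exists (Q`_0 * c', c *: Q'); first by rewrite mulf_neq0.
  rewrite /= -scalerA E' -mul_polyC -QE mulrCA -E -scalerAl -scalerAr.
  by [].
move: dv; rewrite Pdiv.Idomain.dvdp_eq lead_coef_Psi => /eqP.
set n := Pdiv.Idomain.scalp _ _; set W := Pdiv.Idomain.divp _ _ => EW.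
exists n, (lead_coef B ^+ n), W; split; last by rewrite -exprZn.
by rewrite expf_neq0 // lead_coef_eq0 -size_poly_gt0 ltnW.
Qed.
End Dichotomy.
(* In {poly {poly k}} the inner variable is the first coordinate u and the outer
   one the second coordinate v. *)
Definition pe (k : fieldType) (a b : k) (g : {poly {poly k}}) : k :=
  (map_poly (horner_eval a) g).[b].
HB.instance Definition _ (k : fieldType) (a b : k) :=
  GRing.RMorphism.copy (pe a b) (horner_eval b \o map_poly (horner_eval a)).

Lemma peD (k : fieldType) (a b : k) (p q : {poly {poly k}}) : pe a b (p + q) = pe a b p + pe a b q.
Proof. by rewrite raddfD. Qed.
Lemma peB (k : fieldType) (a b : k) (p q : {poly {poly k}}) : pe a b (p - q) = pe a b p - pe a b q.
Proof. by rewrite /pe raddfB hornerD hornerN. Qed.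
Lemma peM (k : fieldType) (a b : k) (p q : {poly {poly k}}) : pe a b (p * q) = pe a b p * pe a b q.
Proof. by rewrite rmorphM. Qed.
Lemma pe0 (k : fieldType) (a b : k) : pe a b 0 = 0.
Proof. by rewrite raddf0. Qed.
Lemma pe1 (k : fieldType) (a b : k) : pe a b 1 = 1.
Proof. by rewrite rmorph1. Qed.
Lemma peXn (k : fieldType) (a b : k) (p : {poly {poly k}}) n : pe a b (p ^+ n) = pe a b p ^+ n.
Proof. by rewrite rmorphXn. Qed.

Lemma peC (k : fieldType) (a b : k) p : pe a b p%:P = p.[a].
Proof. by rewrite /pe map_polyC hornerC. Qed.

Lemma peY (k : fieldType) (a b : k) p : pe a b p^:P = p.[b].
Proof.
rewrite /pe -map_poly_comp map_poly_id // => c _ /=.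
by rewrite /horner_eval hornerC.
Qed.

Lemma peZ (k : fieldType) (a b : k) p g : pe a b (p *: g) = p.[a] * pe a b g.
Proof. by rewrite -mul_polyC rmorphM /= peC. Qed.

Lemma pe_Psi (k : fieldType) (a b : k) A D B :
  pe a b (Psi A D B) = A.[a] * B.[b] + D.[a].
Proof. by rewrite rmorphD /= peZ peY peC. Qed.

(** * Evaluation in an extension field and valuation rings *)

Section Evaluation.
Variables (k K : fieldType) (i : {rmorphism k -> K}).

Definition pu (u : K) (p : {poly k}) : K := (map_poly i p).[u].
HB.instance Definition _ (u : K) :=
  GRing.RMorphism.copy (pu u) (horner_eval u \o map_poly i).

Definition ev (u v : K) (g : {poly {poly k}}) : K := (map_poly (pu u) g).[v].
HB.instance Definition _ (u v : K) :=
  GRing.RMorphism.copy (ev u v) (horner_eval v \o map_poly (pu u)).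

Lemma puD u (p q : {poly k}) : pu u (p + q) = pu u p + pu u q.
Proof. by rewrite raddfD. Qed.
Lemma puM u (p q : {poly k}) : pu u (p * q) = pu u p * pu u q.
Proof. by rewrite rmorphM. Qed.
Lemma puN u (p : {poly k}) : pu u (- p) = - pu u p.
Proof. by rewrite /pu raddfN hornerN. Qed.
Lemma pu0 u : pu u 0 = 0.
Proof. by rewrite raddf0. Qed.
Lemma pu1 u : pu u 1 = 1.
Proof. by rewrite rmorph1. Qed.
Lemma puXn u (p : {poly k}) n : pu u (p ^+ n) = pu u p ^+ n.
Proof. by rewrite rmorphXn. Qed.
Lemma evD u v (p q : {poly {poly k}}) : ev u v (p + q) = ev u v p + ev u v q.
Proof. by rewrite raddfD. Qed.
Lemma evB u v (p q : {poly {poly k}}) : ev u v (p - q) = ev u v p - ev u v q.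
Proof. by rewrite /ev raddfB hornerD hornerN. Qed.
Lemma evM u v (p q : {poly {poly k}}) : ev u v (p * q) = ev u v p * ev u v q.
Proof. by rewrite rmorphM. Qed.
Lemma evN u v (p : {poly {poly k}}) : ev u v (- p) = - ev u v p.
Proof. by rewrite /ev raddfN hornerN. Qed.
Lemma ev0 u v : ev u v 0 = 0.
Proof. by rewrite raddf0. Qed.
Lemma ev1 u v : ev u v 1 = 1.
Proof. by rewrite rmorph1. Qed.

Lemma puC u a : pu u a%:P = i a.
Proof. by rewrite /pu map_polyC hornerC. Qed.

Lemma puX u : pu u 'X = u.
Proof. by rewrite /pu map_polyX hornerX. Qed.

Lemma puZ u a p : pu u (a *: p) = i a * pu u p.
Proof. by rewrite -mul_polyC rmorphM /= puC. Qed.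

Lemma puXsubC u a : pu u ('X - a%:P) = u - i a.
Proof. by rewrite rmorphB /= puX puC. Qed.

Lemma evC u v p : ev u v p%:P = pu u p.
Proof. by rewrite /ev map_polyC hornerC. Qed.

Lemma evX u v : ev u v 'X = v.
Proof. by rewrite /ev map_polyX hornerX. Qed.

Lemma evY u v p : ev u v p^:P = pu v p.
Proof.
rewrite /ev -map_poly_comp /pu; congr (_.[_]); apply: eq_map_poly => c /=.
by rewrite puC.
Qed.

Lemma evZ u v p g : ev u v (p *: g) = pu u p * ev u v g.
Proof. by rewrite -mul_polyC rmorphM /= evC. Qed.

Lemma ev_Psi u v A D B : ev u v (Psi A D B) = pu u A * pu v B + pu u D.
Proof. by rewrite rmorphD /= evZ evY evC. Qed.

Lemma pu_expand u p : pu u p = \sum_(j < size p) i p`_j * u ^+ j.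
Proof. by rewrite /pu horner_poly; under eq_bigr => j _ do rewrite ?coef_map. Qed.

Lemma ev_expand u v g : ev u v g = \sum_(j < size g) pu u g`_j * v ^+ j.
Proof.
rewrite /ev -[g in LHS]coefK poly_def rmorph_sum horner_sum; apply: eq_bigr => j _ /=.
by rewrite linearZ /= map_polyXn hornerZ hornerXn.
Qed.

Lemma pu_point u a p : exists q, pu u p - i p.[a] = (u - i a) * pu u q.
Proof.
have [|q qE] := @root_factor _ (p - p.[a]%:P) a.
  by rewrite rootE hornerD hornerN hornerC subrr.
exists q; rewrite -[u - i a]puXsubC -rmorphM /= -qE rmorphB /= puC.
by [].
Qed.

Definition place (O : K -> Prop) :=
  [/\ forall a, O (i a),
      forall z w, O z -> O w -> O (z - w),
      forall z w, O z -> O w -> O (z * w),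
      exists z, ~ O z
    & forall z, O z \/ O z^-1].

(* The nonunits of the valuation ring O. *)
Definition mI (O : K -> Prop) z := z = 0 \/ ~ O z^-1.

Section Place.
Variables (O : K -> Prop) (pO : place O).

Lemma plC a : O (i a). Proof. by have [] := pO. Qed.
Lemma plB z w : O z -> O w -> O (z - w). Proof. by have [_ H _ _ _] := pO; apply: H. Qed.
Lemma plM z w : O z -> O w -> O (z * w). Proof. by have [_ _ H _ _] := pO; apply: H. Qed.
Lemma plV z : O z \/ O z^-1. Proof. by by have [_ _ _ _ H] := pO; exact: (H z). Qed.
Lemma pl0 : O 0. Proof. by rewrite -(rmorph0 i); exact: plC. Qed.
Lemma pl1 : O 1. Proof. by rewrite -(rmorph1 i); exact: plC. Qed.
Lemma plN z : O z -> O (- z). Proof. by rewrite -sub0r; apply: plB pl0. Qed.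
Lemma plD z w : O z -> O w -> O (z + w).
Proof. by move=> Oz Ow; rewrite -[w]opprK; apply: plB => //; apply: plN. Qed.
Lemma plX z n : O z -> O (z ^+ n).
Proof.
by move=> Oz; elim: n => [|n IH]; rewrite ?expr0 ?exprS; [exact: pl1|exact: plM].
Qed.
Lemma pl_sum I (s : seq I) (P : pred I) F :
  (forall j, P j -> O (F j)) -> O (\sum_(j <- s | P j) F j).
Proof. by move=> H; elim/big_ind: _ => //; [exact: pl0 | exact: plD]. Qed.
Lemma pl_pu u p : O u -> O (pu u p).
Proof.
move=> Ou; rewrite pu_expand; apply: pl_sum => j _.
by apply: plM (plC _) (plX _ Ou).
Qed.
Lemma pl_ev u v g : O u -> O v -> O (ev u v g).
Proof.
move=> Ou Ov; rewrite ev_expand; apply: pl_sum => j _.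
by apply: plM (pl_pu _ Ou) (plX _ Ov).
Qed.

Lemma mI_pl z : mI O z -> O z.
Proof. by case=> [->|nO]; [exact: pl0 | have [|/nO] := plV z]. Qed.
Lemma mI0 : mI O 0. Proof. by left. Qed.
Lemma mI1 : ~ mI O 1.
Proof. by case=> [/eqP|]; [rewrite oner_eq0|rewrite invr1 => /(_ pl1)]. Qed.
Lemma mIM z w : O z -> mI O w -> mI O (z * w).
Proof.
move=> Oz [->|nO]; first by left; rewrite mulr0.
have [->|z0] := eqVneq z 0; first by left; rewrite mul0r.
right => zw; apply: nO; have := plM Oz zw.
by rewrite invfM mulrA divff // mul1r.
Qed.
Lemma mIMr z w : mI O z -> O w -> mI O (z * w).
Proof. by move=> mz Ow; rewrite mulrC; apply: mIM. Qed.
Lemma mIV z : ~ O z -> mI O z^-1. Proof. by move=> nz; right; rewrite invrK. Qed.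
Lemma mI_unit z : O z -> ~ mI O z -> O z^-1.
Proof.
move=> Oz nm; case: (EM (O z^-1)) => // nO; by case: nm; right.
Qed.
Lemma mID z w : mI O z -> mI O w -> mI O (z + w).
Proof.
have H x y : x != 0 -> mI O x -> O (y / x) -> mI O (x + y).
  move=> x0 mx Oyx.
  have -> : x + y = (1 + y / x) * x by field.
  exact: mIM (plD pl1 Oyx) mx.
move=> mz mw.
have [z0|z0] := eqVneq z 0; first by rewrite z0 add0r.
have [w0|w0] := eqVneq w 0; first by rewrite w0 addr0.
have [|] := plV (w / z); first exact: H.
by rewrite invf_div addrC; apply: H.
Qed.
Lemma mIN z : mI O z -> mI O (- z).
Proof. by move=> mz; rewrite -mulN1r; apply: mIM mz; apply: plN pl1. Qed.
Lemma mIB z w : mI O z -> mI O w -> mI O (z - w).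
Proof. by move=> mz mw; apply: mID => //; apply: mIN. Qed.
Lemma mI_prime z w : O z -> O w -> mI O (z * w) -> mI O z \/ mI O w.
Proof.
move=> Oz Ow mzw; case: (EM (mI O z)) => [|nz]; [by left|right].
have [z0|z0] := eqVneq z 0; first by case: nz; left.
by have := mIM (mI_unit Oz nz) mzw; rewrite mulKf.
Qed.
Lemma mIC a : mI O (i a) -> a = 0.
Proof.
move=> ma; apply/eqP; case: eqVneq => // a0; case: mI1.
by have := mIM (plC a^-1) ma; rewrite -rmorphM mulVf // rmorph1.
Qed.
Lemma mIXS z n : mI O z -> (0 < n)%N -> mI O (z ^+ n).
Proof. by case: n => // n mz _; rewrite exprS; apply: mIMr (plX _ (mI_pl mz)). Qed.
Lemma mI_sum I (s : seq I) (P : pred I) F :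
  (forall j, P j -> mI O (F j)) -> mI O (\sum_(j <- s | P j) F j).
Proof. by move=> H; elim/big_ind: _ => //; [exact: mI0 | exact: mID]. Qed.

(** No residue field is formed: [mI O (z - i a)] expresses that z has residue a at O, and the lemmas
    that follow make this relation compatible with the ring operations. *)
Lemma mI_pu u a p : O u -> mI O (u - i a) -> mI O (pu u p - i p.[a]).
Proof.
by move=> Ou mu; have [q ->] := pu_point u a p; apply: mIMr => //; apply: pl_pu.
Qed.
Lemma pl_res u a : mI O (u - i a) -> O u.
Proof. by move=> mu; rewrite -[u](subrK (i a)); apply: plD (mI_pl mu) (plC _). Qed.
Lemma mI_resM z w a b :
  mI O (z - i a) -> mI O (w - i b) -> mI O (z * w - i (a * b)).
Proof.
move=> mz mw; rewrite rmorphM.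
have -> : z * w - i a * i b = z * (w - i b) + i b * (z - i a) by ring.
by apply: mID; apply: mIM => //; [exact: pl_res mz | exact: plC].
Qed.
Lemma mI_resD z w a b :
  mI O (z - i a) -> mI O (w - i b) -> mI O (z + w - i (a + b)).
Proof.
move=> mz mw; rewrite rmorphD.
have -> : z + w - (i a + i b) = (z - i a) + (w - i b) by ring.
exact: mID.
Qed.
Lemma mI_resX z a n : mI O (z - i a) -> mI O (z ^+ n - i (a ^+ n)).
Proof.
move=> mz; elim: n => [|n IH]; first by rewrite !expr0 rmorph1 subrr; exact: mI0.
by rewrite !exprS; exact: mI_resM.
Qed.
Lemma mI_res_uniq z a b : mI O (z - i a) -> mI O (z - i b) -> a = b.
Proof.
move=> ma mb; have := mIB mb ma.
have -> : z - i b - (z - i a) = i (a - b) by rewrite rmorphB; ring.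
by move=> /mIC /eqP; rewrite subr_eq0 => /eqP.
Qed.
Lemma mI_ev u v a b g :
  mI O (u - i a) -> mI O (v - i b) -> mI O (ev u v g - i (pe a b g)).
Proof.
move=> mu mv; elim/poly_ind: g => [|g p IH].
  by rewrite !rmorph0 subrr; exact: mI0.
rewrite !rmorphD !rmorphM /= evX evC peC.
have -> : pe a b 'X = b by rewrite /pe map_polyX hornerX.
rewrite -[i (pe a b g) * _]rmorphM -[_ + i p.[a]]rmorphD.
apply: mI_resD; first exact: mI_resM.
by apply: mI_pu => //; apply: pl_res mu.
Qed.

Lemma mI_unit_res z a : mI O (z - i a) -> a != 0 -> O z^-1.
Proof.
move=> mz a0; apply: mI_unit; first exact: pl_res mz.
move=> m; have := mIB m mz; rewrite subKr => /mIC E; by rewrite E eqxx in a0.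
Qed.

(** Valuation rings are integrally closed: if w were a pole, dividing p(w) by w^(deg p) would put
    the leading coefficient of p, a nonzero constant, in the maximal ideal. *)
Lemma pl_pu_inf w (p : {poly k}) : (1 < size p)%N -> O (pu w p) -> O w.
Proof.
move=> sp Op; apply: contrapT => nw; have mw := mIV nw.
have w0 : w != 0 by apply/eqP => w0; apply: nw; rewrite w0; exact: pl0.
have : mI O (i (lead_coef p)).
  have -> : i (lead_coef p) = pu w p * w^-1 ^+ (size p).-1
     - \sum_(j < (size p).-1) i p`_j * w^-1 ^+ ((size p).-1 - j).
    rewrite pu_expand; case: (size p) sp (lead_coefE p) => // n _ /= ->.
    rewrite big_ord_recr /= mulrDl -mulrA -exprMn divff // expr1n mulr1.
    rewrite addrAC big_distrl /= -sumrB big1 ?add0r // => j _.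
    rewrite -mulrA; apply/eqP; rewrite subr_eq0; apply/eqP; congr (_ * _).
    rewrite -{2}(subnK (ltnW (ltn_ord j))) addnC exprD mulrA -exprMn divff //.
    by rewrite expr1n mul1r.
  apply: mIB; first by apply: mIM => //; apply: mIXS => //; case: (size p) sp => [|[]].
  apply: mI_sum => j _; apply: mIM (plC _) _; apply: mIXS => //.
  by rewrite subn_gt0.
by move=> /mIC /eqP; rewrite lead_coef_eq0 => /eqP p0; rewrite p0 size_poly0 in sp.
Qed.
End Place.
End Evaluation.

(** * Local rings at smooth points of A(u) B(v) + D(u) = 0 *)

Section LocalRing.
Variables (k K : fieldType) (i : {rmorphism k -> K}).
Local Notation pu := (pu i).
Local Notation ev := (ev i).

(** One shape for all charts: A = L1, D = c for (x, y), and A = u^q L1(1/u), D = c u^q for (1/x, y);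
    exchanging the variables gives (1/y, x). [pm_eis] is the hypothesis of Eisenstein's
    criterion. *)
Record plane_model (A D B : {poly k}) (u v : K) : Prop := PlaneModel {
  pm_eis : exists r, [/\ root A r, A^`().[r] != 0 & D.[r] != 0];
  pm_size : (1 < size B)%N;
  pm_rel : ev u v (Psi A D B) = 0;
  pm_tr : forall p, p != 0 -> pu u p != 0;
  pm_gen : forall z, exists g h, ev u v h != 0 /\ z = ev u v g / ev u v h }.

Variables (A D B : {poly k}) (u v : K).
Hypothesis H : plane_model A D B u v.

Lemma pm_A0 : A != 0.
Proof. by have [r [_ /simple_root_neq0 A0 _]] := pm_eis H. Qed.

(** Denominators can be moved into k[u], that is, K is algebraic over k(u). In the first alternative
    of the dichotomy g would have value 0 at (u, v). *)
Lemma ev_bezout g : ev u v g != 0 ->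
  exists d t, d != 0 /\ ev u v t * ev u v g = pu u d.
Proof.
move=> g0; have [r [rA A1 D0]] := pm_eis H.
have [[n [c [Q [c0 E]]]]|[d [s [t [d0 E]]]]] :=
  Psi_dichotomy rA A1 D0 (pm_size H) g.
  have := congr1 (ev u v) E; rewrite evM pm_rel // mulr0 evZ => /eqP.
  rewrite mulf_eq0 (negbTE g0) orbF => e0; have : c *: A ^+ n != 0.
    by rewrite -mul_polyC mulf_neq0 ?polyC_eq0 ?expf_neq0 ?pm_A0.
  by move=> /(pm_tr H); rewrite e0.
exists d, t; split => //; have := congr1 (ev u v) E.
by rewrite evD !evM pm_rel // mulr0 add0r evC.
Qed.

(** This makes values at a point well defined on k[u, v]. The coprime alternative would give d(u) =
    0 against [pm_tr]; in the other one, evaluate at (a, b), where A^n does not vanish. *)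
Lemma ev0_pe g a b : ev u v g = 0 -> A.[a] != 0 -> A.[a] * B.[b] + D.[a] = 0 ->
  pe a b g = 0.
Proof.
move=> g0 Aa R; have [r [rA A1 D0]] := pm_eis H.
have [[n [c [Q [c0 E]]]]|[d [s [t [d0 E]]]]] :=
  Psi_dichotomy rA A1 D0 (pm_size H) g.
  have := congr1 (pe a b) E; rewrite peM pe_Psi R mulr0 peZ => /eqP.
  by rewrite hornerZ horner_exp !mulf_eq0 expf_eq0 (negbTE c0) (negbTE Aa) andbF => /eqP.
have := congr1 (ev u v) E.
rewrite evD !evM pm_rel // g0 !mulr0 addr0 evC => /esym/eqP.
by rewrite (negbTE (pm_tr H d0)).
Qed.

Variables (a b : k).
Hypotheses (Aa : A.[a] != 0) (R : A.[a] * B.[b] + D.[a] = 0) (B1 : B^`().[b] != 0).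

Definition loc (z : K) := exists g h, pe a b h != 0 /\ z = ev u v g / ev u v h.

Lemma pe_ev_neq0 h : pe a b h != 0 -> ev u v h != 0.
Proof. by apply: contraNneq => /ev0_pe ->. Qed.

Lemma loc_ev g : loc (ev u v g).
Proof. by exists g, 1; rewrite pe1 ev1 divr1 oner_neq0. Qed.

Lemma locB z w : loc z -> loc w -> loc (z - w).
Proof.
move=> [g [h [h0 ->]]] [g' [h' [h'0 ->]]]; exists (g * h' - g' * h), (h * h').
split; first by rewrite peM mulf_neq0.
rewrite evB !evM.
by rewrite -mulNr addf_div ?pe_ev_neq0 // mulNr.
Qed.

Lemma locM z w : loc z -> loc w -> loc (z * w).
Proof.
move=> [g [h [h0 ->]]] [g' [h' [h'0 ->]]]; exists (g * g'), (h * h').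
split; first by rewrite peM mulf_neq0.
by rewrite mulf_div !evM.
Qed.

(** Here smoothness enters. Modulo u - a both g and Psi are divisible by v - b, and the cofactor w
    of Psi has w(b) = A(a) B'(b), which is nonzero. Eliminating v - b between the two leaves a
    multiple of u - a. *)
Lemma loc_maximal g : pe a b g = 0 -> exists g1 h1,
  pe a b h1 != 0 /\ ev u v g * ev u v h1 = (u - i a) * ev u v g1.
Proof.
have split_a (G : {poly {poly k}}) : exists G1,
    G = (map_poly (horner_eval a) G)^:P + ('X - a%:P) *: G1.
  have [|G1 E] := @coef_root_factor _ a (G - (map_poly (horner_eval a) G)^:P).
    rewrite rmorphB /= -[X in _ - X]map_poly_comp [X in _ - X]map_poly_id ?subrr // => c _.
    by rewrite /= /horner_eval hornerC.
  by exists G1; rewrite -E addrC subrK.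
move=> g0; have [G EG] := split_a g; have [P1 EP] := split_a (Psi A D B).
have [|g1 Eg1] := @root_factor _ (map_poly (horner_eval a) g) b; first exact/eqP.
have PE : map_poly (horner_eval a) (Psi A D B) = A.[a] *: B + D.[a]%:P.
  apply/polyP => j; rewrite coef_map /= !coefD !coefZ coef_map !coefC /horner_eval.
  rewrite hornerD hornerM hornerC; congr (_ + _); by case: eqP; rewrite ?horner0.
have [|w Ew] := @root_factor _ (A.[a] *: B + D.[a]%:P) b.
  by rewrite rootE hornerD hornerZ hornerC R.
have w0 : w.[b] != 0.
  have := congr1 (fun p => p^`().[b]) Ew.
  rewrite derivD derivZ derivC addr0 hornerZ derivM derivXsubC mul1r.
  rewrite hornerD hornerM hornerXsubC subrr mul0r addr0 => <-.
  by rewrite mulf_neq0.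
exists (w^:P * G - g1^:P * P1), w^:P; rewrite peY; split=> //.
have := pm_rel H; rewrite EP PE Ew EG Eg1.
rewrite !(evD, evM, evN, evZ, evY, puM, puXsubC) => E.
apply/eqP; rewrite -subr_eq0; apply/eqP.
rewrite [LHS](_ : _ = pu v g1 * ((v - i b) * pu v w + (u - i a) * ev u v P1)).
  by rewrite E mulr0.
by ring.
Qed.

(** The order at (a, b) is finite because some multiple t g equals a polynomial d(u) in K: each
    factor u - a taken out of g is matched by one taken out of d. *)
Lemma loc_val g : ev u v g != 0 -> exists n g1 h1,
  [/\ pe a b g1 != 0, pe a b h1 != 0 &
      ev u v g * ev u v h1 = (u - i a) ^+ n * ev u v g1].
Proof.
move=> g0; have [d [t [d0 E]]] := ev_bezout g0.
(* The unit h, equal to 1 at the start, absorbs the denominators produced during the induction. *)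
have [h [h0 {}E]] : exists h, pe a b h != 0 /\
    ev u v t * ev u v g = pu u d * ev u v h.
  by exists 1; rewrite pe1 ev1 oner_neq0 mulr1.
have [N] := ubnP (size d); elim: N d g h t d0 g0 h0 E => // N IH d g h t d0 g0 h0 E sd.
have [gz|gnz] := eqVneq (pe a b g) 0; last first.
  by exists 0%N, g, 1; rewrite pe1 oner_neq0 expr0 mul1r ev1 mulr1.
have [g1 [h1 [h10 E1]]] := loc_maximal gz.
have ua0 : u - i a != 0 by rewrite -puXsubC (pm_tr H) // polyXsubC_eq0.
have : pe a b (t * g - d%:P * h) = 0.
  by apply: ev0_pe => //; rewrite evB !evM E evC subrr.
rewrite peB !peM gz mulr0 peC sub0r => /eqP; rewrite oppr_eq0.
rewrite mulf_eq0 (negbTE h0) orbF => /root_factor[d1 Ed].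
have d10 : d1 != 0 by apply: contraNneq d0 => d10; rewrite Ed d10 mulr0.
have g10 : ev u v g1 != 0.
  by apply: contraTneq (mulf_neq0 g0 (pe_ev_neq0 h10)) => g10; rewrite E1 g10 mulr0 eqxx.
have [|||||n [g2 [h2 [g20 h20 E2]]]] := IH d1 g1 (h * h1) t => //.
- by rewrite peM mulf_neq0.
- apply: (mulfI ua0); rewrite mulrCA -E1 mulrA E Ed puM puXsubC evM.
  by ring.
- by move: sd; rewrite Ed size_monicM ?monicXsubC // size_XsubC.
exists n.+1, g2, (h1 * h2); rewrite peM mulf_neq0 // evM mulrA E1 exprS.
by split=> //; rewrite -mulrA E2 mulrA.
Qed.

Lemma ua_neq0 : u - i a != 0.
Proof. by rewrite -puXsubC (pm_tr H) // polyXsubC_eq0. Qed.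

Lemma loc_pl_inv_ua : ~ loc (u - i a)^-1.
Proof.
move=> [g [h [h0 E]]]; have eh := pe_ev_neq0 h0.
have : pe a b (h - ('X - a%:P)%:P * g) = 0.
  apply: ev0_pe => //; rewrite evB evM evC puXsubC.
  have -> : ev u v g = (u - i a)^-1 * ev u v h by rewrite E divfK.
  by rewrite mulVKf ?subrr // ua_neq0.
rewrite peB peM peC hornerXsubC subrr mul0r subr0 => h0'.
by rewrite h0' eqxx in h0.
Qed.

Lemma loc_place : place i loc.
Proof.
split.
- by move=> c; rewrite -(puC i u) -(evC i u v); exact: loc_ev.
- exact: locB.
- exact: locM.
- by exists (u - i a)^-1; exact: loc_pl_inv_ua.
move=> z; have [g [h [h0 zE]]] := pm_gen H z.
have [z0|z0] := eqVneq z 0.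
  by left; rewrite z0 -(ev0 i u v); exact: loc_ev.
have g0 : ev u v g != 0 by apply: contraNneq z0 => g0; rewrite zE g0 mul0r.
have [n [g1 [g2 [g10 g20 Eg]]]] := loc_val g0.
have [m [h1 [h2 [h10 h20 Eh]]]] := loc_val h0.
have := (pe_ev_neq0 g10, pe_ev_neq0 g20, pe_ev_neq0 h10, pe_ev_neq0 h20) => -[[[? ?] ?] ?].
have u0 := ua_neq0.
have key : z * ((u - i a) ^+ m * ev u v (g2 * h1)) = (u - i a) ^+ n * ev u v (g1 * h2).
  rewrite zE !evM.
  apply: (@mulIf _ (ev u v h * ev u v h2)); first by rewrite mulf_neq0.
  transitivity ((ev u v g * ev u v g2) * ((u - i a) ^+ m * ev u v h1) * ev u v h2).
    by field.
  by rewrite Eg -Eh; ring.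
have uE n' : (u - i a) ^+ n' = ev u v (('X - a%:P) ^+ n')%:P.
  by rewrite evC puXn puXsubC.
have div m' n' g' h' : (n' <= m')%N -> pe a b h' != 0 ->
    z * ((u - i a) ^+ n' * ev u v h') = (u - i a) ^+ m' * ev u v g' -> loc z.
  move=> nm h'0 E; exists ((('X - a%:P) ^+ (m' - n'))%:P * g'), h'.
  split=> //; have eh := pe_ev_neq0 h'0; rewrite evM -uE.
  apply: (@mulIf _ ((u - i a) ^+ n' * ev u v h')).
    by rewrite mulf_neq0 // expf_neq0.
  by rewrite E -{1}(subnK nm) exprD; field.
have [mn|nm] := leqP m n.
  by left; apply: (div n m (g1 * h2) (g2 * h1)); rewrite ?peM ?mulf_neq0.
right; exists ((('X - a%:P) ^+ (m - n))%:P * (g2 * h1)), (g1 * h2).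
split; first by rewrite peM mulf_neq0.
have gh0 : ev u v (g1 * h2) != 0 by apply: pe_ev_neq0; rewrite peM mulf_neq0.
apply: (mulfI z0); rewrite divff //; apply: (mulIf (mulf_neq0 (expf_neq0 n u0) gh0)).
rewrite mul1r -{1}key [ev u v (_%:P * _)]evM -uE -{1}(subnK (ltnW nm)) exprD.
by field; rewrite !pe_ev_neq0.
Qed.

Lemma loc_mI z : mI loc z -> loc (z / (u - i a)).
Proof.
move=> mz; have [g [h [h0 E]]] := mI_pl loc_place mz.
have [gz|gnz] := eqVneq (pe a b g) 0; last first.
  case: mz => [z0|[]]; last by exists h, g; rewrite E invf_div.
  have := pe_ev_neq0 gnz; have := pe_ev_neq0 h0 => eh eg.
  by have := mulf_neq0 eg (invr_neq0 eh); rewrite -E z0 eqxx.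
have [g1 [h1 [h10 E1]]] := loc_maximal gz.
exists g1, (h * h1); rewrite peM mulf_neq0 //; split=> //; rewrite evM.
have := (pe_ev_neq0 h0, pe_ev_neq0 h10, ua_neq0) => -[[? ?] ?].
have -> : ev u v g1 = ev u v g * ev u v h1 / (u - i a) by rewrite E1; field.
by rewrite E; field; do ?[apply/andP; split].
Qed.

Lemma mI_loc_u : mI loc (u - i a).
Proof. by right; exact: loc_pl_inv_ua. Qed.

Lemma mI_loc_pe0 g : pe a b g = 0 -> mI loc (ev u v g).
Proof.
move=> /loc_maximal[g1 [h1 [h10 E]]]; have eh := pe_ev_neq0 h10.
have -> : ev u v g = (u - i a) * (ev u v g1 / ev u v h1) by rewrite mulrA -E mulfK.
by apply: (mIMr loc_place mI_loc_u); exists g1, h1.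
Qed.

Lemma mI_loc_v : mI loc (v - i b).
Proof.
have -> : v - i b = ev u v ('X - b%:P%:P) by rewrite evB evX evC puC.
apply: mI_loc_pe0; rewrite peB peC hornerC.
by rewrite /pe map_polyX hornerX subrr.
Qed.

Lemma loc_residue z : loc z -> exists c, mI loc (z - i c).
Proof.
move=> [g [h [h0 ->]]]; exists (pe a b g / pe a b h).
have eh := pe_ev_neq0 h0.
have -> : ev u v g / ev u v h - i (pe a b g / pe a b h)
  = ev u v (g - ((pe a b g / pe a b h)%:P)%:P * h) / ev u v h.
  by rewrite evB evM evC puC mulrBl mulfK.
apply: (mIMr loc_place).
  by apply: mI_loc_pe0; rewrite peB peM peC hornerC divfK ?subrr.
by exists 1, h; rewrite ev1 div1r.
Qed.

(** O contains the local ring because its denominators are units of O. Conversely, if z lies in O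
    but not in the local ring, then z^-1 / (u - a) lies in the local ring, hence in O, and 1 becomes
    a multiple of u - a in O. *)
Lemma loc_unique (O : K -> Prop) : place i O ->
  mI O (u - i a) -> mI O (v - i b) -> forall z, O z <-> loc z.
Proof.
move=> pO mu mv.
have sub z : loc z -> O z.
  move=> [g [h [h0 ->]]]; apply: (plM pO); last first.
    exact: (mI_unit_res pO (mI_ev pO h mu mv) h0).
  by apply: (pl_ev pO); [exact: pl_res mu | exact: pl_res mv].
move=> z; split; last exact: sub.
move=> Oz; apply: contrapT => nz; have := loc_mI (mIV nz) => /sub Ow.
have := mIM pO (plM pO Oz Ow) mu.
have z0 : z != 0.
  by apply/eqP => z0; apply: nz; rewrite z0 -(ev0 i u v); exact: loc_ev.
have u0 := ua_neq0.
have -> : z * (z^-1 / (u - i a)) * (u - i a) = 1 by field; rewrite z0 u0.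
exact: (mI1 pO).
Qed.
End LocalRing.

(** * The function field and its places *)

Section AdditivePolynomial.
Variables (k : closedFieldType) (q : nat).

(** These properties are all that the geometric argument knows of L_1 and L_2; [p], [e] and the
    coefficients return only in [additive_poly_sep]. *)
Record additive_sep (L : {poly k}) : Prop := AdditiveSep {
  additive_sep_size : size L = q.+1;
  additive_sep_deriv : exists2 a, a != 0 & L^`() = a%:P;
  additive_sep_add : forall x y, L.[x + y] = L.[x] + L.[y] }.

Variable L : {poly k}.
Hypothesis gL : additive_sep L.

Lemma additive_sep0 : L.[0] = 0.
Proof.
by have := additive_sep_add gL 0 0; rewrite addr0 => /eqP; rewrite -subr_eq0 opprD addNKr oppr_eq0 => /eqP.
Qed.

Lemma additive_sep_neq0 : L != 0.
Proof. by rewrite -size_poly_gt0 (additive_sep_size gL). Qed.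

Lemma additive_sep_deriv_neq0 a : L^`().[a] != 0.
Proof. by have [d d0 ->] := additive_sep_deriv gL; rewrite hornerC. Qed.

Lemma additive_sep_fiber (q0 : (0 < q)%N) s : exists rs : seq k,
  [/\ uniq rs, size rs = q & forall b, (b \in rs) = (L.[b] == s)].
Proof.
have sz : size (L - s%:P) = q.+1.
  rewrite size_polyDl (additive_sep_size gL) // size_polyN size_polyC.
  by apply: leq_ltn_trans (leq_b1 _) _.
have n0 : L - s%:P != 0 by rewrite -size_poly_gt0 sz.
have [rs E] := closed_field_poly_normal (L - s%:P).
have l0 : lead_coef (L - s%:P) != 0 by rewrite lead_coef_eq0.
exists rs; split.
- have : separable_poly (L - s%:P).
    rewrite unlock derivB derivC subr0; have [d d0 ->] := additive_sep_deriv gL.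
    by rewrite coprimep_sym -[d%:P]alg_polyC coprimepZl // coprime1p.
  by rewrite E (eqp_separable (eqp_scale _ l0)) separable_prod_XsubC.
- by move: sz; rewrite E size_scale // size_prod_XsubC => -[].
move=> b; rewrite -root_prod_XsubC -(rootZ _ _ l0) -E rootE hornerD hornerN hornerC.
by rewrite subr_eq0.
Qed.

(** The reciprocal polynomial u^q L(1/u), which describes L near infinity. *)
Definition rev_poly : {poly k} := \poly_(j < q.+1) L`_(q - j).

Lemma rev_poly0 : rev_poly.[0] != 0.
Proof.
rewrite horner_coef0 coef_poly /= subn0.
by have := additive_sep_neq0; rewrite -lead_coef_eq0 lead_coefE (additive_sep_size gL).
Qed.

(** Since L' is the constant a, j times the j-th coefficient of L is 0 unless j = 1. Hence a single
    correction term, which at a root forces a nonzero derivative. *)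
Lemma deriv_rev_poly a : (0 < q)%N -> L^`() = a%:P ->
  'X * rev_poly^`() = q%:R *: rev_poly - a *: 'X^(q.-1).
Proof.
move=> q0 dL; have c1 n : L`_n *+ n = a *+ (n == 1%N).
  case: n => // n; rewrite -coef_deriv dL coefC eqSS; by case: n.
apply/polyP => m; rewrite coefXM coefB !coefZ coefXn.
have -> : (if m == 0%N then 0 else rev_poly^`()`_m.-1) = rev_poly`_m *+ m.
  by case: m => // m; rewrite coef_deriv.
rewrite coef_poly ltnS; have [mq|qm] := leqP m q; last first.
  rewrite mul0rn mulr0 sub0r; have -> : (m == q.-1) = false.
    by apply/eqP => E; move: qm; rewrite E; case: q q0 => // n _; rewrite ltnNge leqnSn.
  by rewrite mulr0 oppr0.
rewrite mulr_natl -[X in _ = _ *+ X - _](subnK mq) mulrnDr c1.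
have -> : (q - m == 1)%N = (m == q.-1).
  by rewrite -(eqn_add2r m) subnK // add1n -(prednK q0) eqSS eq_sym.
by rewrite mulr_natr addrAC subrr add0r.
Qed.

Lemma rev_poly_root r : (0 < q)%N -> root rev_poly r -> rev_poly^`().[r] != 0.
Proof.
move=> q0 rr; have [a a0 dL] := additive_sep_deriv gL.
have r0 : r != 0 by apply: contraTneq rr => ->; rewrite rootE rev_poly0.
have := congr1 (fun p => p.[r]) (deriv_rev_poly q0 dL).
rewrite hornerM hornerX !(hornerD, hornerN, hornerZ) hornerXn (eqP rr) mulr0 sub0r => E.
have := mulf_neq0 a0 (expf_neq0 q.-1 r0); rewrite -oppr_eq0 -E.
by rewrite mulf_eq0 negb_or => /andP[].
Qed.
End AdditivePolynomial.

Lemma pu_rev_poly (k : closedFieldType) (K : fieldType) (i : {rmorphism k -> K}) q (L : {poly k}) u :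
  size L = q.+1 -> u != 0 -> pu i u L = u ^+ q * pu i u^-1 (rev_poly q L).
Proof.
move=> sL u0; rewrite pu_expand sL.
have -> : pu i u^-1 (rev_poly q L) = \sum_(j < q.+1) i L`_(q - j) * u^-1 ^+ j.
  rewrite /pu /rev_poly (@horner_coef_wide _ q.+1).
    by apply: eq_bigr => j _; rewrite coef_map coef_poly ltn_ord.
  by apply: leq_trans (size_poly _ _) _; exact: size_poly.
rewrite big_distrr /= (reindex_inj rev_ord_inj) /=; apply: eq_bigr => j _.
rewrite subSS mulrCA exprVn; congr (_ * _).
have : (j <= q)%N by rewrite -ltnS.
move: (nat_of_ord j) => m mq.
by rewrite -[X in _ = _ ^+ X / _](subnK mq) exprD mulfK ?expf_neq0.
Qed.

Section Curve.
Variables (k : closedFieldType) (K : fieldType) (i : {rmorphism k -> K}).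
Variables (q : nat) (c : k).
Hypotheses (q_gt1 : (1 < q)%N) (c0 : c != 0).
Local Notation pu := (pu i).
Local Notation ev := (ev i).
Local Notation additive_sep := (additive_sep q).

(* An automorphism phi of K / k is studied through the pair (phi x, phi y), which
   is again a curve_model on the same K. *)
Record curve_model (L1 L2 : {poly k}) (x y : K) : Prop := CurveModel {
  cm_good1 : additive_sep L1;
  cm_good2 : additive_sep L2;
  cm_rel : pu x L1 * pu y L2 = - i c;
  cm_tr : forall p, p != 0 -> pu x p != 0;
  cm_gen : forall z, exists g h, ev x y h != 0 /\ z = ev x y g / ev x y h }.

Lemma pu_root (u : K) p : p != 0 -> pu u p = 0 -> exists b, u = i b.
Proof.
move=> p0; have [rs ->] := closed_field_poly_normal p.
rewrite puZ => /eqP; rewrite mulf_eq0 fmorph_eq0 lead_coef_eq0 (negbTE p0) /=.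
elim: rs => [|b rs IH]; first by rewrite big_nil pu1 oner_eq0.
rewrite big_cons puM mulf_eq0 puXsubC subr_eq0 => /orP[/eqP ->|/IH //].
by exists b.
Qed.

Lemma pu_neq0 (u : K) : (forall b, u != i b) -> forall p, p != 0 -> pu u p != 0.
Proof.
by move=> nu p p0; apply/eqP => /(pu_root p0)[b E]; move: (nu b); rewrite E eqxx.
Qed.

Lemma pu_const a p : pu (i a) p = i p.[a].
Proof. by rewrite /pu horner_map. Qed.

Lemma cm_const L1 L2 x y b : curve_model L1 L2 x y -> x != i b.
Proof.
move=> H; apply/eqP => E; have := cm_tr H (negbT (polyXsubC_eq0 b)).
by rewrite puXsubC E subrr eqxx.
Qed.

Lemma ev_swap x y g : ev x y (swapXY g) = ev y x g.
Proof.
elim/poly_ind: g => [|g p IH]; first by rewrite !raddf0.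
rewrite rmorphD rmorphM /= swapXY_X swapXY_polyC !(evD, evM) IH evY evX evC.
by rewrite /ev map_polyC /= hornerC puX.
Qed.

Lemma cm_swap L1 L2 x y : curve_model L1 L2 x y -> curve_model L2 L1 y x.
Proof.
move=> H; split; [exact: cm_good2 H | exact: cm_good1 H | | | ].
- by rewrite mulrC (cm_rel H).
(* If y were a constant b, then x would be a root of L2(b) L1 + c, a nonzero polynomial since its
   value at 0 is c. *)
- apply: pu_neq0 => b; apply/eqP => E.
  have := cm_rel H; rewrite E pu_const => /eqP; rewrite -subr_eq0 opprK.
  have -> : pu x L1 * i L2.[b] + i c = pu x (L2.[b] *: L1 + c%:P).
    by rewrite puD puZ puC mulrC.
  apply/negP; apply: (cm_tr H); apply/eqP => /(congr1 (fun p : {poly k} => p.[0])).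
  rewrite hornerD hornerZ hornerC (additive_sep0 (cm_good1 H)) mulr0 add0r horner0.
  exact/eqP.
move=> z; have [g [h [h0 ->]]] := cm_gen H z.
by exists (swapXY g), (swapXY h); rewrite !ev_swap.
Qed.

Variables (L1 L2 : {poly k}) (x y : K).
Hypothesis H : curve_model L1 L2 x y.

Let q_gt0 : (0 < q)%N := ltnW q_gt1.

Lemma cm_affine : plane_model i L1 c%:P L2 x y.
Proof.
split.
- exists 0; rewrite rootE (additive_sep0 (cm_good1 H)) hornerC; split=> //.
  exact: additive_sep_deriv_neq0 (cm_good1 H) _.
- by rewrite (additive_sep_size (cm_good2 H)) ltnS.
- by rewrite ev_Psi (cm_rel H) puC addNr.
- exact: cm_tr H.
exact: cm_gen H.
Qed.

Lemma ev_inv (u v : K) (g : {poly {poly k}}) : u != 0 ->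
  exists N, forall n, (N <= n)%N -> exists g', ev u v g = u ^+ n * ev u^-1 v g'.
Proof.
move=> u0; elim/poly_ind: g => [|g p [N IH]].
  by exists 0%N => n _; exists 0; rewrite !ev0 mulr0.
exists (maxn N (size p)) => n; rewrite geq_max => /andP[Nn pn].
have [g' Eg] := IH n Nn.
exists (g' * 'X + (\poly_(j < n.+1) p`_(n - j))%:P).
rewrite !(evD, evM) !evX !evC Eg mulrDr mulrA; congr (_ + _).
rewrite /pu [LHS](@horner_coef_wide _ n.+1); last first.
  by apply: leq_trans (size_poly _ _) _; apply: leqW.
rewrite [X in _ * X](@horner_coef_wide _ n.+1); last first.
  by apply: leq_trans (size_poly _ _) _; exact: size_poly.
rewrite big_distrr /= (reindex_inj rev_ord_inj) /=; apply: eq_bigr => j _.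
rewrite subSS !coef_map coef_poly ltn_ord /= mulrCA exprVn; congr (_ * _).
have : (j <= n)%N by rewrite -ltnS.
move: (nat_of_ord j) => m mq.
by rewrite -[X in _ = _ ^+ X / _](subnK mq) exprD mulfK ?expf_neq0.
Qed.

Lemma x_neq0 : x != 0.
Proof. by rewrite -(rmorph0 i); exact: cm_const H. Qed.

Lemma cm_infinity : plane_model i (rev_poly q L1) (c *: 'X^q) L2 x^-1 y.
Proof.
have sL1 := additive_sep_size (cm_good1 H).
split.
(* As q > 1, L1 has a nonzero root a. Eisenstein applies at 1/a, a simple root of the reciprocal
   polynomial at which c u^q does not vanish. *)
- have [rs [urs srs rsE]] := additive_sep_fiber (cm_good1 H) q_gt0 0.
  have [a ars a0] : exists2 a, a \in rs & a != 0.
    case: rs urs srs {rsE} => [|a [|b rs]] /=; [by move: q_gt0; case: q | by move: q_gt1; case: q => [|[]] | ].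
    case/andP; rewrite inE negb_or => /andP[ab _] _ _.
    have [a0|a0] := eqVneq a 0; last by exists a => //; rewrite mem_head.
    by exists b; rewrite ?inE ?eqxx ?orbT // eq_sym -a0.
  have ra : root (rev_poly q L1) a^-1.
    have ia0 : i a != 0 by rewrite fmorph_eq0.
    have := pu_rev_poly i sL1 ia0; rewrite -fmorphV !pu_const => E.
    move: ars; rewrite rsE -(fmorph_eq0 i) E mulf_eq0 expf_eq0 (negbTE ia0) andbF.
    by rewrite fmorph_eq0.
  have := rev_poly_root (cm_good1 H) q_gt0 ra. exists a^-1; split=> //.
  by rewrite hornerZ hornerXn mulf_neq0 // expf_neq0 // invr_eq0.
- by rewrite (additive_sep_size (cm_good2 H)) ltnS.
- rewrite ev_Psi puZ puXn puX; apply: (mulfI (expf_neq0 q x_neq0)).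
  rewrite mulr0 mulrDr mulrA -pu_rev_poly ?x_neq0 // (cm_rel H) mulrCA -exprMn.
  by rewrite divff ?x_neq0 // expr1n mulr1 addNr.
- apply: pu_neq0 => b; apply/eqP => E; have := cm_const b^-1 H.
  by rewrite fmorphV -E invrK eqxx.
move=> z; have [g [h [h0 ->]]] := cm_gen H z.
have [N Ng] := ev_inv y g x_neq0; have [M Mh] := ev_inv y h x_neq0.
have [g' Eg] := Ng (maxn N M) (leq_maxl _ _).
have [h' Eh] := Mh (maxn N M) (leq_maxr _ _).
exists g', h'; split; first by apply: contraNneq h0 => h'0; rewrite Eh h'0 mulr0.
by rewrite Eg Eh -mulf_div divff ?mul1r // expf_neq0 // x_neq0.
Qed.

Definition aff a b := loc i x y a b.
(** The point (oo, b), for b a root of L2. Points with y = oo are obtained from the swapped model,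
    as [inf i y x a]. *)
Definition inf b := loc i x^-1 y 0 b.

Definition on_curve a b := L1.[a] * L2.[b] + c == 0.

Lemma on_curve_neq0 a b : on_curve a b -> (L1.[a] != 0) && (L2.[b] != 0).
Proof.
apply: contraTT; rewrite -negb_or negbK -mulf_eq0 => /eqP.
by rewrite /on_curve => ->; rewrite add0r.
Qed.

Section AffinePoint.
Variables (a b : k).
Hypothesis ab : on_curve a b.

Let La : L1.[a] != 0. Proof. by have /andP[] := on_curve_neq0 ab. Qed.
Let Lb : L2^`().[b] != 0. Proof. exact: additive_sep_deriv_neq0 (cm_good2 H) b. Qed.
Let R : L1.[a] * L2.[b] + c%:P.[a] = 0. Proof. by rewrite hornerC; apply/eqP. Qed.

Lemma aff_place : place i (aff a b). Proof. exact: (loc_place cm_affine La R Lb). Qed.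
Lemma aff_x : mI (aff a b) (x - i a). Proof. exact (mI_loc_u cm_affine La R). Qed.
Lemma aff_y : mI (aff a b) (y - i b). Proof. exact (mI_loc_v cm_affine La R Lb). Qed.
Lemma aff_mI z : mI (aff a b) z -> aff a b (z / (x - i a)).
Proof. apply: (loc_mI cm_affine La R Lb). Qed.
Lemma aff_residue z : aff a b z -> exists c, mI (aff a b) (z - i c).
Proof. apply: (loc_residue cm_affine La R Lb). Qed.
Lemma aff_unique (O : K -> Prop) : place i O ->
  mI O (x - i a) -> mI O (y - i b) -> forall z, O z <-> aff a b z.
Proof. apply: (loc_unique cm_affine La R Lb). Qed.
Lemma ev0_on_curve g : ev x y g = 0 -> pe a b g = 0.
Proof. by move=> g0; apply: (ev0_pe cm_affine) => //. Qed.
End AffinePoint.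

Section InfinitePoint.
Variable b : k.
Hypothesis rb : root L2 b.

Let La : (rev_poly q L1).[0] != 0. Proof. exact: rev_poly0 (cm_good1 H). Qed.
Let Lb : L2^`().[b] != 0. Proof. exact: additive_sep_deriv_neq0 (cm_good2 H) b. Qed.
Let R : (rev_poly q L1).[0] * L2.[b] + (c *: 'X^q).[0] = 0.
Proof.
rewrite (eqP rb) mulr0 hornerZ hornerXn expr0n.
by case: q q_gt0 => // n _; rewrite mulr0 addr0.
Qed.

Lemma inf_place : place i (inf b). Proof. exact: (loc_place cm_infinity La R Lb). Qed.
Lemma inf_x : mI (inf b) x^-1.
Proof. by have := mI_loc_u cm_infinity La R; rewrite rmorph0 subr0. Qed.
Lemma inf_y : mI (inf b) (y - i b). Proof. exact (mI_loc_v cm_infinity La R Lb). Qed.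
Lemma inf_residue z : inf b z -> exists c, mI (inf b) (z - i c).
Proof. apply: (loc_residue cm_infinity La R Lb). Qed.
Lemma inf_unique (O : K -> Prop) : place i O ->
  mI O x^-1 -> mI O (y - i b) -> forall z, O z <-> inf b z.
Proof.
move=> pO mx my; apply: (loc_unique cm_infinity La R Lb pO) => //.
by rewrite rmorph0 subr0.
Qed.
End InfinitePoint.

Lemma cm_bezout g : ev x y g != 0 ->
  exists d t, d != 0 /\ ev x y t * ev x y g = pu x d.
Proof. apply: (ev_bezout cm_affine). Qed.

Lemma mI_pu_root O u p : place i O -> O u -> p != 0 -> mI O (pu u p) ->
  exists2 a, root p a & mI O (u - i a).
Proof.
move=> pO Ou p0; have [rs E] := closed_field_poly_normal p.
have l0 : lead_coef p != 0 by rewrite lead_coef_eq0.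
rewrite {1}E puZ => m; have {m} : mI O (pu u (\prod_(z <- rs) ('X - z%:P))).
  by have := mIM pO (plC pO (lead_coef p)^-1) m; rewrite mulrA -rmorphM mulVf // rmorph1 mul1r.
have sub a : a \in rs -> root p a by rewrite E rootZ // root_prod_XsubC.
elim: rs sub {E} => [|a rs IH] sub; first by rewrite big_nil pu1 => /(mI1 pO).
rewrite big_cons puM => m.
have [] := mI_prime pO (pl_pu pO _ Ou) (pl_pu pO _ Ou) m.
  by rewrite puXsubC; exists a => //; apply: sub; rewrite mem_head.
by apply: IH => b br; apply: sub; rewrite inE br orbT.
Qed.

(** At a pole of x, L1(x) has a pole, so L2(y) = -c / L1(x) vanishes there; y is then integral and
    its residue is a root of L2. *)
Lemma place_pole_y O : place i O -> ~ O x -> exists2 b, root L2 b & mI O (y - i b).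
Proof.
move=> pO nx; have sL := (additive_sep_size (cm_good1 H), additive_sep_size (cm_good2 H)).
have nL : ~ O (pu x L1) by move/(pl_pu_inf pO); rewrite sL ltnS => /(_ q_gt0).
have mL2 : mI O (pu y L2).
  have -> : pu y L2 = - i c * (pu x L1)^-1.
    rewrite -(cm_rel H) mulrAC divff ?mul1r //.
    by apply/eqP => E; apply: nL; rewrite E; exact: pl0 pO.
  by apply: (mIM pO _ (mIV nL)); apply: (plN pO); exact: (plC pO).
apply: (mI_pu_root pO _ _ mL2); last exact: additive_sep_neq0 (cm_good2 H).
by apply: (pl_pu_inf pO (p := L2)); [rewrite sL ltnS | exact: (mI_pl pO)].
Qed.

(** If x had no residue in k, every nonzero d(x) would be a unit and [cm_bezout] would give O = K.
    For a residue a, L1(a) = 0 is excluded by L1(x) L2(y) = -c; then L2(y) + c / L1(a) lies in the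
    maximal ideal, which yields b. *)
Lemma place_center O : place i O -> O x -> O y ->
  exists a b, [/\ on_curve a b, mI O (x - i a) & mI O (y - i b)].
Proof.
move=> pO Ox Oy.
have [a ma] : exists a, mI O (x - i a).
  apply: contrapT => na; have [_ _ _ [z nz] _] := pO; apply: nz.
  have [g [h [h0 ->]]] := cm_gen H z; have [d [t [d0 E]]] := cm_bezout h0.
  have dx0 := cm_tr H d0.
  have -> : ev x y g / ev x y h = ev x y g * ev x y t * (pu x d)^-1.
    by rewrite -E; have : ev x y t != 0 by [apply: contraNneq dx0 => t0; rewrite -E t0 mul0r]; move=> t0; field; rewrite t0 h0.
  apply: (plM pO); first by apply: (plM pO); apply: (pl_ev pO).
  have Od := pl_pu pO d Ox. apply: (mI_unit Od).
  by move=> /(mI_pu_root pO Ox d0)[a _ ma]; apply: na; exists a.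
have mLa := mI_pu pO L1 Ox ma.
have La0 : L1.[a] != 0.
  apply/eqP => La0; move: mLa; rewrite La0 rmorph0 subr0 => m.
  have := mIMr pO m (pl_pu pO L2 Oy); rewrite (cm_rel H) -rmorphN => /(mIC pO) /eqP.
  by rewrite oppr_eq0 (negbTE c0).
have : mI O (pu y (L2 + (c / L1.[a])%:P)).
  have -> : pu y (L2 + (c / L1.[a])%:P) =
     - (i L1.[a])^-1 * (pu x L1 - i L1.[a]) * pu y L2.
    have iL0 : i L1.[a] != 0 by rewrite fmorph_eq0.
    rewrite puD puC rmorphM fmorphV /= -[i c]opprK -(cm_rel H).
    by move: (i L1.[a]) iL0 => l l0; field.
  apply: (mIMr pO); last exact: (pl_pu pO _ Oy).
  by apply: (mIM pO _ mLa); apply: (plN pO); rewrite -fmorphV; exact: (plC pO).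
have s2 : size (L2 + (c / L1.[a])%:P) = q.+1.
  rewrite size_polyDl (additive_sep_size (cm_good2 H)) // size_polyC.
  by apply: leq_ltn_trans (leq_b1 _) _.
case/(mI_pu_root pO Oy); first by rewrite -size_poly_gt0 s2.
move=> b; rewrite rootE hornerD hornerC => /eqP rb mb; exists a, b; split=> //.
rewrite /on_curve; apply/eqP; have := congr1 ( *%R L1.[a]) rb.
by rewrite mulr0 mulrDr mulrCA divff // mulr1.
Qed.
End Curve.

(** * Functions with bounded poles at infinity are polynomials *)

Section Bidegree.
Variables (k : closedFieldType) (K : fieldType) (i : {rmorphism k -> K}).
Variables (q : nat) (c : k).
Hypotheses (q_gt1 : (1 < q)%N) (c0 : c != 0).
Local Notation pu := (pu i).
Local Notation ev := (ev i).
Variables (L1 L2 : {poly k}) (x y : K).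
Hypothesis H : curve_model i q c L1 L2 x y.

Let q_gt0 : (0 < q)%N := ltnW q_gt1.

Lemma reduced_form z : exists (D : {poly k}) (G : {poly {poly k}}),
  [/\ D != 0, (size G <= q)%N & pu x D * z = ev x y G].
Proof.
have [g [h [h0 ->]]] := cm_gen H z.
have [d [t [d0 E]]] := cm_bezout q_gt1 c0 H h0.
have A0 : L1 != 0 := additive_sep_neq0 (cm_good1 H).
have pm := cm_affine q_gt1 c0 H.
have [r [_ r1 _]] := pm_eis pm.
have sP := size_Psi c%:P r1 (pm_size pm).
have P0 : Psi L1 c%:P L2 != 0.
  by rewrite -size_poly_gt0 sP; apply: ltnW (pm_size pm).
pose M := Pdiv.Idomain.modp (t * g) (Psi L1 c%:P L2).
pose l := lead_coef (Psi L1 c%:P L2) ^+ Pdiv.Idomain.scalp (t * g) (Psi L1 c%:P L2).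
have El : pu x l * ev x y (t * g) = ev x y M.
  by rewrite -evZ Pdiv.Idomain.divp_eq evD evM (pm_rel pm) mulr0 add0r.
exists (l * d), M; split.
- by rewrite mulf_neq0 // expf_neq0 // lead_coef_eq0.
- by rewrite -ltnS -(additive_sep_size (cm_good2 H)) -sP; exact: Pdiv.Idomain.ltn_modpN0.
by rewrite puM -El evM -E; field.
Qed.

Lemma sum_res (O : K -> Prop) (pO : place i O) n (F : 'I_n -> K) (f : 'I_n -> k) :
  (forall j, mI O (F j - i (f j))) -> mI O (\sum_j F j - i (\sum_j f j)).
Proof.
move=> m; rewrite rmorph_sum -sumrB; apply: (mI_sum pO) => j _; exact: m.
Qed.

(** With L1 = (T - xi) A1 and L2(y) = y^q R(1/y) the equation reads (x - xi) y^q A1(x) R(1/y) = -c.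
    Both A1(x) and R(1/y) are units at O: xi is a simple root, and R(0) is the leading coefficient
    of L2. *)
Lemma order_at_root O (xi : k) : place i O -> mI O (x - i xi) -> mI O y^-1 ->
  root L1 xi -> O ((x - i xi) * y ^+ q).
Proof.
move=> pO mx my rxi; have Ox := pl_res pO mx; have Oy := mI_pl pO my.
have y0 : y != 0 := x_neq0 (cm_swap c0 H).
have [A1 EA1] := root_factor rxi.
have Er := pu_rev_poly i (additive_sep_size (cm_good2 H)) y0.
have Oi : O (pu x A1 * pu y^-1 (rev_poly q L2))^-1.
  have m0 : mI O (pu x A1 - i (A1.[xi])) := mI_pu pO _ Ox mx.
  have m1 : mI O (pu y^-1 (rev_poly q L2) - i (rev_poly q L2).[0]).
    by apply: (mI_pu pO) => //; rewrite rmorph0 subr0.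
  rewrite invfM; apply: (plM pO); first apply: (mI_unit_res pO m0).
    have := additive_sep_deriv_neq0 (cm_good1 H) xi; rewrite EA1 derivM derivXsubC mul1r.
    by rewrite hornerD hornerM hornerXsubC subrr mul0r addr0.
  exact: (mI_unit_res pO m1) (rev_poly0 (cm_good2 H)).
have := plM pO (plN pO (plC pO c)) Oi; rewrite -(cm_rel H) Er EA1 puM puXsubC.
have := cm_rel H; rewrite Er EA1 puM puXsubC => E0.
have : (x - i xi) * pu x A1 * (y ^+ q * pu y^-1 (rev_poly q L2)) != 0.
  by rewrite E0 oppr_eq0 fmorph_eq0.
rewrite !mulf_eq0 !negb_or => /andP[/andP[_ a0] /andP[_ b0]].
congr O; field; by rewrite a0 b0.
Qed.

(* At a point (alpha, oo) the functions x - alpha and y^-q generate the same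
   ideal, so the terms of ev G have distinct orders there. *)
Lemma vanishing_coef O (xi : k) (G : {poly {poly k}}) s : place i O -> mI O (x - i xi) -> mI O y^-1 ->
  root L1 xi -> (size G <= q)%N -> mI O (y^-1 ^+ s * ev x y G) ->
  forall j, (s <= j)%N -> (G`_j).[xi] = 0.
Proof.
move=> pO mx my rxi sG mG j; have Ox := pl_res pO mx; have Oy := mI_pl pO my.
have y0 : y != 0 := x_neq0 (cm_swap c0 H).
have Oxy := order_at_root pO mx my rxi.
have [N] := ubnP (q - j); elim: N j => // N IH j lt sj.
have [sGj|jG] := leqP (size G) j; first by rewrite nth_default ?horner0.
have jq : (j < q)%N := leq_trans jG sG.
have mj : mI O (y^-1 ^+ j * ev x y G).
  by rewrite -(subnK sj) exprD -mulrA; apply: (mIM pO _ mG); apply: (plX pO).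
apply: (mIC pO); rewrite -[i _](subKr (pu x G`_j)); apply: (mIB pO); last first.
  exact: (mI_pu pO _ Ox mx).
(* Isolate the coefficient j. Terms with l < j carry a positive power of 1/y. For l > j the
   coefficient vanishes at xi by induction, and its factor x - xi, comparable to y^-q, beats y^(l -
   j) because l - j < q. *)
have -> : pu x G`_j = y^-1 ^+ j * ev x y G -
   \sum_(l < size G | l != Ordinal jG) y^-1 ^+ j * (pu x G`_l * y ^+ l).
  rewrite ev_expand (bigD1 (Ordinal jG)) //= mulrDr big_distrr /= addrK.
  by rewrite exprVn mulrCA mulVf ?mulr1 // expf_neq0.
apply: (mIB pO) => //; apply: (mI_sum pO) => l lj.
have [lt_lj|lt_jl|E] := ltngtP l j; last by move: lj; rewrite -val_eqE /= E eqxx.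
  rewrite mulrCA -(subnK (ltnW lt_lj)) exprD -mulrA -exprMn mulVf // expr1n mulr1.
  apply: (mIM pO); first exact: (pl_pu pO _ Ox).
  by apply: (mIXS pO) => //; rewrite subn_gt0.
have lq : (l < q)%N := leq_trans (ltn_ord l) sG.
have Gl0 : root G`_l xi.
  apply/eqP/IH; last exact: leq_trans sj (ltnW lt_jl).
  by apply: leq_trans (lt : (q - j <= N)%N); apply: ltn_sub2l.
have [h ->] := root_factor Gl0; rewrite puM puXsubC.
have ljq : (l - j < q)%N by apply: leq_ltn_trans (leq_subr _ _) lq.
have -> : y^-1 ^+ j * ((x - i xi) * pu x h * y ^+ l) =
   pu x h * (y^-1 ^+ (q - (l - j)) * ((x - i xi) * y ^+ q)).
  have -> : y ^+ q = y ^+ (q - (l - j)) * y ^+ (l - j) by rewrite -exprD subnK // ltnW.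
  have -> : y ^+ l = y ^+ (l - j) * y ^+ j by rewrite -exprD subnK // ltnW.
  have := (expf_neq0 j y0, expf_neq0 (q - (l - j)) y0) => -[? ?].
  by rewrite !exprVn; field; do ?[apply/andP; split].
apply: (mIM pO); first exact: (pl_pu pO _ Ox).
by apply: (mIMr pO) => //; apply: (mIXS pO) => //; rewrite subn_gt0.
Qed.

Section Regular.
Variables (z : K) (m n : nat).
Hypotheses (mq : (m < q)%N) (nq : (n < q)%N).
Hypothesis z_aff : forall O, place i O -> O x -> O y -> O z.
Hypothesis z_x : forall O, place i O -> ~ O x -> O (x^-1 ^+ m * z).
Hypothesis z_y : forall O, place i O -> ~ O y -> O (y^-1 ^+ n * z).

Let place_at_root xi : root L1 xi -> exists O,
  [/\ place i O, mI O (x - i xi), mI O y^-1 & ~ O y].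
Proof.
move=> rxi; have H' := cm_swap c0 H; have pO := inf_place q_gt1 c0 H' rxi.
exists (inf i y x xi); split=> //; first exact: (inf_y q_gt1 c0 H' rxi).
  exact: (inf_x q_gt1 c0 H' rxi).
move=> Oy; have := mIM pO Oy (inf_x q_gt1 c0 H' rxi).
by rewrite divff ?(x_neq0 H') // => /(mI1 pO).
Qed.

(** Roots xi of the denominator D are cancelled one at a time, by showing G(xi, v) = 0. If L1(xi) is
    nonzero, G(xi, v) has degree < q and vanishes at the q points over xi; otherwise the separation
    of orders at (xi, oo) applies. *)
Lemma poly_of_regular : exists2 G : {poly {poly k}}, (size G <= q)%N & z = ev x y G.
Proof.
have [D [G [D0 sG E]]] := reduced_form z.
have [N] := ubnP (size D); elim: N D G D0 sG E => // N IH D G D0 sG E sD.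
have [sD1|sD1] := leqP (size D) 1.
  exists ((D`_0)^-1%:P *: G).
    by apply: leq_trans sG; rewrite -mul_polyC size_Cmul // polyC_eq0 invr_eq0 -polyC_eq0 -size1_polyC.
  have d0 : i D`_0 != 0 by rewrite fmorph_eq0 -polyC_eq0 -size1_polyC.
  by rewrite evZ puC -E {2}(size1_polyC sD1) puC fmorphV mulKf.
have [xi rD] : exists xi, root D xi.
  by apply/closed_rootP; rewrite gtn_eqF.
have [D1 ED] := root_factor rD.
have D10 : D1 != 0 by apply: contraNneq D0 => D10; rewrite ED D10 mulr0.
suff /coef_root_factor[G1 EG] : map_poly (horner_eval xi) G = 0.
  apply: (IH D1 G1) => //.
  - by move: sG; rewrite EG size_scale // polyXsubC_eq0.
  - have x0 : pu x ('X - xi%:P) != 0 by apply: (cm_tr H); rewrite polyXsubC_eq0.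
    by apply: (mulfI x0); rewrite mulrA -puM -ED E EG evZ.
  - by move: sD; rewrite ED size_monicM ?monicXsubC // size_XsubC.
have [rxi|nrxi] := boolP (root L1 xi).
  have [O [pO mx my nOy]] := place_at_root rxi.
  apply/polyP => j; rewrite coef_map coef0 /=.
  apply: (@vanishing_coef O xi G 0) => //; rewrite expr0 mul1r -E ED puM puXsubC.
  have y0 : y != 0 := x_neq0 (cm_swap c0 H).
  (* Since n < q, the zero of x - xi at (xi, oo) outweighs the pole of z. *)
  have -> : (x - i xi) * pu x D1 * z =
      y^-1 ^+ (q - n) * (((x - i xi) * y ^+ q) * pu x D1 * (y^-1 ^+ n * z)).
    rewrite -{2}(subnK (ltnW nq)) exprD; have := (expf_neq0 n y0, expf_neq0 (q - n) y0) => -[? ?].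
    by rewrite !exprVn; field; do ?[apply/andP; split].
  apply: (mIMr pO); first by apply: (mIXS pO) => //; rewrite subn_gt0.
  apply: (plM pO); last exact: z_y.
  by apply: (plM pO); [exact: order_at_root | apply: (pl_pu pO); exact: pl_res mx].
have [rs [urs srs rsE]] := additive_sep_fiber (cm_good2 H) q_gt0 (- c / L1.[xi]).
apply: (roots_geq_poly_eq0 (rs := rs)) => //; last first.
  by rewrite srs; apply: leq_trans (size_poly _ _) sG.
apply/allP => b; rewrite rsE => /eqP bE.
have ab : on_curve c L1 L2 xi b.
  by rewrite /on_curve bE mulrC divfK // addNr.
have pO := aff_place q_gt1 c0 H ab.
have [mx my] := (aff_x q_gt1 c0 H ab, aff_y q_gt1 c0 H ab).
have [Ox Oy] := (pl_res pO mx, pl_res pO my).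
apply/eqP/(mIC pO); rewrite -/(pe xi b G) -[i _](subKr (ev x y G)).
apply: (mIB pO); last exact: (mI_ev pO).
rewrite -E ED puM puXsubC; apply: (mIMr pO); last exact: z_aff.
by apply: (mIMr pO) => //; apply: (pl_pu pO).
Qed.

(** Let N > m be the largest possible degree in x and C the coefficient of x^N, of degree < q in y.
    At (oo, b) the function x^-N z has residue C(b), which is 0 by the pole bound; the q roots b of
    L2 then force C = 0. *)
Lemma size_coef_regular (G : {poly {poly k}}) : (size G <= q)%N -> z = ev x y G ->
  forall j, (size (G`_j)%R <= m.+1)%N.
Proof.
move=> sG E; suff Ht t : (forall j, size (G`_j)%R <= m.+1 + t)%N ->
    (forall j, size (G`_j)%R <= m.+1)%N.
  apply: (Ht (sizeY G)) => j; apply: leq_trans (leq_addl _ _); exact: max_size_coefXY.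
elim: t => [|t IH] sz; first by move=> j; have := sz j; rewrite addn0.
apply: IH => j; set N := (m.+1 + t)%N.
suff CN0 : \poly_(j < q) (G`_j)`_N = 0.
  apply/leq_sizeP => l; rewrite leq_eqVlt => /orP[/eqP <-|Nl].
    have [jq|qj] := ltnP j q; last first.
      by rewrite (nth_default 0 (leq_trans sG qj)) coef0.
    by have := congr1 (fun p : {poly k} => p`_j) CN0; rewrite coef_poly jq coef0.
  by rewrite nth_default //; apply: leq_trans (sz j) _; rewrite addnS.
have [rs [urs srs rsE]] := additive_sep_fiber (cm_good2 H) q_gt0 0.
apply: (roots_geq_poly_eq0 (rs := rs)) => //; last by rewrite srs; exact: size_poly.
apply/allP => b; rewrite rsE => rb.
have pO := inf_place q_gt1 c0 H rb.
have [mx my] := (inf_x q_gt1 c0 H rb, inf_y q_gt1 c0 H rb).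
set O := inf i x y b in pO mx my.
have x0 := x_neq0 H.
have nOx : ~ O x.
  by move=> Ox; have := mIM pO Ox mx; rewrite divff // => /(mI1 pO).
have mz : mI O (x^-1 ^+ N * z).
  rewrite /N addSn -addnS addnC exprD -mulrA; apply: (mIMr pO); last exact: z_x.
  exact: (mIXS pO).
apply/eqP/(mIC pO); rewrite -[i _](subKr (x^-1 ^+ N * z)); apply: (mIB pO) => //.
rewrite horner_poly E ev_expand big_distrr /=.
have -> : \sum_(j < size G) x^-1 ^+ N * (pu x G`_j * y ^+ j) =
   \sum_(j < q) x^-1 ^+ N * pu x G`_j * y ^+ j.
  rewrite (big_ord_widen _ (fun j => x^-1 ^+ N * (pu x G`_j * y ^+ j)) sG) big_mkcond /=.
  apply: eq_bigr => l _; case: ltnP => [_|sl]; first by rewrite mulrA.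
  by rewrite (nth_default 0 sl) pu0 mulr0 mul0r.
apply: (sum_res pO) => l; apply: (mI_resM pO); last exact: (mI_resX pO).
have szl : (size (G`_l)%R <= N.+1)%N by have := sz l; rewrite addnS.
rewrite /pu (@horner_coef_wide _ N.+1); last first.
  by apply: leq_trans (size_poly _ _) szl.
rewrite big_distrr big_ord_recr /= coef_map /= mulrCA -exprMn mulVf // expr1n mulr1 addrK.
apply: (mI_sum pO) => r _; rewrite coef_map /= mulrCA; apply: (mIM pO); first exact: plC pO _.
case: r => r /= rN.
rewrite -(subnK (ltnW rN)) exprD -mulrA -exprMn mulVf // expr1n mulr1.
by apply: (mIXS pO) => //; rewrite subn_gt0.
Qed.

(** For j > n the coefficient of y^j vanishes at the q roots of L1, by [vanishing_coef] with s = n +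
    1, while its degree is at most m < q. *)
Lemma bidegree_regular : exists G : {poly {poly k}},
  [/\ (size G <= n.+1)%N, forall j, (size (G`_j)%R <= m.+1)%N & z = ev x y G].
Proof.
have [G sG E] := poly_of_regular; have sc := size_coef_regular sG E.
exists G; split=> //; apply/leq_sizeP => j nj.
have [rs [urs srs rsE]] := additive_sep_fiber (cm_good1 H) q_gt0 0.
apply: (roots_geq_poly_eq0 (rs := rs)) => //; last first.
  by rewrite srs; apply: leq_trans (sc j) mq.
apply/allP => xi; rewrite rsE => rxi; have [O [pO mx my nOy]] := place_at_root rxi.
apply/eqP; apply: (@vanishing_coef O xi G n.+1) => //.
by rewrite -E exprS -mulrA; apply: (mIMr pO) => //; exact: z_y.
Qed.
End Regular.
End Bidegree.

Lemma horner_pe (k : fieldType) (a b : k) (G : {poly {poly k}}) :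
  (G.[b%:P]).[a] = pe a b G.
Proof.
have := horner_map (horner_eval a) G b%:P.
by rewrite /pe /= [horner_eval a _%:P]hornerC => ->.
Qed.

(** * Functions with q simple poles *)

Section SimplePoles.
Variables (k : closedFieldType) (K : fieldType) (i : {rmorphism k -> K}).
Variables (q : nat) (c : k).
Hypotheses (q_gt2 : (2 < q)%N) (c0 : c != 0).
Local Notation pu := (pu i).
Local Notation ev := (ev i).
Variables (L1 L2 : {poly k}) (x y : K).
Hypothesis H : curve_model i q c L1 L2 x y.

Let q_gt1 : (1 < q)%N := ltnW q_gt2.
Let q_gt0 : (0 < q)%N := ltnW q_gt1.

Lemma pl_inv_pu (O : K -> Prop) u (p : {poly k}) m : place i O -> u != 0 -> O u^-1 ->
  (size p <= m.+1)%N -> O (u^-1 ^+ m * pu u p).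
Proof.
move=> pO u0 Ou sp; rewrite pu_expand big_distrr /=.
apply: (pl_sum pO) => -[j /= jp] _; rewrite mulrCA; apply: (plM pO (plC pO _)).
rewrite -(subnK (leq_trans jp sp : (j <= m)%N)) exprD -mulrA -exprMn mulVf //.
by rewrite expr1n mulr1; apply: (plX pO).
Qed.

Variables (z : K) (p1 : k * k) (P : seq (k * k)).
Hypotheses (uP : uniq (p1 :: P)) (sP : size P = q.-1).
Hypothesis p1_curve : on_curve c L1 L2 p1.1 p1.2.
Hypothesis P_curve : forall p, p \in P -> on_curve c L1 L2 p.1 p.2.
Hypothesis poles : forall O, place i O -> ~ O z -> exists2 p, p \in p1 :: P &
  [/\ mI O (x - i p.1), mI O (y - i p.2),
      O ((x - i p.1) * z) & O ((y - i p.2) * z)].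

Let xs := undup (map fst P).
Let hx : {poly k} := \prod_(xi <- xs) ('X - xi%:P).

Let sxs : (size xs < q)%N.
Proof.
by apply: leq_ltn_trans (size_undup _) _; rewrite size_map sP; case: q q_gt0.
Qed.

Let shx : size hx = (size xs).+1.
Proof. by rewrite size_prod_XsubC. Qed.

Let hx_factor xi : xi \in xs -> exists h, hx = ('X - xi%:P) * h.
Proof. by move=> xix; apply: root_factor; rewrite root_prod_XsubC. Qed.

(** Leaving [p1] out of the product over x keeps its degree at most q - 1, within the range of
    [bidegree_regular]; the pole at [p1] is cancelled by the factor in y instead. *)
Lemma clear_poles : exists G : {poly {poly k}},
  [/\ (size G <= 2)%N, forall j, (size (G`_j)%R <= (size xs).+1)%N &
      pu x hx * ((y - i p1.2) * z) = ev x y G].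
Proof.
have [x0 y0] := (x_neq0 H, x_neq0 (cm_swap c0 H)).
apply: (bidegree_regular q_gt1 c0 H) => // O pO.
- move=> Ox Oy; have [Oz|nOz] := EM (O z).
    by apply: (plM pO (pl_pu pO _ Ox) (plM pO (plB pO Oy (plC pO _)) Oz)).
  have [p pP [_ _ xz yz]] := poles pO nOz.
  move: pP; rewrite inE => /orP[/eqP E|pP].
    by rewrite -E; apply: (plM pO (pl_pu pO _ Ox) yz).
  have [|h ->] := @hx_factor p.1; first by rewrite mem_undup map_f.
  rewrite puM puXsubC.
  have -> : (x - i p.1) * pu x h * ((y - i p1.2) * z) =
     ((x - i p.1) * z) * (pu x h * (y - i p1.2)) by ring.
  by apply: (plM pO xz (plM pO (pl_pu pO _ Ox) (plB pO Oy (plC pO _)))).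
- move=> nOx; have [Oz|nOz] := EM (O z); last first.
    by have [p _ [mx _ _ _]] := poles pO nOz; case: nOx; exact: pl_res mx.
  have [b rb mb] := place_pole_y q_gt1 H pO nOx.
  rewrite [X in O X]mulrA; apply: (plM pO _ (plM pO (plB pO (pl_res pO mb) (plC pO _)) Oz)).
  by apply: (pl_inv_pu pO x0 (mI_pl pO (mIV nOx))); rewrite shx.
- move=> nOy; have [Oz|nOz] := EM (O z); last first.
    by have [p _ [_ my _ _]] := poles pO nOz; case: nOy; exact: pl_res my.
  have [b rb mb] := place_pole_y q_gt1 (cm_swap c0 H) pO nOy.
  rewrite expr1.
  have -> : y^-1 * (pu x hx * ((y - i p1.2) * z)) =
     pu x hx * z * (1 - i p1.2 * y^-1) by field.
  apply: (plM pO (plM pO (pl_pu pO _ (pl_res pO mb)) Oz)).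
  exact: (plB pO (pl1 pO) (plM pO (plC pO _) (mI_pl pO (mIV nOy)))).
Qed.

Let hx_neq0 : pu x hx != 0.
Proof. by apply: (cm_tr H); rewrite -size_poly_gt0 shx. Qed.

Let yb_neq0 b : y - i b != 0.
Proof. by rewrite subr_eq0; exact: cm_const (cm_swap c0 H). Qed.

Let pe_zero a b (G : {poly {poly k}}) : on_curve c L1 L2 a b ->
  mI (aff i x y a b) (ev x y G) -> pe a b G = 0.
Proof.
move=> ab m; have pO := aff_place q_gt1 c0 H ab.
have mE := mI_ev pO G (aff_x q_gt1 c0 H ab) (aff_y q_gt1 c0 H ab).
by apply: (mIC pO); rewrite -[i _](subKr (ev x y G)); apply: (mIB pO).
Qed.

(** G has bidegree (1, 1). Restricted to the line y = y(p1) it vanishes at the curve points other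
    than [p1], at least q - 1 >= 2 of them, hence identically. So y - y(p1) divides G, and the
    quotient involves x only. *)
Lemma moebius_same_fiber xi : (forall p, p \in P -> p.1 = xi) ->
  exists xi' (g : {poly k}), (size g <= 2)%N /\ (x - i xi') * z = pu x g.
Proof.
move=> Pxi; have [G [sG sGj E]] := clear_poles.
have xsE : xs = [:: xi].
  have : all (pred1 xi) xs by apply/allP => s; rewrite mem_undup => /mapP[p /Pxi + ->] => ->/=.
  have : uniq xs by exact: undup_uniq.
  have : xi \in xs.
    have [p pP] : exists p, p \in P.
      move: sP; case: (P) => [E'|p P' _]; last by exists p; rewrite mem_head.
      by have := q_gt2; rewrite -(prednK q_gt0) -E'.
    by rewrite mem_undup -(Pxi p pP) map_f.
  case: (xs) => // s [|s' l] _ /=; first by rewrite andbT => _ /eqP ->.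
  by rewrite inE negb_or => /andP[/andP[ss' _] _] /and3P[/eqP E1 /eqP E2 _]; rewrite E1 E2 eqxx in ss'.
have hxE : pu x hx = x - i xi by rewrite /hx xsE big_seq1 puXsubC.
exists xi.
have [as_ [uas sas asE]] := additive_sep_fiber (cm_good1 H) q_gt0 (- c / L2.[p1.2]).
have L2b : L2.[p1.2] != 0 by have /andP[] := on_curve_neq0 c0 p1_curve.
have mb a : on_curve c L1 L2 a p1.2 -> a != p1.1 -> pe a p1.2 G = 0.
  move=> ab ap; apply: (pe_zero ab); rewrite -E hxE.
  have pO := aff_place q_gt1 c0 H ab.
  have [mx my] := (aff_x q_gt1 c0 H ab, aff_y q_gt1 c0 H ab).
  have [Oz|nOz] := EM (aff i x y a p1.2 z).
    apply: (mIM pO); first exact: (plB pO (pl_res pO mx) (plC pO _)).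
    exact: (mIMr pO).
  have [p pP [px _ xz _]] := poles pO nOz.
  have pa := mI_res_uniq pO px mx.
  have {}pP : p \in P.
    by move: pP; rewrite inE => /orP[/eqP pE|//]; rewrite -pa pE eqxx in ap.
  rewrite mulrA mulrAC mulrC; apply: (mIMr pO my).
  by rewrite -(Pxi p pP).
have /eqP/factor_theorem[G1 EG] : G.[p1.2%:P] = 0.
  apply: (roots_geq_poly_eq0 (rs := [seq a <- as_ | a != p1.1])).
  - apply/allP => a; rewrite mem_filter asE => /andP[ap /eqP aE].
    have ab : on_curve c L1 L2 a p1.2 by rewrite /on_curve aE divfK // addNr.
    by rewrite rootE horner_pe mb.
  - exact: filter_uniq.
  apply: (@leq_trans 2).
    rewrite (@horner_coef_wide _ 2) // !big_ord_recl big_ord0 expr0 mulr1 expr1 addr0 /=.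
    rewrite (leq_trans (size_polyD _ _)) // geq_max.
    have := sGj 0%N; have := sGj 1%N; rewrite xsE /= => s1 ->.
    by rewrite mulrC mul_polyC; apply: leq_trans (size_scale_leq _ _) s1.
  have := count_predC (pred1 p1.1) as_.
  rewrite (count_uniq_mem _ uas) sas size_filter => Ec; move: q_gt2; rewrite -Ec.
  by case: (_ \in _); [rewrite add1n ltnS | rewrite add0n => /ltnW].
have sG1 : (size G1 <= 1)%N.
  have [->|G10] := eqVneq G1 0; first by rewrite size_poly0.
  by move: sG; rewrite EG size_Mmonic ?monicXsubC // size_XsubC addn2.
exists G1`_0; split.
  have := sGj 1%N; rewrite xsE /= EG (size1_polyC sG1) mul_polyC coefZ.
  by rewrite coefB coefX coefC /= subr0 mulr1 coefC eqxx.
apply: (mulfI (yb_neq0 p1.2)); move: E; rewrite hxE EG (size1_polyC sG1).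
rewrite evM evC evB evX evC puC coefC eqxx => E.
by rewrite mulrCA E mulrC.
Qed.
(** On a line x = xi, G has degree at most 1 in y and vanishes at the curve points outside [P]. Some
    point of [P] is off the line, so at most q - 2 are on it and two zeros remain. Thus [hx] divides
    every coefficient of G, and by degree the quotients are constants. *)
Lemma moebius_distinct_fibers : ~~ constant (map fst P) ->
  exists g : {poly k}, (size g <= 2)%N /\ (y - i p1.2) * z = pu y g.
Proof.
move=> ncst; have [G [sG sGj E]] := clear_poles.
have two_fibers xi : exists2 p, p \in P & p.1 != xi.
  apply/hasP; apply: contraR ncst => /hasPn nP.
  have nP' p : p \in P -> p.1 = xi by move=> /nP; rewrite negbK => /eqP.
  case: (P) nP' => //= p P' nP'; apply/allP => s /mapP[p' p'P ->].
  by apply/eqP; transitivity xi; [|symmetry]; apply: nP'; rewrite ?mem_head // inE p'P orbT.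
have Gxi xi j : xi \in xs -> root G`_j xi.
  move=> xix.
  have Lxi : L1.[xi] != 0.
    by move: xix; rewrite mem_undup => /mapP[p pP ->]; have /andP[] := on_curve_neq0 c0 (P_curve pP).
  have [bs [ubs sbs bsE]] := additive_sep_fiber (cm_good2 H) q_gt0 (- c / L1.[xi]).
  have [h hE] := hx_factor xix.
  have mb b : on_curve c L1 L2 xi b -> (xi, b) \notin P -> pe xi b G = 0.
    move=> ab nP; apply: (pe_zero ab); rewrite -E hE puM puXsubC.
    have pO := aff_place q_gt1 c0 H ab.
    have [mx my] := (aff_x q_gt1 c0 H ab, aff_y q_gt1 c0 H ab).
    have [Ox Oy] := (pl_res pO mx, pl_res pO my).
    rewrite -mulrA; apply: (mIMr pO mx); apply: (plM pO (pl_pu pO _ Ox)).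
    have [Oz|nOz] := EM (aff i x y xi b z).
      exact: (plM pO (plB pO Oy (plC pO _)) Oz).
    have [p pP [px py _ yz]] := poles pO nOz.
    have pE : p = (xi, b).
      by rewrite [p]surjective_pairing (mI_res_uniq pO px mx) (mI_res_uniq pO py my).
    by move: pP; rewrite inE => /orP[/eqP <-//|]; rewrite pE (negbTE nP).
  have G0 : map_poly (horner_eval xi) G = 0.
    apply: (roots_geq_poly_eq0 (rs := [seq b <- bs | (xi, b) \notin P])).
    - apply/allP => b; rewrite mem_filter bsE => /andP[nP /eqP bE].
      by apply/eqP/mb => //; rewrite /on_curve bE mulrC divfK // addNr.
    - exact: filter_uniq.
    apply: leq_trans (size_poly _ _) _; apply: leq_trans sG _.
    have := count_predC (fun b => (xi, b) \in P) bs; rewrite sbs => Ec.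
    have cP : (count (fun b => (xi, b) \in P) bs < q.-1)%N.
      have [p pP px] := two_fibers xi.
      rewrite -sP -(count_predC (fun p' : k * k => p'.1 == xi) P).
      rewrite -addn1 leq_add //; last by rewrite -has_count; apply/hasP; exists p.
      rewrite -!size_filter -(size_map (pair xi)); apply: uniq_leq_size.
        by rewrite map_inj_uniq ?filter_uniq // => b b' [].
      by move=> p' /mapP[b]; rewrite !mem_filter => /andP[bP _] ->; rewrite eqxx.
    rewrite size_filter -[leqRHS]/(count (predC (fun b => (xi, b) \in P)) bs).
    by move: (count _ _) (count _ _) Ec cP => u w; lia.
  by rewrite rootE; have := congr1 (fun p : {poly k} => p`_j) G0; rewrite coef_map coef0 => /eqP.
have dvG j : hx %| G`_j.
  apply: uniq_roots_dvdp; last by rewrite uniq_rootsE undup_uniq.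
  by apply/allP => xi /Gxi.
pose g := \poly_(j < 2) (G`_j %/ hx)`_0.
have hx0 : hx != 0 by rewrite -size_poly_gt0 shx.
have EG : G = hx *: g^:P.
  apply/polyP => j; rewrite coefZ coef_map /= coef_poly; case: ltnP => [_|j2]; last first.
    by rewrite polyC0 mulr0 nth_default // (leq_trans sG).
  rewrite -size1_polyC; first by rewrite mulrC divpK.
  by rewrite size_divp // shx leq_subLR addn1.
exists g; split; first exact: size_poly.
by apply: (mulfI hx_neq0); rewrite E EG evZ evY.
Qed.

Lemma moebius_of_poles : exists xi (g : {poly k}), (size g <= 2)%N /\
  ((x - i xi) * z = pu x g \/ (y - i xi) * z = pu y g).
Proof.
have [cst|ncst] := boolP (constant (map fst P)); last first.
  by have [g [sg E]] := moebius_distinct_fibers ncst; exists p1.2, g; split=> //; right.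
have [xi Pxi] : exists xi, forall p, p \in P -> p.1 = xi.
  case: (P) cst => [|p P'] /= cst; first by exists 0.
  exists p.1 => p'; rewrite inE => /orP[/eqP -> //|p'P]; apply/eqP.
  by have /allP/(_ p'.1) := cst; apply; rewrite map_f.
have [xi' [g [sg E]]] := moebius_same_fiber Pxi; exists xi', g; split=> //; by left.
Qed.
End SimplePoles.

(** The nonconstant polynomial p X + 1 has a root, and p cannot vanish there. *)
Lemma exists_nonroot (k : closedFieldType) (p : {poly k}) :
  p != 0 -> exists a, ~~ root p a.
Proof.
move=> p0; have /closed_rootP[a ra] : size (p * 'X + 1) != 1%N.
  by rewrite size_polyDl size_mulX // ?size_poly1 ?ltnS ?size_poly_gt0 // eqSS size_poly_eq0.
exists a; apply: contraL ra => pa; rewrite rootE hornerD hornerM hornerC (eqP pa).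
by rewrite mul0r add0r oner_eq0.
Qed.

(** * Two coordinate pairs on the same field *)

Section TwoModels.
Variables (k : closedFieldType) (K : fieldType) (i : {rmorphism k -> K}).
Variables (q : nat) (c : k).
Hypotheses (q_gt2 : (2 < q)%N) (c0 : c != 0).
Local Notation pu := (pu i).
Local Notation ev := (ev i).

Let q_gt1 : (1 < q)%N := ltnW q_gt2.
Let q_gt0 : (0 < q)%N := ltnW q_gt1.

Definition moebius (u v : K) := exists M N : {poly k},
  [/\ M != 0, (size M <= 2)%N, (size N <= 2)%N & v * pu u M = pu u N].

Lemma cm_nonroot (L1 L2 : {poly k}) (x y : K) (h : {poly {poly k}}) :
  curve_model i q c L1 L2 x y -> ev x y h != 0 ->
  exists2 d : {poly k}, d != 0 & forall a b, on_curve c L1 L2 a b ->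
    ~~ root d a -> pe a b h != 0.
Proof.
move=> H h0; have [d [t [d0 E]]] := cm_bezout q_gt1 c0 H h0.
exists d => // a b ab; apply: contraNneq => hz.
have : ev x y (t * h - d%:P) = 0 by rewrite evB evM evC E subrr.
move/(ev0_on_curve q_gt1 c0 H ab); rewrite peB peM peC hz mulr0 sub0r => /eqP.
by rewrite oppr_eq0.
Qed.

(** The value a avoids the roots of M1 and those of [dx], [dy], so that x and y are regular at the q
    affine places over x' = a. The centres of these places in the first model are the points fed to
    [moebius_of_poles]. *)
Lemma moebius_coordinate (L1 L2 M1 M2 : {poly k}) (x y x' y' : K) :
  curve_model i q c L1 L2 x y -> curve_model i q c M1 M2 x' y' ->
  moebius x x' \/ moebius y x'.
Proof.
move=> H H'.
have [gx [hx [hx0 Ex]]] := cm_gen H' x; have [gy [hy [hy0 Ey]]] := cm_gen H' y.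
have [dx dx0 nzx] := cm_nonroot H' hx0; have [dy dy0 nzy] := cm_nonroot H' hy0.
have M10 := additive_sep_neq0 (cm_good1 H').
have [a] := exists_nonroot (mulf_neq0 M10 (mulf_neq0 dx0 dy0)).
rewrite !rootM !negb_or => /and3P[M1a dxa dya].
have [bs [ubs sbs bsE]] := additive_sep_fiber (cm_good2 H') q_gt0 (- c / M1.[a]).
have bsC b : b \in bs -> on_curve c M1 M2 a b.
  by rewrite bsE => /eqP bE; rewrite /on_curve bE mulrC divfK ?addNr.
have /choice[P PP] b : exists p : k * k, b \in bs ->
   [/\ on_curve c L1 L2 p.1 p.2, mI (aff i x' y' a b) (x - i p.1)
     & mI (aff i x' y' a b) (y - i p.2)].
  have [bb|] := boolP (b \in bs); last by exists (0, 0).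
  have ab := bsC b bb; have pO := aff_place q_gt1 c0 H' ab.
  have Ox : aff i x' y' a b x by exists gx, hx; split=> //; exact: nzx.
  have Oy : aff i x' y' a b y by exists gy, hy; split=> //; exact: nzy.
  have [xi [eta [? ? ?]]] := place_center q_gt1 c0 H pO Ox Oy.
  by exists (xi, eta).
(* A place is determined by its centre, so distinct places over x' = a have distinct centres. *)
have Pinj : {in bs &, injective P}.
  move=> b b' bb bb' E; have [C m1 m2] := PP b bb; have [_ m1' m2'] := PP b' bb'.
  rewrite -E in m1' m2'.
  have pO := aff_place q_gt1 c0 H' (bsC b bb).
  have pO' := aff_place q_gt1 c0 H' (bsC b' bb').
  have e := aff_unique q_gt1 c0 H C pO m1 m2.
  have e' := aff_unique q_gt1 c0 H C pO' m1' m2'.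
  apply: (mI_res_uniq pO (aff_y q_gt1 c0 H' (bsC b bb))).
  case: (aff_y q_gt1 c0 H' (bsC b' bb')) => [->|n]; [by left|right].
  by move=> /e/e'.
pose z := (x' - i a)^-1.
have xa0 : x' - i a != 0 by rewrite subr_eq0; exact: cm_const H'.
have poles O : place i O -> ~ O z -> exists2 p, p \in map P bs &
  [/\ mI O (x - i p.1), mI O (y - i p.2),
      O ((x - i p.1) * z) & O ((y - i p.2) * z)].
  move=> pO nOz; have mx' : mI O (x' - i a) by right.
  have Ox' := pl_res pO mx'.
  have Oy' : O y'.
    apply: (pl_pu_inf pO (p := M2)); first by rewrite (additive_sep_size (cm_good2 H')) ltnS.
    have Ou : O (pu x' M1)^-1 by apply: (mI_unit_res pO (mI_pu pO M1 Ox' mx')).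
    have := plM pO (plN pO (plC pO c)) Ou; rewrite -(cm_rel H') mulrAC divff ?mul1r //.
    exact: (cm_tr H').
  have [a' [b [ab ma mb]]] := place_center q_gt1 c0 H' pO Ox' Oy'.
  have aE := mI_res_uniq pO ma mx'; rewrite aE in ab ma.
  have bb : b \in bs.
    rewrite bsE; apply/eqP; move: ab; rewrite /on_curve addr_eq0 => /eqP <-.
    by rewrite mulrAC divff ?mul1r.
  have e := aff_unique q_gt1 c0 H' ab pO ma mb.
  have mE w : mI (aff i x' y' a b) w -> mI O w.
    by case=> [->|nw]; [left|right => /e].
  have [C m1 m2] := PP b bb.
  (* The poles are simple because x' - a generates the maximal ideal of O. *)
  exists (P b); first exact: map_f.
  split; [exact: mE | exact: mE | |]; apply/e; rewrite /z; apply: (aff_mI q_gt1 c0 H' ab);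
    by [].
have [b0 [bs' bsE']] : exists b0 bs', bs = b0 :: bs'.
  by case: (bs) sbs => [|b0 bs'] E; [by have := q_gt0; rewrite -E | exists b0, bs'].
have PC b : b \in bs -> on_curve c L1 L2 (P b).1 (P b).2 by move=> /PP[].
have [|||||xi [g [sg E]]] := @moebius_of_poles k K i q c q_gt2 c0 L1 L2 x y H z (P b0) (map P bs').
- by rewrite -map_cons -bsE' map_inj_in_uniq.
- by rewrite size_map -sbs bsE'.
- by apply: PC; rewrite bsE' mem_head.
- by move=> p /mapP[b bb ->]; apply: PC; rewrite bsE' inE bb orbT.
- by rewrite -map_cons -bsE'.
(* Solve (u - xi) / (x' - a) = g(u) for x'. *)
have conc u : u - i xi != 0 -> (u - i xi) * z = pu u g -> moebius u x'.
  move=> u0 Eu; exists g, ('X - xi%:P + a *: g); split=> //.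
  - apply: contraNneq (mulf_neq0 u0 (invr_neq0 xa0)) => g0.
    by rewrite -/z Eu g0 pu0.
  - apply: leq_trans (size_polyD _ _) _; rewrite geq_max size_XsubC leqnn.
    exact: leq_trans (size_scale_leq _ _) sg.
  by rewrite puD puXsubC puZ -Eu /z; field.
case: E => E; [left|right]; apply: conc => //; rewrite subr_eq0.
  exact: cm_const H.
exact: cm_const (cm_swap c0 H).
Qed.

Definition rational_in (u w : K) := exists D N : {poly k},
  D != 0 /\ w * pu u D = pu u N.

Section RationalIn.
Variable u : K.
Hypothesis u_tr : forall p, p != 0 -> pu u p != 0.

Lemma rational_pu p : rational_in u (pu u p).
Proof. by exists 1, p; rewrite oner_neq0 pu1 mulr1. Qed.

Lemma rationalD v w : rational_in u v -> rational_in u w -> rational_in u (v + w).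
Proof.
move=> [D [N [D0 E]]] [D' [N' [D'0 E']]]; exists (D * D'), (N * D' + N' * D).
by rewrite mulf_neq0 // puD !puM -E -E'; split=> //; ring.
Qed.

Lemma rationalM v w : rational_in u v -> rational_in u w -> rational_in u (v * w).
Proof.
move=> [D [N [D0 E]]] [D' [N' [D'0 E']]]; exists (D * D'), (N * N').
by rewrite mulf_neq0 // !puM -E -E'; split=> //; ring.
Qed.

Lemma rationalV v : v != 0 -> rational_in u v -> rational_in u v^-1.
Proof.
move=> v0 [D [N [D0 E]]]; exists N, D; split; last by rewrite -E mulKf.
by apply: contraNneq (mulf_neq0 v0 (u_tr D0)) => N0; rewrite E N0 pu0.
Qed.

Lemma rational_comp v p : rational_in u v -> rational_in u (pu v p).
Proof.
move=> rv; elim/poly_ind: p => [|p a IH]; first by rewrite pu0 -(pu0 i u); exact: rational_pu.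
rewrite puD puM puX puC -(puC i u a); apply: rationalD (rational_pu _).
exact: rationalM.
Qed.

Lemma rational_ev v w g : rational_in u v -> rational_in u w -> rational_in u (ev v w g).
Proof.
move=> rv rw; elim/poly_ind: g => [|g p IH]; first by rewrite ev0 -(pu0 i u); exact: rational_pu.
rewrite evD evM evX evC; apply: rationalD; last exact: rational_comp.
exact: rationalM.
Qed.
End RationalIn.

(** Otherwise y would take a single value over a general x = a, where there are q > 1 points. *)
Lemma not_rational (L1 L2 : {poly k}) (x y : K) :
  curve_model i q c L1 L2 x y -> ~ rational_in x y.
Proof.
move=> H [D [N [D0 E]]].
have [a] := exists_nonroot (mulf_neq0 D0 (additive_sep_neq0 (cm_good1 H))).
rewrite rootM negb_or => /andP[Da La].
have [bs [ubs sbs bsE]] := additive_sep_fiber (cm_good2 H) q_gt0 (- c / L1.[a]).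
have bE b : b \in bs -> b = N.[a] / D.[a].
  rewrite bsE => /eqP bE.
  have ab : on_curve c L1 L2 a b by rewrite /on_curve bE mulrC divfK ?addNr.
  have : ev x y (D *: 'X - N%:P) = 0 by rewrite evB evZ evX evC mulrC E subrr.
  move/(ev0_on_curve q_gt1 c0 H ab); rewrite peB peZ peC => /eqP; rewrite subr_eq0.
  have -> : pe a b 'X = b by rewrite /pe map_polyX hornerX.
  by move=> /eqP <-; rewrite mulrAC divff ?mul1r.
case: bs ubs sbs bE {bsE} => [|b [|b' bs]] /=.
- by move=> _ q0; have := q_gt0; rewrite -q0.
- by move=> _ q0; have := q_gt1; rewrite -q0.
move=> /andP[+ _] _ bE; rewrite (bE b) ?mem_head // (bE b') ?inE ?eqxx ?orbT //.
Qed.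

Lemma moebius_rational u v : moebius u v -> rational_in u v.
Proof. by move=> [M [N [M0 _ _ E]]]; exists M, N. Qed.

(** If x' and y' were both in k(x), so would be y, which is a fraction in x' and y'. *)
Lemma moebius_not_same (L1 L2 M1 M2 : {poly k}) (x y x' y' : K) :
  curve_model i q c L1 L2 x y -> curve_model i q c M1 M2 x' y' ->
  moebius x x' -> moebius x y' -> False.
Proof.
move=> H H' /moebius_rational rx /moebius_rational ry; apply: (not_rational H).
have [g [h [h0 ->]]] := cm_gen H' y.
apply: rationalM; first exact: rational_ev.
apply: rationalV => //; first exact: cm_tr H.
exact: rational_ev.
Qed.

(* A^q M(B/A) for M of degree q. *)
Definition homog_comp (M A B : {poly k}) : {poly k} :=
  \sum_(j < q.+1) M`_j *: (B ^+ j * A ^+ (q - j)).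

Lemma pu_homog_comp (M A B : {poly k}) u v : size M = q.+1 -> v * pu u A = pu u B ->
  pu u (homog_comp M A B) = pu u A ^+ q * pu v M.
Proof.
move=> sM E; rewrite (pu_expand i v) sM big_distrr /=.
rewrite /homog_comp (big_morph _ (puD i u) (pu0 i u)); apply: eq_bigr => -[j /=] + _.
rewrite ltnS => jq; rewrite puZ puM !puXn -E exprMn.
by rewrite -{2}(subnK jq) exprD; ring.
Qed.

Lemma horner_homog_comp (M A B : {poly k}) b : size M = q.+1 -> A.[b] = 0 ->
  (homog_comp M A B).[b] = lead_coef M * B.[b] ^+ q.
Proof.
move=> sM Ab; rewrite lead_coefE sM /= /homog_comp horner_sum big_ord_recr /=.
rewrite subnn expr0 mulr1 hornerZ horner_exp big1 ?add0r // => -[j /= jq] _.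
by rewrite hornerZ hornerM !horner_exp Ab expr0n subn_eq0 leqNgt jq /= !mulr0.
Qed.

(** By the second equation M2(y') = -c / M1(x') depends on x alone, so as a function of y it is
    invariant under translation by roots of L2. A nonconstant denominator C would give it exactly
    one finite pole, which a nonzero translation moves. *)
Lemma moebius_affine (L1 L2 M1 M2 : {poly k}) (x y x' y' : K) :
  curve_model i q c L1 L2 x y -> curve_model i q c M1 M2 x' y' ->
  moebius x x' -> moebius y y' -> exists g : {poly k}, (size g <= 2)%N /\ y' = pu y g.
Proof.
move=> H H' [A [B [A0 _ _ Ex]]] [C [D [C0 sC sD Ey]]].
have [sM1 sM2] := (additive_sep_size (cm_good1 H'), additive_sep_size (cm_good2 H')).
have Hs := cm_swap c0 H.
have [C1|C1] := leqP (size C) 1.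
  exists ((C`_0)^-1 *: D); split; first exact: leq_trans (size_scale_leq _ _) sD.
  have c00 : i C`_0 != 0 by rewrite fmorph_eq0 -polyC_eq0 -size1_polyC.
  by rewrite puZ -Ey {2}(size1_polyC C1) puC fmorphV mulrC mulfK.
have /closed_rootP[b0 rC] : size C != 1%N by rewrite gtn_eqF.
(* A common root of C and D would cancel and leave y' constant. *)
have Db0 : D.[b0] != 0.
  apply/eqP => Db; have [C' EC] := root_factor rC.
  have [|D' ED] := @root_factor _ D b0; first exact/eqP.
  have sz1 (p p' : {poly k}) : p = ('X - b0%:P) * p' -> (size p <= 2)%N -> (size p' <= 1)%N.
    move=> ->; have [->|p'0] := eqVneq p' 0; first by rewrite size_poly0.
    by rewrite size_monicM ?monicXsubC // size_XsubC.
  have [sC' sD'] := (sz1 _ _ EC sC, sz1 _ _ ED sD).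
  have yb : y - i b0 != 0 by rewrite subr_eq0; exact: cm_const Hs.
  have c00 : i C'`_0 != 0.
    rewrite fmorph_eq0 -polyC_eq0 -size1_polyC //.
    by apply: contraNneq C0 => C'0; rewrite EC C'0 mulr0.
  have : y' != i (D'`_0 / C'`_0) by exact: cm_const (cm_swap c0 H').
  apply/negP; rewrite negbK; apply/eqP; move: Ey.
  rewrite EC ED !puM puXsubC (size1_polyC sC') (size1_polyC sD') !puC !coefC eqxx.
  rewrite mulrCA => /(mulfI yb) Ey.
  by rewrite rmorphM fmorphV /= -Ey mulfK.
have [rs [urs srs rsE]] := additive_sep_fiber (cm_good2 H) q_gt0 0.
have [be rbe be0] : exists2 be, root L2 be & be != 0.
  case: rs urs srs rsE => [|a [|b rs]] /= u s rsE.
  - by have := q_gt0; rewrite -s.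
  - by have := q_gt1; rewrite -s.
  have ra : root L2 a by rewrite rootE -rsE mem_head.
  have rb : root L2 b by rewrite rootE -rsE !inE eqxx orbT.
  have [a0|a0] := eqVneq a 0; last by exists a.
  by exists b => //; move: u; rewrite inE negb_or a0 eq_sym => /andP[/andP[]].
pose h1 := homog_comp M1 A B; pose h2 := homog_comp M2 C D.
have E1 : pu x h1 = pu x A ^+ q * pu x' M1 by exact: pu_homog_comp.
have E2 : pu y h2 = pu y C ^+ q * pu y' M2 by exact: pu_homog_comp.
have h10 : h1 != 0.
  have : pu x h1 != 0.
    rewrite E1 mulf_neq0 ?expf_neq0 ?(cm_tr H) ?(cm_tr H') //.
    exact: additive_sep_neq0 (cm_good1 H').
  by apply: contraNneq => ->; rewrite pu0.
have rel a b : on_curve c L1 L2 a b -> h1.[a] * h2.[b] = - c * A.[a] ^+ q * C.[b] ^+ q.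
  move=> ab; have : ev x y (h1%:P * h2^:P + (c *: A ^+ q)%:P * (C ^+ q)^:P) = 0.
    rewrite evD !evM !evC !evY puZ !puXn E1 E2.
    have -> : i c = - (pu x' M1 * pu y' M2) by rewrite (cm_rel H') opprK.
    by ring.
  move/(ev0_on_curve q_gt1 c0 H ab); rewrite peD !peM !peC !peY hornerZ !horner_exp.
  by move/eqP; rewrite addr_eq0 => /eqP ->; ring.
pose T p : {poly k} := p \Po ('X + be%:P).
have TE p b : (T p).[b] = p.[b + be] by rewrite horner_comp hornerD hornerX hornerC.
(* Q is the translation invariance of h2 / C^q with denominators cleared. If nonzero, it would
   vanish over finitely many values of x only, whereas [rel] at (a, b) and (a, b + be) makes it
   vanish over a general a. *)
pose Q := h2 * T C ^+ q - T h2 * C ^+ q.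
have Q0 : Q = 0.
  have [//|Qn] := eqVneq Q 0.
  have yQ : ev x y Q^:P != 0 by rewrite evY; exact: cm_tr Hs _ Qn.
  have [d d0 dP] := cm_nonroot H yQ.
  have [a] := exists_nonroot (mulf_neq0 d0 (mulf_neq0 h10 (additive_sep_neq0 (cm_good1 H)))).
  rewrite !rootM !negb_or => /and3P[da ha La].
  have [bs [_ sbs bsE]] := additive_sep_fiber (cm_good2 H) q_gt0 (- c / L1.[a]).
  have [b bb] : exists b, b \in bs.
    by case: (bs) sbs => [|b bs'] E; [have := q_gt0; rewrite -E | exists b; rewrite mem_head].
  have ab : on_curve c L1 L2 a b.
    by move: bb; rewrite bsE => /eqP bE; rewrite /on_curve bE mulrC divfK ?addNr.
  have ab' : on_curve c L1 L2 a (b + be).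
    by rewrite /on_curve (additive_sep_add (cm_good2 H)) (eqP rbe) addr0.
  have := dP a b ab da; rewrite peY; apply: contraNeq => _; apply/eqP.
  rewrite /Q hornerD hornerN !hornerM !horner_exp !TE.
  apply: (mulfI (ha : h1.[a] != 0)); rewrite mulr0 mulrBr mulrA (rel _ _ ab).
  by rewrite mulrA (rel _ _ ab'); ring.
(* At b0 only h2(b0) C(b0 + be)^q survives and h2(b0) is nonzero, so b0 + be is a second root of
   C. *)
have := congr1 (fun p : {poly k} => p.[b0]) Q0.
rewrite horner0 /Q hornerD hornerN !hornerM !horner_exp !TE (eqP rC).
rewrite horner_homog_comp ?(eqP rC) // expr0n gtn_eqF //= mulr0 subr0 => /eqP.
rewrite !mulf_eq0 !expf_eq0 lead_coef_eq0 (negbTE (additive_sep_neq0 (cm_good2 H'))) (negbTE Db0) q_gt0 /=.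
move=> rC'; have : C == 0; last by rewrite (negbTE C0).
apply/eqP; apply: (roots_geq_poly_eq0 (rs := [:: b0; b0 + be])) => //=.
  by rewrite rC rootE rC'.
by rewrite inE andbT -subr_eq0 opprD addNKr oppr_eq0.
Qed.

Theorem linear_coordinates (L1 L2 M1 M2 : {poly k}) (x y x' y' : K) :
  curve_model i q c L1 L2 x y -> curve_model i q c M1 M2 x' y' ->
  exists g h : {poly k}, [/\ (size g <= 2)%N, (size h <= 2)%N &
    (x' = pu x g /\ y' = pu y h) \/ (x' = pu y g /\ y' = pu x h)].
Proof.
move=> H H'; have [Hs Hs'] := (cm_swap c0 H, cm_swap c0 H').
have [mx|mx] := moebius_coordinate H H'; have [my|my] := moebius_coordinate H Hs'.
- by case: (moebius_not_same H H' mx my).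
- have [h [sh Eh]] := moebius_affine H H' mx my.
  have [g [sg Eg]] := moebius_affine Hs Hs' my mx.
  by exists g, h; split=> //; left.
- have [h [sh Eh]] := moebius_affine Hs H' mx my.
  have [g [sg Eg]] := moebius_affine H Hs' my mx.
  by exists g, h; split=> //; right.
by case: (moebius_not_same Hs H' mx my).
Qed.
End TwoModels.

Local Open Scope quotient_scope.
Local Notation coord := Defs.coord.

(** * The plane curve and its rational functions *)

Section Homogenization.
Variable k : closedFieldType.

Definition vec (a b c : k) : 'I_3 -> k := fun j => tnth [tuple a; b; c] j.

Lemma homogenize_meval (f : {mpoly k[2]}) (v : 'I_3 -> k) : v ord_max != 0 ->
  (homogenize f).@[v] =
  v ord_max ^+ (msize f).-1 * f.@[fun j : 'I_2 => v (widen_ord (leqnSn 2) j) / v ord_max].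
Proof.
move=> v2; rewrite /homogenize raddf_sum [in RHS]mevalE big_distrr /=.
apply: eq_big_seq => m mf.
rewrite mevalZ !mevalM !rmorphXn /= !mevalXU [RHS]mulrCA; congr (_ * _).
have dm : (mdeg m <= (msize f).-1)%N by rewrite -ltnS prednK ?msize_mdeg_lt // (leq_trans _ (msize_mdeg_lt mf)).
rewrite -[in RHS](subnK dm) mdegE !big_ord_recl !big_ord0 !addn0 mulr1.
have -> : widen_ord (leqnSn 2) ord0 = 0 by exact: val_inj.
have -> : widen_ord (leqnSn 2) (lift ord0 ord0) = 1 by exact: val_inj.
have -> : lift ord0 ord0 = 1 :> 'I_2 by exact: val_inj.
rewrite !exprD !exprMn !exprVn.
have := (expf_neq0 (m 0) v2, expf_neq0 (m 1) v2) => -[h0 h1].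
move: (v ord_max ^+ m 0) (v ord_max ^+ m 1) h0 h1 => s0 s1 h0 h1.
move: (v ord_max ^+ (_ - _)) (v 0 ^+ m 0) (v 1 ^+ m 1) => e t0 t1.
by field; rewrite h0 h1.
Qed.

(** On the line X_2 = 0 only the form of top degree remains; d is that form in the coordinate X_1 /
    X_0. *)
Lemma homogenize_infinity (f : {mpoly k[2]}) : f != 0 ->
  exists2 d : {poly k}, d != 0 & forall v : 'I_3 -> k, v ord_max = 0 -> v 0 != 0 ->
   (homogenize f).@[v] = v 0 ^+ (msize f).-1 * d.[v 1 / v 0].
Proof.
move=> f0; pose D := (msize f).-1.
exists (\sum_(m <- msupp f | mdeg m == D) f@_m *: 'X^(m 1)).
  (* A monomial of top degree is determined by its second exponent, so this coefficient of d is the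
     leading coefficient of f. *)
  apply/eqP => /(congr1 (fun p : {poly k} => p`_(mlead f 1))).
  rewrite coef0 coef_sum big_mkcond (bigD1_seq (mlead f)) ?msupp_uniq ?mlead_supp //=.
  rewrite /D -(mlead_deg f0) eqxx coefZ coefXn eqxx mulr1 big1 ?addr0.
    by apply/eqP; rewrite mleadc_eq0.
  move=> m mf; case: eqP => // md; rewrite coefZ coefXn.
  case: eqP => [E|_]; last by rewrite mulr0.
  case/eqP: mf; apply/mnmP => j; have : mdeg m = mdeg (mlead f) by [].
  rewrite !mdegE !big_ord_recl !big_ord0 !addn0.
  have -> : lift ord0 ord0 = 1 :> 'I_2 by exact: val_inj.
  rewrite -E => /addIn E0; case: j => [[|[|//]] jl].
    by have -> : Ordinal jl = ord0 by exact: val_inj.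
  by have -> : Ordinal jl = 1 by exact: val_inj.
move=> v v2 v0; rewrite /homogenize raddf_sum horner_sum big_distrr [RHS]big_mkcond /=.
apply: eq_big_seq => m mf.
rewrite mevalZ !mevalM !rmorphXn /= !mevalXU v2.
have dm : (mdeg m <= D)%N by rewrite -ltnS prednK ?msize_mdeg_lt // (leq_trans _ (msize_mdeg_lt mf)).
rewrite expr0n subn_eq0; have [md|md] := eqVneq (mdeg m) D; last first.
  by rewrite leqNgt ltn_neqAle md dm !mulr0.
rewrite -/D -md leqnn mulr1 hornerZ hornerXn [RHS]mulrCA; congr (_ * _).
rewrite expr_div_n mdegE !big_ord_recl !big_ord0 !addn0 exprD.
have -> : lift ord0 ord0 = 1 :> 'I_2 by exact: val_inj.
rewrite -mulrA; congr (_ * _).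
by rewrite mulrCA divff ?mulr1 // expf_neq0.
Qed.

Lemma P2_eq (P Q : P2 k) s : s != 0 -> (forall j, coord P j = s * coord Q j) -> P = Q.
Proof.
move=> s0 E; rewrite -[P]reprK -[Q]reprK; apply/eqmodP/asboolP; exists s => //.
by apply/rowP => j; rewrite mxE; exact: E.
Qed.

Lemma P2_coord (v : 'I_3 -> k) j0 : v j0 != 0 ->
  exists P : P2 k, exists2 s, s != 0 & forall j, v j = s * coord P j.
Proof.
move=> v0; have r0 : \row_j v j != 0 :> 'rV_3.
  by apply: contraNneq v0 => /rowP/(_ j0); rewrite !mxE => ->.
pose w : nzvec k := exist (fun v : 'rV[k]_3 => v != 0) _ r0.
exists (\pi_(P2 k) w).
have /eqmodP/asboolP[s s0 E] : \pi_(P2 k) (repr (\pi_(P2 k) w)) = \pi_(P2 k) w by rewrite reprK.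
exists s^-1; first by rewrite invr_eq0.
by move=> j; rewrite /coord E !mxE /= mulKf.
Qed.

Definition xc (P : P2 k) : k := coord P 0 / coord P ord_max.
Definition yc (P : P2 k) : k := coord P 1 / coord P ord_max.
Definition finite_pt (P : P2 k) := coord P ord_max != 0.

Lemma I3_cases (A : 'I_3 -> Prop) : A 0 -> A 1 -> A ord_max -> forall j, A j.
Proof.
move=> A0 A1 A2 [[|[|[|//]]] jl].
- by have -> : Ordinal jl = 0 by exact: val_inj.
- by have -> : Ordinal jl = 1 by exact: val_inj.
by have -> : Ordinal jl = ord_max by exact: val_inj.
Qed.

Lemma finite_pt_eq (P Q : P2 k) : finite_pt P -> finite_pt Q ->
  xc P = xc Q -> yc P = yc Q -> P = Q.
Proof.
move=> P2 Q2 ex ey; apply: (@P2_eq _ _ (coord P ord_max / coord Q ord_max)).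
  by rewrite mulf_neq0 ?invr_eq0.
apply: I3_cases; last by rewrite divfK.
  by rewrite mulrAC -mulrA -/(xc Q) -ex mulrC divfK.
by rewrite mulrAC -mulrA -/(yc Q) -ey mulrC divfK.
Qed.

Lemma infinite_pt_eq (P Q : P2 k) : ~~ finite_pt P -> ~~ finite_pt Q ->
  coord P 0 != 0 -> coord Q 0 != 0 -> coord P 1 / coord P 0 = coord Q 1 / coord Q 0 ->
  P = Q.
Proof.
rewrite !negbK => /eqP P2 /eqP Q2 P0 Q0 E.
apply: (@P2_eq _ _ (coord P 0 / coord Q 0)); first by rewrite mulf_neq0 ?invr_eq0.
apply: I3_cases; [by rewrite divfK | | by rewrite P2 Q2 mulr0].
by rewrite mulrAC -mulrA -E mulrC divfK.
Qed.

Lemma vertical_pt_eq (P Q : P2 k) : ~~ finite_pt P -> ~~ finite_pt Q ->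
  coord P 0 = 0 -> coord Q 0 = 0 -> P = Q.
Proof.
rewrite !negbK => /eqP P2 /eqP Q2 P0 Q0.
have nz (R : @Defs.P2 k) : coord R ord_max = 0 -> coord R 0 = 0 -> coord R 1 != 0.
  move=> R2 R0; apply/eqP => R1; have := valP (repr R).
  by apply/negP; rewrite negbK; apply/eqP/rowP => j; rewrite mxE; move: j; apply: I3_cases.
have [P1 Q1] := (nz _ P2 P0, nz _ Q2 Q0).
apply: (@P2_eq _ _ (coord P 1 / coord Q 1)); first by rewrite mulf_neq0 ?invr_eq0.
by apply: I3_cases; [rewrite P0 Q0 mulr0 | rewrite divfK | rewrite P2 Q2 mulr0].
Qed.

(** Exceptional points are bounded through an invariant: each value of [key] in s accounts for at
    most one of them. *)
Lemma almost_all_key (F : {mpoly k[3]}) (A : curve F -> Prop) (T : eqType)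
    (key : curve F -> T) (s : seq T) :
  (forall P, ~ A P -> key P \in s) ->
  (forall P Q, ~ A P -> ~ A Q -> key P = key Q -> P = Q) -> almost_all A.
Proof.
move=> ks inj; have [l lP] : exists l : seq (curve F), forall P, ~ A P -> key P \in s -> P \in l.
  elim: s {ks} => [|t s [l IH]]; first by exists [::].
  have [[Q [nQ kQ]]|nex] := EM (exists Q, ~ A Q /\ key Q = t).
    exists (Q :: l) => P nP; rewrite inE => /orP[/eqP kP|/(IH P nP) Pl].
      by rewrite (inj P Q) ?mem_head // kP kQ.
    by rewrite inE Pl orbT.
  exists l => P nP; rewrite inE => /orP[/eqP kP|/(IH P nP) //].
  by case: nex; exists P.
exists l => P Pl; apply: contrapT => nP; move/negP: Pl; apply; apply: lP => //.
exact: ks.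
Qed.

(* The points outside the affine chart are the zeros of the form of top degree. *)
Lemma almost_all_finite (f : {mpoly k[2]}) : f != 0 ->
  almost_all (fun P : curve (homogenize f) => finite_pt (val P)).
Proof.
move=> f0; have [d d0 dE] := homogenize_infinity f0.
(* [None] stands for the single point (0 : 1 : 0); the other points at infinity are separated by X_1
   / X_0. *)
pose key (P : curve (homogenize f)) :=
  if coord (val P) 0 == 0 then None else Some (coord (val P) 1 / coord (val P) 0).
have [rs drs] := closed_field_poly_normal d.
apply: (almost_all_key (key := key) (s := None :: map Some rs)).
  move=> P /negP; rewrite negbK => /eqP P2; rewrite /key; case: ifPn => P0; first by rewrite mem_head.
  rewrite inE; apply/orP; right; apply/mapP; exists (coord (val P) 1 / coord (val P) 0) => //.
  have := eqP (valP P); rewrite (dE _ P2 P0) => /eqP.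
  rewrite mulf_eq0 expf_eq0 (negbTE P0) andbF /= -/(root _ _) drs rootZ ?lead_coef_eq0 //.
  by rewrite root_prod_XsubC.
move=> P Q /negP nP /negP nQ; rewrite /key.
case: eqVneq => P0; case: eqVneq => Q0 //.
  by move=> _; apply: val_inj; apply: vertical_pt_eq.
by move=> [E]; apply: val_inj; apply: infinite_pt_eq.
Qed.
End Homogenization.

Section RatfunField.
Variables (k : closedFieldType) (F : {mpoly k[3]}).

(* An alias of ratfun F whose arguments carry the proofs of the field axioms. *)
Definition ratfun_field (nz : (1 : ratfun F) != 0)
  (inv : forall z : ratfun F, z != 0 -> exists w, z * w = 1) := ratfun F.

Variables (nz : (1 : ratfun F) != 0).
Variable inv : forall z : ratfun F, z != 0 -> exists w, z * w = 1.
Local Notation K := (ratfun_field nz inv).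

HB.instance Definition _ := GRing.ComPzRing.on K.
HB.instance Definition _ := GRing.PzSemiRing_isNonZero.Build K nz.

Definition ratfun_inv (z : K) : K :=
  if pselect (z != 0) is left z0 then projT1 (cid (inv z0)) else 0.

Lemma ratfun_mulVf (z : K) : z != 0 -> ratfun_inv z * z = 1.
Proof.
rewrite /ratfun_inv => z0; case: pselect => [z0'|/(_ z0) //].
by rewrite mulrC; exact: (projT2 (cid (inv z0'))).
Qed.

Lemma ratfun_invr0 : ratfun_inv 0 = 0.
Proof.
by rewrite /ratfun_inv; case: pselect => // z0; have := z0; rewrite {1}eqxx.
Qed.

HB.instance Definition _ := GRing.ComNzRing_isField.Build K ratfun_mulVf ratfun_invr0.

Definition ratfun_field_const (a : k) : K := ratfun_const F a.

Lemma ratfun_field_const_additive : zmod_morphism ratfun_field_const.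
Proof.
move=> a b; apply/ratfun_eqP.
have := almost_allI (mk_ratfunE (is_ratfun_const F (a - b)))
  (almost_allI (mk_ratfunE (is_ratfun_const F a)) (mk_ratfunE (is_ratfun_const F b))).
have := mk_ratfunE (is_ratfunD (ratfun_valP (ratfun_const F a))
  (ratfun_valP (ratfun_opp (ratfun_const F b)))).
have := mk_ratfunE (is_ratfunN (ratfun_valP (ratfun_const F b))).
move=> /almost_allI h /h /almost_allI {}h /h.
by apply: almost_allS => P [[EN ED] [-> [E1 E2]]]; rewrite ED E1 EN E2.
Qed.

Lemma ratfun_field_const_multiplicative : monoid_morphism ratfun_field_const.
Proof.
split=> // a b; apply/ratfun_eqP.
have := almost_allI (mk_ratfunE (is_ratfun_const F (a * b)))
  (almost_allI (mk_ratfunE (is_ratfun_const F a)) (mk_ratfunE (is_ratfun_const F b))).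
have := mk_ratfunE (is_ratfunM (ratfun_valP (ratfun_const F a))
  (ratfun_valP (ratfun_const F b))).
move=> /almost_allI h /h.
by apply: almost_allS => P [EM [-> [E1 E2]]]; rewrite EM E1 E2.
Qed.

HB.instance Definition _ := GRing.isZmodMorphism.Build k K ratfun_field_const
  ratfun_field_const_additive.
HB.instance Definition _ := GRing.isMonoidMorphism.Build k K ratfun_field_const
  ratfun_field_const_multiplicative.

Definition fconst : {rmorphism k -> K} := ratfun_field_const.
End RatfunField.

Section Dehomogenization.
Variable k : closedFieldType.

Definition dehomog (G : {mpoly k[3]}) : {poly {poly k}} :=
  mmap (fun a : k => a%:P%:P) (fun j => tnth [tuple 'X%:P; 'X; 1] j) G.

Lemma pe_dehomog a b G : pe a b (dehomog G) = G.@[vec a b 1].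
Proof.
rewrite mevalE /dehomog /mmap (big_morph _ (peD a b) (pe0 a b)).
apply: eq_bigr => m _; rewrite peM !peC hornerC; congr (_ * _).
rewrite /mmap1 (big_morph _ (peM a b) (pe1 a b)); apply: eq_bigr => j _.
rewrite peXn; congr (_ ^+ _); rewrite /vec; move: j.
apply: I3_cases; rewrite !(tnth_nth 0) /=.
- by rewrite peC hornerX.
- by rewrite /pe map_polyX hornerX.
by rewrite pe1.
Qed.

Lemma meval_dehomog d (G : {mpoly k[3]}) (P : P2 k) : G \is d.-homog -> finite_pt P ->
  G.@[coord P] = coord P ord_max ^+ d * pe (xc P) (yc P) (dehomog G).
Proof.
move=> Gd P2; rewrite pe_dehomog; apply: meval_homogZ => //.
by apply: I3_cases; rewrite /vec !(tnth_nth 0) /= ?mulr1 // mulrC divfK.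
Qed.

Lemma meval_horner_alg n (j : 'I_n) (p : {poly k}) (w : 'I_n -> k) :
  (horner_alg 'X_j p).@[w] = p.[w j].
Proof.
elim/poly_ind: p => [|p a IH]; first by rewrite raddf0 meval0 horner0.
rewrite rmorphD rmorphM /= horner_algX horner_algC mevalD mevalM IH mevalXU.
by rewrite hornerD hornerMX hornerC mevalZ meval1 mulr1.
Qed.
End Dehomogenization.

(** * The function field of C as a curve model *)

Section ConcreteCurve.
Variables (k : closedFieldType) (q : nat) (c : k) (L1 L2 : {poly k}).
Hypotheses (q_gt1 : (1 < q)%N) (c0 : c != 0) (g1 : additive_sep q L1) (g2 : additive_sep q L2).

Definition affine_eq : {mpoly k[2]} := horner_alg 'X_0 L1 * horner_alg 'X_1 L2 + c%:MP.
Local Notation F := (homogenize affine_eq).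
Local Notation C := (curve F).
Let q_gt0 : (0 < q)%N := ltnW q_gt1.

Lemma meval_affine_eq w : affine_eq.@[w] = L1.[w 0] * L2.[w 1] + c.
Proof. by rewrite mevalD mevalM !meval_horner_alg mevalC. Qed.

Lemma affine_eq_neq0 : affine_eq != 0.
Proof.
apply/eqP => f0; have := meval_affine_eq (fun => 0).
by rewrite f0 meval0 (additive_sep0 g1) mul0r add0r => /esym/eqP; apply/negP.
Qed.

Lemma finite_pt_on_curve P : finite_pt P -> (F.@[coord P] == 0) = on_curve c L1 L2 (xc P) (yc P).
Proof.
move=> P2; rewrite homogenize_meval // mulf_eq0 expf_eq0 (negbTE P2) andbF /=.
rewrite meval_affine_eq /on_curve /xc /yc.
have -> : widen_ord (leqnSn 2) 0 = 0 by exact: val_inj.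
by have -> : widen_ord (leqnSn 2) 1 = 1 by exact: val_inj.
Qed.

Lemma curve_on_curve (P : C) : finite_pt (val P) -> on_curve c L1 L2 (xc (val P)) (yc (val P)).
Proof. by move=> P2; rewrite -finite_pt_on_curve //; exact: (valP P). Qed.

Lemma affine_point a b : on_curve c L1 L2 a b ->
  exists P : C, [/\ finite_pt (val P), xc (val P) = a & yc (val P) = b].
Proof.
move=> ab; have [|P [s s0 E]] := @P2_coord k (vec a b 1) ord_max.
  by rewrite /vec (tnth_nth 0) oner_neq0.
have := (E 0, E 1, E ord_max); rewrite /vec !(tnth_nth 0) /= => -[[E0 E1] E2].
have P2 : finite_pt P by apply: contraNneq (oner_neq0 k) => z; rewrite E2 z mulr0.
have s1 : s = (coord P ord_max)^-1 by apply: (mulIf P2); rewrite -E2 mulVf.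
have xa : xc P = a by rewrite /xc E0 s1 mulrC.
have yb : yc P = b by rewrite /yc E1 s1 mulrC.
have PC : F.@[coord P] == 0 by rewrite finite_pt_on_curve // xa yb.
by exists (exist _ P PC).
Qed.

Lemma aa_finite : almost_all (fun P : C => finite_pt (val P)).
Proof. exact: (almost_all_finite affine_eq_neq0). Qed.

Lemma aa_nonroot d : d != 0 ->
  almost_all (fun P : C => finite_pt (val P) /\ ~~ root d (xc (val P))).
Proof.
move=> d0; have [rs drs] := closed_field_poly_normal d.
pose fib a := projT1 (cid (additive_sep_fiber g2 q_gt0 (- c / L1.[a]))).
have fibE a b : (b \in fib a) = (L2.[b] == - c / L1.[a]).
  by have [_ _] := projT2 (cid (additive_sep_fiber g2 q_gt0 (- c / L1.[a]))); apply.
suff h : almost_all (fun P : C => ~ (finite_pt (val P) /\ root d (xc (val P)))).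
  by apply: almost_allS (almost_allI aa_finite h) => P [P2 nP]; split=> //; apply/negP => r; apply: nP.
apply: (@almost_all_key _ _ _ _ (fun P => (xc (val P), yc (val P)))
  [seq (a, b) | a <- rs, b <- fib a]).
  move=> P /contrapT[P2 r]; apply/allpairsPdep; exists (xc (val P)), (yc (val P)).
  split=> //; first by move: r; rewrite drs rootZ ?lead_coef_eq0 // root_prod_XsubC.
  have ab := curve_on_curve P2; have /andP[La _] := on_curve_neq0 c0 ab.
  rewrite fibE; move: ab; rewrite /on_curve addr_eq0 => /eqP <-.
  by rewrite mulrAC divff ?mul1r.
move=> P Q /contrapT[P2 _] /contrapT[Q2 _] [ex ey]; apply: val_inj.
exact: finite_pt_eq.
Qed.

(** Turns cofiniteness into the nonvanishing of a polynomial in x, a condition that field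
    homomorphisms can transport. *)
Lemma aa_cofinite (A : C -> Prop) : almost_all A -> exists2 d : {poly k}, d != 0 &
  forall P : C, finite_pt (val P) -> ~~ root d (xc (val P)) -> A P.
Proof.
move=> [s As]; exists (\prod_(Q <- s) ('X - (xc (val Q))%:P)).
  by apply/monic_neq0/monic_prod_XsubC.
move=> P _ nr; apply: As; apply: contra nr => Ps.
by rewrite -(big_map (fun Q : C => xc (val Q)) predT (fun a => 'X - a%:P)) root_prod_XsubC; apply/mapP; exists P.
Qed.

Lemma aa_point (A : C -> Prop) : almost_all A -> exists P : C, finite_pt (val P) /\ A P.
Proof.
move=> /aa_cofinite[d d0 dA].
have [a] := exists_nonroot (mulf_neq0 d0 (additive_sep_neq0 g1)).
rewrite rootM negb_or => /andP[da La].
have [bs [_ sbs bsE]] := additive_sep_fiber g2 q_gt0 (- c / L1.[a]).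
have [b bb] : exists b, b \in bs.
  by case: (bs) sbs => [|b bs'] E; [have := q_gt0; rewrite -E | exists b; rewrite mem_head].
have [|P [P2 xa yb]] := @affine_point a b.
  by move: bb; rewrite bsE => /eqP bE; rewrite /on_curve bE mulrC divfK ?addNr.
by exists P; split=> //; apply: dA; rewrite ?xa.
Qed.

(** This is the irreducibility of C in terms of points, and the reason why nonzero elements of
    [ratfun] are invertible. *)
Lemma pe_dichotomy (g : {poly {poly k}}) :
  (forall P : C, finite_pt (val P) -> pe (xc (val P)) (yc (val P)) g = 0) \/
  almost_all (fun P : C => pe (xc (val P)) (yc (val P)) g != 0).
Proof.
have r0 : root L1 0 by rewrite rootE (additive_sep0 g1).
have L20 : (1 < size L2)%N by rewrite (additive_sep_size g2) ltnS.
have c0' : (c%:P).[0] != 0 by rewrite hornerC.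
have [[n [e [Q [e0 E]]]]|[d [s [t [d0 E]]]]] :=
  Psi_dichotomy r0 (additive_sep_deriv_neq0 g1 0) c0' L20 g.
  left=> P P2; have ab := curve_on_curve P2; have /andP[La _] := on_curve_neq0 c0 ab.
  have := congr1 (pe (xc (val P)) (yc (val P))) E.
  rewrite peM pe_Psi hornerC (eqP ab) mulr0 peZ hornerZ horner_exp => /eqP.
  by rewrite !mulf_eq0 expf_eq0 (negbTE e0) (negbTE La) andbF => /eqP.
right; apply: almost_allS (aa_nonroot d0) => P [P2 nr].
apply: contraNneq nr => gz; have ab := curve_on_curve P2.
have := congr1 (pe (xc (val P)) (yc (val P))) E.
by rewrite peD !peM pe_Psi hornerC (eqP ab) gz !mulr0 addr0 peC rootE => <-.
Qed.

Lemma ratfun_val0 : almost_all (fun P => ratfun_val (0 : ratfun F) P = 0).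
Proof. exact: mk_ratfunE. Qed.
Lemma ratfun_val1 : almost_all (fun P => ratfun_val (1 : ratfun F) P = 1).
Proof. exact: mk_ratfunE. Qed.
Lemma ratfun_valD (z w : ratfun F) :
  almost_all (fun P => ratfun_val (z + w) P = ratfun_val z P + ratfun_val w P).
Proof. exact: mk_ratfunE. Qed.
Lemma ratfun_valM (z w : ratfun F) :
  almost_all (fun P => ratfun_val (z * w) P = ratfun_val z P * ratfun_val w P).
Proof. exact: mk_ratfunE. Qed.

Lemma ratfun_quotient (z : ratfun F) : exists g h : {poly {poly k}},
  almost_all (fun P => pe (xc (val P)) (yc (val P)) h != 0 /\
    ratfun_val z P = pe (xc (val P)) (yc (val P)) g / pe (xc (val P)) (yc (val P)) h).
Proof.
have [d [G [Hh [Gd Hd E]]]] := ratfun_valP z; exists (dehomog G), (dehomog Hh).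
apply: almost_allS (almost_allI aa_finite E) => P [P2 [H0 ->]].
move: H0; rewrite (meval_dehomog Gd P2) (meval_dehomog Hd P2).
rewrite mulf_eq0 negb_or => /andP[s0 h0]; split=> //.
by rewrite -mulf_div divff // mul1r.
Qed.

Lemma is_ratfunV (f : C -> k) : is_ratfun f -> almost_all (fun P => f P != 0) ->
  is_ratfun (fun P => (f P)^-1).
Proof.
move=> [d [G [Hh [Gd Hd E]]]] f0; exists d, Hh, G; split=> //.
apply: almost_allS (almost_allI E f0) => P [[H0 ->]].
by rewrite mulf_eq0 negb_or invr_eq0 invf_div => /andP[].
Qed.

Lemma ratfun_aa_neq0 (z : ratfun F) : z != 0 -> almost_all (fun P => ratfun_val z P != 0).
Proof.
move=> z0; have [g [h E]] := ratfun_quotient z.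
have [gz|gnz] := pe_dichotomy g.
  case/eqP: z0; apply/ratfun_eqP.
  apply: almost_allS (almost_allI (almost_allI aa_finite E) ratfun_val0) => P [[P2 [h0 ->]] ->].
  by rewrite gz // mul0r.
apply: almost_allS (almost_allI E gnz) => P [[h0 ->] g0].
by rewrite mulf_neq0 ?invr_eq0.
Qed.

Lemma ratfun_oner_neq0 : (1 : ratfun F) != 0.
Proof.
apply/eqP => E; have := almost_allI ratfun_val1 ratfun_val0; rewrite -E => h.
have [P [_ [E1 E0]]] := aa_point h; move: E0; rewrite E1 => /eqP.
by rewrite oner_eq0.
Qed.

Lemma ratfun_inverse (z : ratfun F) : z != 0 -> exists w, z * w = 1.
Proof.
move=> z0; have nz := ratfun_aa_neq0 z0.
have Hv := is_ratfunV (ratfun_valP z) nz; exists (mk_ratfun Hv); apply/ratfun_eqP.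
have := almost_allI (ratfun_valM z (mk_ratfun Hv)) (almost_allI (mk_ratfunE Hv)
  (almost_allI nz ratfun_val1)).
by apply: almost_allS => P [-> [-> [n0 ->]]]; rewrite divff.
Qed.

Definition KC := ratfun_field ratfun_oner_neq0 ratfun_inverse.
HB.instance Definition _ := GRing.Field.on KC.
Definition constC : {rmorphism k -> KC} := fconst ratfun_oner_neq0 ratfun_inverse.
Local Notation ev := (ev constC).
Local Notation pu := (pu constC).

Lemma is_ratfun_coord (j : 'I_3) : is_ratfun (fun P : C => coord (val P) j / coord (val P) ord_max).
Proof.
exists 1%N, 'X_j, 'X_ord_max; split.
- by rewrite dhomogX; apply/eqP; exact: mdeg1.
- by rewrite dhomogX; apply/eqP; exact: mdeg1.
by apply: almost_allS aa_finite => P P2; rewrite !mevalXU.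
Qed.

Definition xC : KC := mk_ratfun (is_ratfun_coord 0).
Definition yC : KC := mk_ratfun (is_ratfun_coord 1).

Lemma valC_eq (z w : KC) : almost_all (fun P => ratfun_val z P = ratfun_val w P) -> z = w.
Proof. by move=> /ratfun_eqP. Qed.

Lemma valC_const a : almost_all (fun P => ratfun_val (constC a) P = a).
Proof. exact: mk_ratfunE. Qed.

Lemma valC_x : almost_all (fun P => ratfun_val xC P = xc (val P)).
Proof. exact: mk_ratfunE. Qed.

Lemma valC_y : almost_all (fun P => ratfun_val yC P = yc (val P)).
Proof. exact: mk_ratfunE. Qed.

Lemma valC_D (z w : KC) :
  almost_all (fun P => ratfun_val (z + w) P = ratfun_val z P + ratfun_val w P).
Proof. exact: ratfun_valD. Qed.

Lemma valC_M (z w : KC) :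
  almost_all (fun P => ratfun_val (z * w) P = ratfun_val z P * ratfun_val w P).
Proof. exact: ratfun_valM. Qed.

Lemma valC_0 : almost_all (fun P => ratfun_val (0 : KC) P = 0).
Proof. exact: ratfun_val0. Qed.

Lemma valC_pu (z : KC) p : almost_all (fun P => ratfun_val (pu z p) P = p.[ratfun_val z P]).
Proof.
elim/poly_ind: p => [|p a IH].
  by rewrite pu0; apply: almost_allS valC_0 => P ->; rewrite horner0.
rewrite puD puM puX puC.
have := almost_allI (valC_D (pu z p * z) (constC a)) (almost_allI (valC_M (pu z p) z)
  (almost_allI IH (valC_const a))).
apply: almost_allS => P [-> [-> [-> ->]]].
by rewrite hornerD hornerMX hornerC.
Qed.

Lemma valC_ev (z w : KC) g :
  almost_all (fun P => ratfun_val (ev z w g) P = pe (ratfun_val z P) (ratfun_val w P) g).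
Proof.
elim/poly_ind: g => [|g p IH].
  by rewrite ev0; apply: almost_allS valC_0 => P ->; rewrite pe0.
rewrite evD evM evX evC.
have := almost_allI (valC_D (ev z w g * w) (pu z p)) (almost_allI (valC_M (ev z w g) w)
  (almost_allI IH (valC_pu z p))).
apply: almost_allS => P [-> [-> [-> ->]]].
by rewrite peD peM peC; congr (_ * _ + _); rewrite /pe map_polyX hornerX.
Qed.

Lemma valC_evxy g :
  almost_all (fun P => ratfun_val (ev xC yC g) P = pe (xc (val P)) (yc (val P)) g).
Proof.
apply: almost_allS (almost_allI (valC_ev xC yC g) (almost_allI valC_x valC_y)).
by move=> P [-> [-> ->]].
Qed.

Lemma curve_modelC : curve_model constC q c L1 L2 xC yC.
Proof.
split=> //.
- have -> : pu xC L1 * pu yC L2 = ev xC yC (L1%:P * L2^:P) by rewrite evM evC evY.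
  have -> : - constC c = constC (- c) by rewrite rmorphN.
  apply: valC_eq; apply: almost_allS (almost_allI (valC_evxy (L1%:P * L2^:P))
    (almost_allI (valC_const (- c)) aa_finite)) => P [-> [-> P2]].
  rewrite peM peC peY; apply/eqP; rewrite -addr_eq0.
  exact: curve_on_curve.
- move=> p p0; apply/eqP => E.
  have := almost_allI (aa_nonroot p0) (almost_allI (valC_pu xC p) (almost_allI valC_x valC_0)).
  move=> /aa_point[P [_ [[_ nr] [Ep [Ex E0]]]]]; move/negP: nr; apply.
  by rewrite rootE -Ex -Ep E E0.
move=> z; have [g [h E]] := ratfun_quotient z; exists g, h.
have h0 : ev xC yC h != 0.
  apply/eqP => hz; have := almost_allI E (almost_allI (valC_evxy h) valC_0).
  by move=> /aa_point[P [_ [[h0 _] [Eh E0]]]]; rewrite -Eh hz E0 eqxx in h0.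
split=> //; apply: (mulIf h0); rewrite divfK //; apply: valC_eq.
have := almost_allI (valC_M z (ev xC yC h)) (almost_allI E
  (almost_allI (valC_evxy h) (valC_evxy g))).
by apply: almost_allS => P [-> [[h0' ->] [-> ->]]]; rewrite divfK.
Qed.
End ConcreteCurve.

Section Transport.
Variables (k : closedFieldType) (K : fieldType) (i : {rmorphism k -> K}).
Variables (phi : {rmorphism K -> K}).
Hypothesis phi_i : forall a, phi (i a) = i a.

Lemma transport_pu u p : phi (pu i u p) = pu i (phi u) p.
Proof.
elim/poly_ind: p => [|p a IH]; first by rewrite !pu0 rmorph0.
by rewrite !puD !puM !puX !puC -IH rmorphD rmorphM phi_i.
Qed.

Lemma transport_ev u v g : phi (ev i u v g) = ev i (phi u) (phi v) g.
Proof.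
elim/poly_ind: g => [|g p IH]; first by rewrite !ev0 rmorph0.
by rewrite !evD !evM !evX !evC -IH rmorphD rmorphM transport_pu.
Qed.

Lemma transport_model q c L1 L2 x y : (forall z, exists w, phi w = z) ->
  curve_model i q c L1 L2 x y -> curve_model i q c L1 L2 (phi x) (phi y).
Proof.
move=> sur H; split; [exact: cm_good1 H | exact: cm_good2 H | | | ].
- by rewrite -!transport_pu -rmorphM (cm_rel H) rmorphN phi_i.
- by move=> p p0; rewrite -transport_pu fmorph_eq0; exact: cm_tr H _ p0.
move=> z; have [w <-] := sur z; have [g [h [h0 ->]]] := cm_gen H w.
by exists g, h; rewrite -!transport_ev fmorph_eq0 fmorph_div.
Qed.

End Transport.

Lemma transport_determined (k : closedFieldType) (K : fieldType) (i : {rmorphism k -> K})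
    (phi psi : {rmorphism K -> K}) q c L1 L2 x y :
  curve_model i q c L1 L2 x y -> (forall a, phi (i a) = i a) -> (forall a, psi (i a) = i a) ->
  phi x = psi x -> phi y = psi y -> phi =1 psi.
Proof.
move=> H phi_i psi_i ex ey z; have [g [h [h0 ->]]] := cm_gen H z.
by rewrite !fmorph_div !(transport_ev phi_i) !(transport_ev psi_i) ex ey.
Qed.

(** * Classification of places and separation of functions by residues *)

Section Places.
Variables (k : closedFieldType) (K : fieldType) (i : {rmorphism k -> K}).
Variables (q : nat) (c : k).
Hypotheses (q_gt1 : (1 < q)%N) (c0 : c != 0).
Variables (L1 L2 : {poly k}) (x y : K).
Hypothesis H : curve_model i q c L1 L2 x y.
Let q_gt0 : (0 < q)%N := ltnW q_gt1.

Lemma place_loc O : place i O ->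
  [\/ exists a b, [/\ on_curve c L1 L2 a b, mI O (x - i a) & O = aff i x y a b],
      exists b, [/\ root L2 b, ~ O x & O = inf i x y b]
    | exists a, [/\ root L1 a, ~ O y & O = inf i y x a] ].
Proof.
move=> pO; have Hs := cm_swap c0 H.
have [Ox|nOx] := EM (O x); last first.
  have [b rb mb] := place_pole_y q_gt1 H pO nOx.
  constructor 2; exists b; split=> //; apply/funext => z; apply/propext.
  exact: (inf_unique q_gt1 c0 H rb pO (mIV nOx) mb).
have [Oy|nOy] := EM (O y); last first.
  have [a ra ma] := place_pole_y q_gt1 Hs pO nOy.
  constructor 3; exists a; split=> //; apply/funext => z; apply/propext.
  exact: (inf_unique q_gt1 c0 Hs ra pO (mIV nOy) ma).
have [a [b [ab ma mb]]] := place_center q_gt1 c0 H pO Ox Oy.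
constructor 1; exists a, b; split=> //; apply/funext => z; apply/propext.
exact: (aff_unique q_gt1 c0 H ab pO ma mb).
Qed.

Lemma place_residue O z : place i O -> O z -> exists a, mI O (z - i a).
Proof.
move=> pO; have Hs := cm_swap c0 H.
have [[a [b [ab _ ->]]]|[b [rb _ ->]]|[a [ra _ ->]]] := place_loc pO.
- exact: (aff_residue q_gt1 c0 H ab).
- exact: (inf_residue q_gt1 c0 H rb).
exact: (inf_residue q_gt1 c0 Hs ra).
Qed.

(** Write z = g t / d(x) with g, t polynomials in x and y. Poles lie either at infinity or over a
    root of d, and each of these sets of places can be listed. *)
Lemma finite_poles (z : K) : exists s : seq (K -> Prop),
  forall O, place i O -> ~ O z -> O \in s.
Proof.
have Hs := cm_swap c0 H.
have [g [h [h0 zE]]] := cm_gen H z; have [d [t [d0 E]]] := cm_bezout q_gt1 c0 H h0.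
have [rs drs] := closed_field_poly_normal d.
have [r1 [_ _ r1E]] := additive_sep_fiber (cm_good1 H) q_gt0 0.
have [r2 [_ _ r2E]] := additive_sep_fiber (cm_good2 H) q_gt0 0.
pose fib a := projT1 (cid (additive_sep_fiber (cm_good2 H) q_gt0 (- c / L1.[a]))).
have fibE a b : (b \in fib a) = (L2.[b] == - c / L1.[a]).
  by have [_ _] := projT2 (cid (additive_sep_fiber (cm_good2 H) q_gt0 (- c / L1.[a]))); apply.
exists ([seq inf i x y b | b <- r2] ++ [seq inf i y x a | a <- r1] ++
        [seq aff i x y a b | a <- rs, b <- fib a]) => O pO nOz; rewrite !mem_cat.
have [[a [b [ab ma OE]]]|[b [rb _ ->]]|[a [ra _ ->]]] := place_loc pO; last 2 first.
- by rewrite map_f // r2E.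
- by rewrite (@map_f _ _ (inf i y x)) ?orbT // r1E.
apply/orP; right; apply/orP; right; rewrite OE; apply/allpairsPdep; exists a, b; split=> //; last first.
  have /andP[La _] := on_curve_neq0 c0 ab.
  rewrite fibE; move: ab; rewrite /on_curve addr_eq0 => /eqP <-.
  by rewrite mulrAC divff ?mul1r.
have da : d.[a] = 0.
  apply/eqP; apply: contrapT => /negP da; apply: nOz.
  have Ox := pl_res pO ma.
  have Oy : O y by rewrite OE; exact: (pl_res (aff_place q_gt1 c0 H ab) (aff_y q_gt1 c0 H ab)).
  have dx := mI_unit_res pO (mI_pu pO d Ox ma) da.
  have dx0 := cm_tr H d0.
  have t0 : ev i x y t != 0 by apply: contraNneq dx0 => t0; rewrite -E t0 mul0r.
  have -> : z = ev i x y g * ev i x y t * (pu i x d)^-1.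
    by rewrite zE -E; field; rewrite t0 h0.
  by apply: (plM pO _ dx); apply: (plM pO); apply: (pl_ev pO).
have : root d a by rewrite rootE da.
by rewrite drs rootZ ?lead_coef_eq0 // root_prod_XsubC.
Qed.

(** Take a different from the residues of x at the members of s; a place over x = a is then new. *)
Lemma infinite_places (s : seq (K -> Prop)) : exists2 O, place i O & O \notin s.
Proof.
have /choice[r rP] (O : K -> Prop) : exists a, forall b, place i O -> mI O (x - i b) -> b = a.
  have [[b [pO mb]]|n] := EM (exists b, place i O /\ mI O (x - i b)).
    by exists b => b' _ mb'; exact: (mI_res_uniq pO mb' mb).
  by exists 0 => b pO mb; case: n; exists b.
have p0 : \prod_(O <- s) ('X - (r O)%:P) != 0 :> {poly k} by apply/monic_neq0/monic_prod_XsubC.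
have [a] := exists_nonroot (mulf_neq0 p0 (additive_sep_neq0 (cm_good1 H))).
rewrite rootM negb_or => /andP[na La].
have [bs [_ sbs bsE]] := additive_sep_fiber (cm_good2 H) q_gt0 (- c / L1.[a]).
have [b bb] : exists b, b \in bs.
  by case: (bs) sbs => [|b bs'] E; [have := q_gt0; rewrite -E | exists b; rewrite mem_head].
have ab : on_curve c L1 L2 a b.
  by move: bb; rewrite bsE => /eqP bE; rewrite /on_curve bE mulrC divfK ?addNr.
have pO := aff_place q_gt1 c0 H ab; exists (aff i x y a b) => //.
apply: contra na => Os; rewrite -(big_map r predT (fun a => 'X - a%:P)) root_prod_XsubC.
rewrite (rP _ _ pO (aff_x q_gt1 c0 H ab)); exact: map_f.
Qed.

(** If z is nonzero, every place where it vanishes is a pole of z^-1, and there are finitely many of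
    those. *)
Lemma zero_of_residues (z : K) (s : seq (K -> Prop)) :
  (forall O, place i O -> O \notin s -> mI O z) -> z = 0.
Proof.
move=> mz; apply: contrapT => /eqP z0; have [t tP] := finite_poles z^-1.
have [O pO] := infinite_places (s ++ t); rewrite mem_cat negb_or => /andP[Os Ot].
case: (mz O pO Os) => [E|/(tP _ pO)]; first by rewrite E eqxx in z0.
by rewrite (negbTE Ot).
Qed.
End Places.

(** * Action of birational maps on the function field *)

Section Pullback.
Variables (k : closedFieldType) (F : {mpoly k[3]}).
Local Notation C := (curve F).

Lemma is_ratfun_comp (b : Bir F) (f : C -> k) : is_ratfun f ->
  is_ratfun (fun P => f (bir_val b P)).
Proof.
move=> [e [G [H [Ge He E]]]]; have [[d [M [Md ME]]] _] := bir_valP b.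
exists (d * e)%N, (G \mPo [tuple M j | j < 3]), (H \mPo [tuple M j | j < 3]).
split; [exact: comp_mpoly_homog | exact: comp_mpoly_homog | ].
apply: almost_allS (almost_allI ME (bir_pre b E)) => P [[a a0 MP] [H0 ->]].
have comp (T : {mpoly k[3]}) : T \is e.-homog ->
    (T \mPo [tuple M j | j < 3]).@[coord (val P)] = a ^+ e * T.@[coord (val (bir_val b P))].
  move=> Te; rewrite comp_mpoly_meval; apply: meval_homogZ => // j.
  by rewrite tnth_mktuple MP.
rewrite !comp // mulf_neq0 ?expf_neq0 //; split=> //.
by rewrite -mulf_div divff ?mul1r // expf_neq0.
Qed.

Definition bpull (b : Bir F) (z : ratfun F) : ratfun F :=
  mk_ratfun (is_ratfun_comp b (ratfun_valP z)).

Lemma bpullE b z : almost_all (fun P => ratfun_val (bpull b z) P = ratfun_val z (bir_val b P)).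
Proof. exact: mk_ratfunE. Qed.

Lemma bpullM (b b' : Bir F) z : bpull (bir_mul b b') z = bpull b' (bpull b z).
Proof.
apply/ratfun_eqP; have := almost_allI (bpullE (bir_mul b b') z) (almost_allI (bir_mulE b b')
  (almost_allI (bpullE b' (bpull b z)) (bir_pre b' (bpullE b z)))).
by apply: almost_allS => P [-> [-> [-> ->]]].
Qed.

Lemma bpull1 z : bpull (bir_one F) z = z.
Proof.
apply/ratfun_eqP; have := almost_allI (bpullE (bir_one F) z) (mk_birE (is_birational_id F)).
by apply: almost_allS => P [-> ->].
Qed.

Lemma bpull_const b a : bpull b (ratfun_const F a) = ratfun_const F a.
Proof.
apply/ratfun_eqP; have := almost_allI (bpullE b (ratfun_const F a))
  (almost_allI (mk_ratfunE (is_ratfun_const F a)) (bir_pre b (mk_ratfunE (is_ratfun_const F a)))).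
by apply: almost_allS => P [-> [-> ->]].
Qed.

Lemma bpull_sub b z w : bpull b (z - w) = bpull b z - bpull b w.
Proof.
apply/ratfun_eqP.
have Sub u v : almost_all (fun P => ratfun_val (u - v : ratfun F) P = ratfun_val u P - ratfun_val v P).
  have h : almost_all (fun P => ratfun_val (- v : ratfun F) P = - ratfun_val v P) by exact: mk_ratfunE.
  have h' : almost_all (fun P => ratfun_val (u + - v : ratfun F) P = ratfun_val u P + ratfun_val (- v : ratfun F) P)
    by exact: mk_ratfunE.
  by apply: almost_allS (almost_allI h h') => P [E ->]; rewrite E.
have := almost_allI (bpullE b (z - w)) (almost_allI (bir_pre b (Sub z w))
  (almost_allI (Sub (bpull b z) (bpull b w)) (almost_allI (bpullE b z) (bpullE b w)))).
by apply: almost_allS => P [-> [-> [-> [-> ->]]]].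
Qed.

Lemma bpull_mul b z w : bpull b (z * w) = bpull b z * bpull b w.
Proof.
apply/ratfun_eqP.
have Mul u v : almost_all (fun P => ratfun_val (u * v : ratfun F) P = ratfun_val u P * ratfun_val v P)
  by exact: mk_ratfunE.
have := almost_allI (bpullE b (z * w)) (almost_allI (bir_pre b (Mul z w))
  (almost_allI (Mul (bpull b z) (bpull b w)) (almost_allI (bpullE b z) (bpullE b w)))).
by apply: almost_allS => P [-> [-> [-> [-> ->]]]].
Qed.

End Pullback.

(** A relation involving y would make y rational in x, and one without y contradicts the
    transcendence of x. Matrices acting on (x, y, 1) are therefore unique. *)
Lemma model_free (k : closedFieldType) (K : fieldType) (i : {rmorphism k -> K}) q c L1 L2 x y
    (a b d : k) : (2 < q)%N -> c != 0 -> curve_model i q c L1 L2 x y ->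
  i a * x + i b * y + i d = 0 -> [/\ a = 0, b = 0 & d = 0].
Proof.
move=> q_gt2 c0 model E.
have b0 : b = 0.
  have [//|b0] := eqVneq b 0; case: (not_rational q_gt2 c0 model).
  exists b%:P, (- (a *: 'X + d%:P)); split; first by rewrite polyC_eq0.
  rewrite puN puD puZ puX !puC; apply/eqP; rewrite -addr_eq0; apply/eqP.
  by rewrite -E; ring.
have p0 : a *: 'X + d%:P = 0.
  apply: contrapT => /eqP/(cm_tr model)/negP; apply; apply/eqP.
  by rewrite puD puZ puX puC -E b0 rmorph0 mul0r addr0.
split=> //.
  by have := congr1 (fun p : {poly k} => p`_1) p0; rewrite coefD coefZ coefX coefC mulr1 addr0 coef0.
by have := congr1 (fun p : {poly k} => p`_0) p0; rewrite coefD coefZ coefX coefC mulr0 add0r coef0.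
Qed.

(** * Matrices of pullbacks and the homomorphism to PGL *)

Section FieldPullback.
Variables (k : closedFieldType) (q : nat) (c : k) (L1 L2 : {poly k}).
Hypotheses (q_gt2 : (2 < q)%N) (c0 : c != 0) (g1 : additive_sep q L1) (g2 : additive_sep q L2).
Local Notation F := (homogenize (affine_eq c L1 L2)).
Local Notation C := (curve F).
Local Notation q_gt1 := (ltnW q_gt2).
Local Notation K := (KC q_gt1 c0 g1 g2).
Local Notation iK := (constC q_gt1 c0 g1 g2).
Local Notation x := (xC q_gt1 c0 g1 g2).
Local Notation y := (yC q_gt1 c0 g1 g2).
Local Notation model := (curve_modelC q_gt1 c0 g1 g2).

Definition fpull (b : Bir F) : K -> K := bpull b.

Lemma fpull_additive b : zmod_morphism (fpull b).
Proof. by move=> z w; exact: bpull_sub. Qed.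

Lemma fpull_multiplicative b : monoid_morphism (fpull b).
Proof. by split=> [|z w]; [exact: bpull_const | exact: bpull_mul]. Qed.

HB.instance Definition _ b := GRing.isZmodMorphism.Build K K (fpull b) (fpull_additive b).
HB.instance Definition _ b := GRing.isMonoidMorphism.Build K K (fpull b) (fpull_multiplicative b).

Lemma fpull_const b a : fpull b (iK a) = iK a.
Proof. exact: bpull_const. Qed.

Lemma fpullM (b b' : Bir F) z : fpull (b * b')%g z = fpull b' (fpull b z).
Proof. exact: bpullM. Qed.

Lemma fpull1 z : fpull 1%g z = z.
Proof. exact: bpull1. Qed.

Lemma fpullVK b : cancel (fpull b^-1%g) (fpull b).
Proof. by move=> z; rewrite -fpullM mulVg fpull1. Qed.

Lemma fpull_inj (b b' : Bir F) : fpull b x = fpull b' x -> fpull b y = fpull b' y -> b = b'.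
Proof.
move=> ex ey; apply/bir_eqP.
have := almost_allI (almost_allI (bpullE b x) (bpullE b' x)) (almost_allI (bpullE b y) (bpullE b' y)).
have := almost_allI (almost_allI (bir_pre b (valC_x q_gt1 c0 g1 g2)) (bir_pre b' (valC_x q_gt1 c0 g1 g2)))
 (almost_allI (bir_pre b (valC_y q_gt1 c0 g1 g2)) (bir_pre b' (valC_y q_gt1 c0 g1 g2))).
move=> /almost_allI h /h /almost_allI {}h.
have := h _ (almost_allI (bir_pre b (aa_finite L2 c0 g1)) (bir_pre b' (aa_finite L2 c0 g1))).
apply: almost_allS => P [[[[E1 E2] [E3 E4]] [[E5 E6] [E7 E8]]] [f1 f2]].
apply: val_inj; apply: finite_pt_eq => //.
  by rewrite -E1 -E2 -E5 -E6; congr (ratfun_val _ P); exact: ex.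
by rewrite -E3 -E4 -E7 -E8; congr (ratfun_val _ P); exact: ey.
Qed.

Definition xy1 : 'cV[K]_3 := \col_j tnth [tuple x; y; 1] j.

Lemma xy1_free (A : 'rV[k]_3) : map_mx iK A *m xy1 = 0 -> A = 0.
Proof.
move=> /matrixP/(_ 0 0); rewrite mxE !big_ord_recl big_ord0 !mxE !(tnth_nth 0) /=.
set a := A 0 ord0; set b := A 0 (lift ord0 ord0); set d := A 0 _.
rewrite mulr1 addr0 => E.
rewrite addrA in E; have [a0 b0 d0] := model_free q_gt2 c0 model E.
apply/rowP => j; rewrite mxE; move: j; apply: I3_cases.
- by rewrite -[RHS]a0 /a; congr (A _ _); exact: val_inj.
- by rewrite -[RHS]b0 /b; congr (A _ _); exact: val_inj.
by rewrite -[RHS]d0 /d; congr (A _ _); exact: val_inj.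
Qed.

Lemma xy1_inj (A B : 'M[k]_3) : map_mx iK A *m xy1 = map_mx iK B *m xy1 -> A = B.
Proof.
move=> E; apply/eqP; rewrite -subr_eq0; apply/eqP/row_matrixP => j; rewrite row0.
by apply: xy1_free; rewrite map_row -row_mul map_mxB mulmxBl E subrr row0.
Qed.

Lemma pu_linear (z : K) (g : {poly k}) : (size g <= 2)%N -> pu iK z g = iK g`_1 * z + iK g`_0.
Proof.
move=> sg; rewrite /pu (@horner_coef_wide _ 2); last by apply: leq_trans (size_poly _ _) sg.
by rewrite !big_ord_recl big_ord0 !coef_map /= mulr1 expr1 addr0 addrC.
Qed.

Lemma fpull_matrix b : exists M : 'M[k]_3, map_mx (fpull b) xy1 = map_mx iK M *m xy1.
Proof.
have sur z : exists w, fpull b w = z by exists (fpull b^-1%g z); exact: fpullVK.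
have H' := transport_model (fpull_const b) sur model.
have [g [h [sg sh E]]] := linear_coordinates q_gt2 c0 model H'.
have xyE (M : 'M[k]_3) :
  fpull b x = iK (M 0 0) * x + iK (M 0 1) * y + iK (M 0 ord_max) ->
  fpull b y = iK (M 1 0) * x + iK (M 1 1) * y + iK (M 1 ord_max) ->
  M ord_max 0 = 0 -> M ord_max 1 = 0 -> M ord_max ord_max = 1 ->
  map_mx (fpull b) xy1 = map_mx iK M *m xy1.
  move=> Ex Ey E0 E1 E2; apply/colP => j; rewrite !mxE !big_ord_recl big_ord0 !mxE.
  rewrite !(tnth_nth 0) /= mulr1 addr0.
  have -> : lift ord0 ord0 = 1 :> 'I_3 by exact: val_inj.
  have -> : lift ord0 (lift ord0 ord0) = ord_max :> 'I_3 by exact: val_inj.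
  rewrite addrA; move: j; apply: I3_cases => //=.
  by rewrite E0 E1 E2 !rmorph0 !rmorph1 !mul0r !add0r.
case: E => -[Ex Ey]; rewrite (pu_linear _ sg) in Ex; rewrite (pu_linear _ sh) in Ey.
  exists (\matrix_(r, s) nth 0 (nth [::] [:: [:: g`_1; 0; g`_0]; [:: 0; h`_1; h`_0]; [:: 0; 0; 1]] r) s).
  apply: xyE; rewrite !mxE //=; first by rewrite Ex rmorph0 mul0r addr0.
  by rewrite Ey rmorph0 mul0r add0r.
exists (\matrix_(r, s) nth 0 (nth [::] [:: [:: 0; g`_1; g`_0]; [:: h`_1; 0; h`_0]; [:: 0; 0; 1]] r) s).
apply: xyE; rewrite !mxE //=; first by rewrite Ex rmorph0 mul0r add0r.
by rewrite Ey rmorph0 mul0r addr0.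
Qed.

Definition bmx b : 'M[k]_3 := projT1 (cid (fpull_matrix b)).

Lemma bmxE b : map_mx (fpull b) xy1 = map_mx iK (bmx b) *m xy1.
Proof. exact: projT2 (cid (fpull_matrix b)). Qed.

(** Pullback reverses products, but the pullback by b' fixes the constant matrix of b and acts on
    the column to its right: this second reversal restores the order. Uniqueness of the matrix turns
    the identity on [xy1] into one of matrices. *)
Lemma bmxM (b b' : Bir F) : bmx (b * b')%g = bmx b *m bmx b'.
Proof.
apply: xy1_inj; rewrite -bmxE map_mxM -mulmxA -bmxE.
have -> : map_mx iK (bmx b) = map_mx (fpull b') (map_mx iK (bmx b)).
  by apply/matrixP => r s; rewrite !mxE [RHS]fpull_const.
rewrite -map_mxM -bmxE; apply/matrixP => r s; rewrite !mxE.
exact: fpullM.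
Qed.

Lemma bmx1 : bmx 1%g = 1%:M.
Proof.
apply: xy1_inj; rewrite -bmxE map_mx1 mul1mx.
by apply/matrixP => r s; rewrite !mxE fpull1.
Qed.

Lemma bmx_unit b : bmx b \in unitmx.
Proof. by apply: (mulmx1_unit (B := bmx b^-1%g) _).1; rewrite -bmxM mulgV bmx1. Qed.

Definition PGL_of_bir (b : Bir F) : PGL 3 k := \pi_(PGL 3 k) (mk_GL (bmx_unit b)).

Lemma PGL_of_birM : {morph PGL_of_bir : b b' / (b * b')%g}.
Proof.
move=> b b'; rewrite /PGL_of_bir [RHS]PGL_mulE; apply: PGL_pi_eq => /=.
exact: bmxM.
Qed.

Lemma PGL_of_bir_inj : injective PGL_of_bir.
Proof.
move=> b b' /PGL_eqP[a a0 /= E].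
have EE : map_mx (fpull b) xy1 = iK a *: map_mx (fpull b') xy1.
  by rewrite !bmxE E map_mxZ scalemxAl.
(* The last entry of [xy1] is 1, fixed by every pullback, which normalizes the scalar. *)
have a1 : iK a = 1.
  have := congr1 (fun M : 'cV[K]_3 => M ord_max 0) EE; rewrite !mxE (tnth_nth 0) /=.
  by rewrite !rmorph1 mulr1.
rewrite a1 scale1r in EE; apply: fpull_inj.
  by have := congr1 (fun M : 'cV[K]_3 => M 0 0) EE; rewrite !mxE (tnth_nth 0) /=.
by have := congr1 (fun M : 'cV[K]_3 => M 1 0) EE; rewrite !mxE (tnth_nth 0) /=.
Qed.
End FieldPullback.

Lemma place_comp (k K : fieldType) (i : {rmorphism k -> K}) (phi : {rmorphism K -> K})
    (O : K -> Prop) : (forall a, phi (i a) = i a) -> (forall z, exists w, phi w = z) ->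
  place i O -> place i (fun z => O (phi z)).
Proof.
move=> phi_i sur pO; split.
- by move=> a; rewrite phi_i; exact: (plC pO).
- by move=> z w Oz Ow; rewrite rmorphB; exact: (plB pO).
- by move=> z w Oz Ow; rewrite rmorphM; exact: (plM pO).
- by have [_ _ _ [z nz] _] := pO; have [w E] := sur z; exists w; rewrite E.
by move=> z; rewrite fmorphV; exact: (plV pO).
Qed.

Lemma mI_comp (K : fieldType) (phi : {rmorphism K -> K}) (O : K -> Prop) z :
  mI (fun z => O (phi z)) z <-> mI O (phi z).
Proof.
rewrite /mI fmorphV; split=> -[E|]; try by right.
  by left; rewrite E rmorph0.
by left; apply/eqP; rewrite -(fmorph_eq0 phi) E.
Qed.

(** * Birational maps and automorphisms of the smooth model *)

Section Theta.
Variables (k : closedFieldType) (q : nat) (c : k) (L1 L2 : {poly k}).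
Hypotheses (q_gt2 : (2 < q)%N) (c0 : c != 0) (g1 : additive_sep q L1) (g2 : additive_sep q L2).
Local Notation F := (homogenize (affine_eq c L1 L2)).
Local Notation C := (curve F).
Local Notation X := (smooth_model F).
Local Notation q_gt1 := (ltnW q_gt2).
Local Notation K := (KC q_gt1 c0 g1 g2).
Local Notation iK := (constC q_gt1 c0 g1 g2).
Local Notation x := (xC q_gt1 c0 g1 g2).
Local Notation y := (yC q_gt1 c0 g1 g2).
Local Notation model := (curve_modelC q_gt1 c0 g1 g2).
Local Notation fpull := (@fpull k q c L1 L2 q_gt2 c0 g1 g2).
Implicit Types (b : Bir F) (p : X).

Definition O_ p : K -> Prop := val p.

Lemma O_place p : place iK (O_ p).
Proof.
have /asboolP[h1 h2 h3 h4 h5] := valP p; split=> // z.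
have [->|z0] := eqVneq z 0; first by left; exact: (h1 0).
have [Oz|[w Ow zw]] := h5 z (elimN eqP z0); [by left|right].
suff -> : z^-1 = w :> K by [].
by apply: (mulfI z0); rewrite divff //; symmetry; exact: zw.
Qed.

Lemma place_X (O : K -> Prop) : place iK O -> `[< is_place (O : ratfun F -> Prop) >].
Proof.
move=> pO; have [h1 h2 h3 h4 h5] := pO; apply/asboolP; split=> // z /eqP z0.
have [Oz|Oz] := h5 z; [by left | right; exists ((z : K)^-1) => //].
exact: (@divff K z).
Qed.

Definition place_pt (O : K -> Prop) (pO : place iK O) : X :=
  exist (fun O : ratfun F -> Prop => `[< is_place O >]) O (place_X pO).

Lemma in_max_idealE p (z : K) : in_max_ideal p z <-> mI (O_ p) z.
Proof.
split.
  move=> [Oz nz]; have [->|z0] := eqVneq z 0; [by left|right=> Oi].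
  by apply: nz; exists ((z : K)^-1) => //; exact: (@divff K z).
move=> m; split; first exact: (mI_pl (O_place p) m).
move=> [w Ow zw]; case: m => [z0|]; last apply.
  by have := oner_neq0 K; rewrite -[1]zw z0 [X in X != 0](@mul0r K w) eqxx.
have z0 : z != 0.
  by apply/eqP => z0; have := oner_neq0 K; rewrite -[1]zw z0 [X in X != 0](@mul0r K w) eqxx.
suff -> : z^-1 = w :> K by [].
by apply: (mulfI z0); rewrite divff //; symmetry; exact: zw.
Qed.

Lemma residueE p (z : K) a : residue p z a <-> mI (O_ p) (z - iK a).
Proof.
split; first by move=> [_ /in_max_idealE].
move=> m; split; last exact/in_max_idealE.
exact: (pl_res (O_place p) m).
Qed.

Lemma residue_ex p (z : K) : O_ p z -> exists a, residue p z a.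
Proof.
move=> Oz; have [a m] := place_residue q_gt1 c0 model (O_place p) Oz.
by exists a; apply/residueE.
Qed.

Lemma residue_uniq p (z : K) a a' : residue p z a -> residue p z a' -> a = a'.
Proof. by move=> /residueE ma /residueE mb; exact: (mI_res_uniq (O_place p) ma mb). Qed.

Lemma finite_poles_X (z : K) : exists s : seq X, forall p, p \notin s -> O_ p z.
Proof.
have [s sP] := finite_poles q_gt1 c0 model z.
exists (pmap insub s) => p; rewrite mem_pmap_sub => ps.
by apply: contrapT => /(sP _ (O_place p)); rewrite (negbTE ps).
Qed.

(** The principle by which functions known only through their values on X are identified. *)
Lemma eq_of_residues (z w : K) (s : seq X) :
  (forall p, p \notin s -> exists a, residue p z a /\ residue p w a) -> z = w.
Proof.
move=> h; apply/eqP; rewrite -subr_eq0; apply/eqP.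
apply: (zero_of_residues q_gt1 c0 model (s := map val s)) => O pO Os.
pose p := place_pt pO.
have ps : p \notin s by apply: contra Os => ps; apply/mapP; exists p.
have [a [/residueE ma /residueE mb]] := h p ps.
have := mIB pO ma mb; rewrite opprB addrA subrK; apply.
Qed.

Lemma pull_place_subproof b p : place iK (fun z => O_ p (fpull b z)).
Proof.
apply: place_comp (O_place p); first exact: fpull_const.
by move=> z; exists (fpull b^-1%g z); exact: fpullVK.
Qed.

(** The action of b on points of X: a function is regular at the image of p when its pullback is
    regular at p. Being contravariant twice, it preserves the order of products. *)
Definition pull_place b p : X := place_pt (pull_place_subproof b p).

Lemma pull_placeE b p z : O_ (pull_place b p) z = O_ p (fpull b z).
Proof. by []. Qed.

Lemma pull_placeM b b' p : pull_place (b * b')%g p = pull_place b (pull_place b' p).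
Proof.
apply: val_inj; apply/funext => z; rewrite -[LHS]/(O_ (pull_place (b * b')%g p) z).
by rewrite pull_placeE fpullM.
Qed.

Lemma pull_place1 p : pull_place 1%g p = p.
Proof.
apply: val_inj; apply/funext => z; rewrite -[LHS]/(O_ (pull_place 1%g p) z).
by rewrite pull_placeE fpull1.
Qed.

Lemma pull_residue b p (z : K) a : residue p (fpull b z) a <-> residue (pull_place b p) z a.
Proof.
have E : mI (O_ (pull_place b p)) (z - iK a) <-> mI (O_ p) (fpull b z - iK a).
  have -> : fpull b z - iK a = fpull b (z - iK a) by rewrite rmorphB /= fpull_const.
  exact: mI_comp.
by split=> /residueE m; apply/residueE; apply/E.
Qed.

Lemma pull_morphism b : is_morphism (pull_place b).
Proof.
split=> [U [nU|[s Us]]|U g _ [z zP]].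
- by left=> p; exact: nU.
- right; exists (map (pull_place b^-1%g) s) => p ps; apply: Us.
  apply: contra ps => ps; apply/mapP; exists (pull_place b p) => //.
  by rewrite -pull_placeM mulVg pull_place1.
by exists (fpull b z) => p Up; apply/pull_residue; exact: zP.
Qed.

Lemma pull_automorphism b : is_automorphism (pull_place b).
Proof.
split; first exact: pull_morphism.
exists (pull_place b^-1%g); split; first exact: pull_morphism.
  by move=> p; rewrite -pull_placeM mulVg pull_place1.
by move=> p; rewrite -pull_placeM mulgV pull_place1.
Qed.

Definition aut_of_bir b : AutX F := mk_aut (pull_automorphism b).

Lemma aut_of_birM b b' : aut_of_bir (b * b')%g = (aut_of_bir b * aut_of_bir b')%g.
Proof. by apply: val_inj; apply/funext => p; exact: pull_placeM. Qed.

Lemma pull_place_fixed b : pull_place b =1 id -> b = 1%g.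
Proof.
move=> fix_b.
have fixed (z : K) : fpull b z = z.
  have [s sP] := finite_poles_X z; apply: (@eq_of_residues _ _ s) => p /sP Oz.
  have [a ra] := residue_ex Oz; exists a; split=> //.
  by apply/pull_residue; rewrite fix_b.
by apply: (@fpull_inj _ _ _ _ _ q_gt2 c0 g1 g2); rewrite !fixed fpull1.
Qed.

Lemma aut_of_bir_inj : injective aut_of_bir.
Proof.
move=> b b' E; have {}E p : pull_place b p = pull_place b' p.
  by have := congr1 (fun s : AutX F => val s p) E.
have /pull_place_fixed : pull_place (b'^-1 * b)%g =1 id.
  by move=> p; rewrite pull_placeM E -pull_placeM mulVg pull_place1.
by move=> E1; rewrite -[b]mul1g -(mulgV b') -mulgA E1 mulg1.
Qed.

(** Where the forms [M] represent b at Q, substituting them into a fraction that has a value at b(Q)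
    gives a fraction for the pulled back function with the same value at Q. *)
Lemma aut_of_bir_induces b : induces (aut_of_bir b) b.
Proof.
have [[d [M [Md ME]]] _] := bir_valP b.
have comp e Q (T : {mpoly k[3]}) (s : k) :
    (forall j, (M j).@[coord (val Q)] = s * coord (val (bir_val b Q)) j) -> T \is e.-homog ->
    (T \mPo [tuple M j | j < 3]).@[coord (val Q)] = s ^+ e * T.@[coord (val (bir_val b Q))].
  move=> sE Te; rewrite comp_mpoly_meval; apply: meval_homogZ => // j.
  by rewrite tnth_mktuple sE.
apply: (almost_allS _ ME) => Q [s s0 sE] p pQ z a [e [G [H [[Ge He] zE H0 ->]]]].
apply/pull_residue; apply: pQ.
exists (d * e)%N, (G \mPo [tuple M j | j < 3]), (H \mPo [tuple M j | j < 3]); split.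
- by split; exact: comp_mpoly_homog.
- apply: almost_allS (almost_allI ME (almost_allI (bir_pre b zE) (bpullE b z))).
  move=> Q' [[s' s'0 s'E] [[H0' E'] E]].
  rewrite (comp _ _ _ _ s'E Ge) (comp _ _ _ _ s'E He) mulf_neq0 ?expf_neq0 //; split=> //.
  by rewrite -mulf_div divff ?mul1r ?expf_neq0 // -E'; exact: E.
- by rewrite (comp _ _ _ _ sE He) mulf_neq0 ?expf_neq0.
by rewrite (comp _ _ _ _ sE Ge) (comp _ _ _ _ sE He) -mulf_div divff ?mul1r ?expf_neq0.
Qed.

Definition gen_values (z w : K) (m : C -> C) := almost_all (fun P =>
  [/\ finite_pt (val (m P)), xc (val (m P)) = ratfun_val z P &
      yc (val (m P)) = ratfun_val w P]).

Lemma point_map_exists (z w : K) : pu iK z L1 * pu iK w L2 = - iK c ->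
  exists m : C -> C, gen_values z w m.
Proof.
move=> E; have /choice[m mP] (P : C) : exists Q : C,
    on_curve c L1 L2 (ratfun_val z P) (ratfun_val w P) ->
    [/\ finite_pt (val Q), xc (val Q) = ratfun_val z P & yc (val Q) = ratfun_val w P].
  have [/affine_point[Q hQ]|] := boolP (on_curve c L1 L2 (ratfun_val z P) (ratfun_val w P)).
    by exists Q.
  by exists P.
exists m.
have := almost_allI (almost_allI (valC_pu z L1) (valC_pu w L2))
  (almost_allI (valC_M (pu iK z L1) (pu iK w L2)) (valC_const q_gt1 c0 g1 g2 (- c))).
apply: almost_allS => P [[E1 E2] [EM Ec]]; apply: mP.
by rewrite /on_curve -E1 -E2 -EM E -rmorphN Ec addNr.
Qed.

Lemma point_map_ratmap (z w : K) m : gen_values z w m -> is_ratmap m.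
Proof.
move=> mE.
have [d [G [H [Gd Hd GH]]]] := ratfun_valP z.
have [d' [G' [H' [Gd' Hd' GH']]]] := ratfun_valP w.
exists (d + d')%N, (fun j => tnth [tuple G * H'; G' * H; H * H'] j); split.
  apply: I3_cases; rewrite (tnth_nth 0) /=; first exact: dhomogM.
    by rewrite addnC; exact: dhomogM.
  exact: dhomogM.
apply: almost_allS (almost_allI mE (almost_allI GH GH')) => P [[f ex ey] [[H0 Ez] [H'0 Ew]]].
have f' : coord (val (m P)) ord_max != 0 by [].
exists ((H * H').@[coord (val P)] / coord (val (m P)) ord_max).
  by rewrite mulf_neq0 ?invr_eq0 // mevalM mulf_neq0.
have Ex : coord (val (m P)) 0 = ratfun_val z P * coord (val (m P)) ord_max.
  by rewrite -ex /xc divfK.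
have Ey : coord (val (m P)) 1 = ratfun_val w P * coord (val (m P)) ord_max.
  by rewrite -ey /yc divfK.
apply: I3_cases; rewrite (tnth_nth 0) /= !mevalM.
- by rewrite Ex Ez; field; rewrite H0 f'.
- by rewrite Ey Ew; field; rewrite H'0 f'.
by rewrite divfK.
Qed.

Section PointMap.
Variables phi : {rmorphism K -> K}.
Hypothesis phi_c : forall a, phi (iK a) = iK a.
Variable m : C -> C.
Hypothesis mE : gen_values (phi x) (phi y) m.

(** No inverse of m is available yet. The exceptional points lie over roots of some d, and d(phi x)
    = phi(d(x)) is nonzero because phi is injective. *)
Lemma point_map_pre (A : C -> Prop) : almost_all A -> almost_all (fun P => A (m P)).
Proof.
move=> /aa_cofinite[d d0 dA].
have n0 : pu iK (phi x) d != 0.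
  by rewrite -(transport_pu phi_c) fmorph_eq0; exact: (cm_tr model).
have := almost_allI (ratfun_aa_neq0 q_gt1 c0 g1 g2 n0) (almost_allI (valC_pu (phi x) d) mE).
apply: almost_allS => P [nz [E [f ex ey]]]; apply: dA => //.
by rewrite rootE ex -E.
Qed.

(** True for x and y by construction of m, hence for polynomials in them, hence for their
    quotients. *)
Lemma point_map_value (z : K) :
  almost_all (fun P => ratfun_val (phi z) P = ratfun_val z (m P)).
Proof.
have [g [h [h0 zE]]] := cm_gen model z.
have n0 : phi (ev iK x y h) != 0 by rewrite fmorph_eq0.
have zE' : phi z * phi (ev iK x y h) = phi (ev iK x y g).
  by rewrite -rmorphM /= zE divfK.
have zE'' : z * ev iK x y h = ev iK x y g by rewrite zE divfK.
have V (t : {poly {poly k}}) : almost_all (fun P =>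
    ratfun_val (phi (ev iK x y t)) P = ratfun_val (ev iK x y t) (m P)).
  rewrite (transport_ev phi_c).
  have := almost_allI (valC_ev (phi x) (phi y) t) (almost_allI mE
    (point_map_pre (valC_evxy q_gt1 c0 g1 g2 t))).
  by apply: almost_allS => P [-> [[_ -> ->] ->]].
have := almost_allI (almost_allI (V g) (V h)) (almost_allI
  (almost_allI (valC_M (phi z) (phi (ev iK x y h))) (point_map_pre (valC_M z (ev iK x y h))))
  (ratfun_aa_neq0 q_gt1 c0 g1 g2 n0)).
apply: almost_allS => P [[Eg Eh] [[E1 E2] nz]].
by apply: (mulIf nz); rewrite -E1 zE' Eg Eh -E2 zE''.
Qed.
End PointMap.

(* The point map of phi sends P to the point with affine coordinates (phi x)(P)
   and (phi y)(P). *)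
Lemma bir_of_hom (phi psi : {rmorphism K -> K}) :
  (forall a, phi (iK a) = iK a) -> (forall a, psi (iK a) = iK a) ->
  cancel phi psi -> cancel psi phi -> exists b, fpull b =1 phi.
Proof.
move=> phi_c psi_c phiK psiK.
have mex (f : {rmorphism K -> K}) (f_c : forall a, f (iK a) = iK a) :
    exists m, gen_values (f x) (f y) m.
  apply: point_map_exists; rewrite -!(transport_pu f_c) -rmorphM (cm_rel model).
  by rewrite rmorphN /= f_c.
have [m mE] := mex _ phi_c; have [n nE] := mex _ psi_c.
(* For almost all P, x(mf'(mf P)) = (f' x)(mf P) = (f (f' x))(P) = x(P), and likewise for y. *)
have inv (f f' : {rmorphism K -> K}) (mf mf' : C -> C) :
    (forall a, f (iK a) = iK a) -> gen_values (f x) (f y) mf ->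
    gen_values (f' x) (f' y) mf' -> cancel f' f -> almost_all (fun P => mf' (mf P) = P).
  move=> f_c fE f'E K'.
  have := almost_allI (point_map_pre f_c fE f'E) (almost_allI
    (almost_allI (point_map_value f_c fE (f' x)) (point_map_value f_c fE (f' y)))
    (almost_allI (almost_allI (valC_x q_gt1 c0 g1 g2) (valC_y q_gt1 c0 g1 g2)) (aa_finite L2 c0 g1))).
  apply: almost_allS => P [[f1 ex ey] [[Ex Ey] [[X1 Y1] f2]]].
  apply: val_inj; apply: finite_pt_eq => //.
    by rewrite ex -Ex K' X1.
  by rewrite ey -Ey K' Y1.
have bm : is_birational m.
  split; first exact: point_map_ratmap mE.
  exists n; split; first exact: point_map_ratmap nE.
  by split; [apply: (inv phi psi) | apply: (inv psi phi)].
exists (mk_bir bm).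
apply: (transport_determined model) => //; first exact: fpull_const.
  apply: valC_eq; have := almost_allI (bpullE (mk_bir bm) x) (almost_allI (mk_birE bm)
    (point_map_value phi_c mE x)).
  by apply: almost_allS => P [Eb [Em ->]]; rewrite -Em; exact: Eb.
apply: valC_eq; have := almost_allI (bpullE (mk_bir bm) y) (almost_allI (mk_birE bm)
  (point_map_value phi_c mE y)).
by apply: almost_allS => P [Eb [Em ->]]; rewrite -Em; exact: Eb.
Qed.

(* phi z is the regular function attached to z o sigma on the complement of the
   poles of z. *)
Lemma morphism_pullback (sigma : X -> X) : is_morphism sigma ->
  exists phi : K -> K, forall z p a, residue (sigma p) z a -> residue p (phi z) a.
Proof.
move=> [_ reg]; suff /choice[phi phiP] (z : K) : exists w : K, forall p a,
  residue (sigma p) z a -> residue p w a by exists phi.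
have /choice[g gP] (p : X) : exists a, O_ p z -> residue p z a.
  have [Oz|nOz] := EM (O_ p z); last by exists 0.
  by have [a ra] := residue_ex Oz; exists a.
have oU : zopen (fun p : X => O_ p z).
  by right; exact: finite_poles_X.
have rU : regular_on (fun p : X => O_ p z) g by exists z; exact: gP.
have [w wP] := reg _ _ oU rU; exists w => p a ra.
have Oz : O_ (sigma p) z by case: ra.
by rewrite (residue_uniq ra (gP _ Oz)); exact: wP.
Qed.

Section AutomorphismPullback.
Variables (sigma tau : X -> X) (phi : K -> K).
Hypotheses (sigmaK : cancel sigma tau).
Hypothesis phiP : forall z p a, residue (sigma p) z a -> residue p (phi z) a.

Lemma sigma_cofinite (z : K) : exists s : seq X, forall p, p \notin s -> O_ (sigma p) z.
Proof.
have [s sP] := finite_poles_X z; exists (map tau s) => p ps; apply: sP.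
by apply: contra ps => ps; apply/mapP; exists (sigma p).
Qed.

Lemma pullback_const a : phi (iK a) = iK a.
Proof.
apply: (@eq_of_residues _ _ [::]) => p _; exists a.
have r p' : residue p' (iK a) a.
  by apply/residueE; rewrite subrr; exact: mI0.
by split; [apply: phiP|].
Qed.

(** The map [phi] is known only through residues: both sides have equal residues off finitely many
    places, so they coincide. *)
Lemma pullback_additive : zmod_morphism phi.
Proof.
move=> z w; have [s sP] := sigma_cofinite z; have [t tP] := sigma_cofinite w.
apply: (@eq_of_residues _ _ (s ++ t)) => p; rewrite mem_cat negb_or => /andP[/sP Oz /tP Ow].
have [a ra] := residue_ex Oz; have [b rb] := residue_ex Ow; exists (a - b).
have sub p' (u v : K) : residue p' u a -> residue p' v b -> residue p' (u - v) (a - b).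
  move=> /residueE mu /residueE mv; apply/residueE; rewrite rmorphB.
  have -> : u - v - (iK a - iK b) = (u - iK a) - (v - iK b) by rewrite !opprB addrACA [RHS]addrACA; congr (_ + _); rewrite addrC.
  exact: (mIB (O_place p')).
by split; [apply: phiP; exact: sub | apply: sub; exact: phiP].
Qed.

Lemma pullback_multiplicative : monoid_morphism phi.
Proof.
split; first by have := pullback_const 1; rewrite rmorph1.
move=> z w; have [s sP] := sigma_cofinite z; have [t tP] := sigma_cofinite w.
apply: (@eq_of_residues _ _ (s ++ t)) => p; rewrite mem_cat negb_or => /andP[/sP Oz /tP Ow].
have [a ra] := residue_ex Oz; have [b rb] := residue_ex Ow; exists (a * b).
have mul p' (u v : K) : residue p' u a -> residue p' v b -> residue p' (u * v) (a * b).
  by move=> /residueE mu /residueE mv; apply/residueE; exact: (mI_resM (O_place p')).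
by split; [apply: phiP; exact: mul | apply: mul; exact: phiP].
Qed.

HB.instance Definition _ := GRing.isZmodMorphism.Build K K phi pullback_additive.
HB.instance Definition _ := GRing.isMonoidMorphism.Build K K phi pullback_multiplicative.
Definition pullback : {rmorphism K -> K} := phi.

(** For the converse, a pole z at sigma(p) makes z^-1 have residue 0 there, so phi(z^-1) lies in the
    maximal ideal at p and phi(z) cannot be regular. *)
Lemma pullback_place p z : O_ (sigma p) z <-> O_ p (phi z).
Proof.
split.
  by move=> /residue_ex[a /phiP[]].
move=> Oz; apply: contrapT => nOz; have z0 : z != 0.
  by apply/eqP => z0; apply: nOz; rewrite z0; exact: (pl0 (O_place _)).
have /phiP/residueE : residue (sigma p) z^-1 0.
  by apply/residueE; rewrite rmorph0 subr0; exact: mIV.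
rewrite rmorph0 subr0 => m; have := mIM (O_place p) Oz m.
have -> : phi z * phi z^-1 = 1 by rewrite -(rmorphM pullback) divff //; exact: (rmorph1 pullback).
exact: (mI1 (O_place p)).
Qed.
End AutomorphismPullback.

(** The pullbacks along sigma and its inverse are mutually inverse field maps over k, so they come
    from some b; by [pullback_place], sigma and b move valuation rings in the same way. *)
Lemma aut_of_bir_surj (sigma : AutX F) : exists b, aut_of_bir b = sigma.
Proof.
have [ms [tau [mt sK tK]]] := aut_funP sigma.
have [phi phiP] := morphism_pullback ms; have [psi psiP] := morphism_pullback mt.
have inv (s t : X -> X) (f g : K -> K) : cancel s t -> cancel t s ->
    (forall z p a, residue (s p) z a -> residue p (f z) a) ->
    (forall z p a, residue (t p) z a -> residue p (g z) a) -> cancel f g.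
  move=> st ts fP gP z; have [l lP] := finite_poles_X z.
  apply: (@eq_of_residues _ _ l) => p /lP/residue_ex[a ra]; exists a; split=> //.
  by apply: gP; apply: fP; rewrite ts.
have [b bE] := @bir_of_hom (pullback sK phiP) (pullback tK psiP)
  (pullback_const phiP) (pullback_const psiP) (inv _ _ _ _ sK tK phiP psiP)
  (inv _ _ _ _ tK sK psiP phiP).
exists b; apply: val_inj; apply/funext => p; apply: val_inj; apply/funext => z.
apply/propext; rewrite -[X in X <-> _]/(O_ (pull_place b p) z) pull_placeE bE.
have [h1 h2] := pullback_place sK phiP p z.
by split=> [/h2|/h1].
Qed.
End Theta.

(** The coefficient of index e gives the degree. In the derivative all terms of positive index carry
    a factor p, which leaves the coefficient of index 0. Additivity is that of the iterated
    Frobenius. *)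
Lemma additive_poly_sep (k : closedFieldType) (p e : nat) (a : 'I_e.+1 -> k) :
  p \in [pchar k] -> a ord_max * a ord0 != 0 -> additive_sep (p ^ e) (additive_poly p a).
Proof.
move=> pk; rewrite mulf_eq0 negb_or => /andP[am a0]; have pr := pcharf_prime pk.
have p1 := prime_gt1 pr; split.
- rewrite /additive_poly big_ord_recr /= addrC size_polyDl.
    by rewrite size_scale ?size_polyXn.
  rewrite size_scale ?size_polyXn // ltnS; apply: leq_trans (size_sum _ _ _) _.
  apply/bigmax_leqP => j _; apply: leq_trans (size_scale_leq _ _) _.
  by rewrite size_polyXn ltn_exp2l.
- exists (a ord0) => //; rewrite /additive_poly big_ord_recl linearD /= raddf_sum /=.
  rewrite big1 ?addr0; first by rewrite expn0 derivZ expr1 derivX alg_polyC.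
  move=> j _; rewrite derivZ derivXn expnS mulnC -mulr_natr natrM.
  have -> : (p%:R : {poly k}) = 0 by rewrite -polyC_natr (pcharf0 pk).
  by rewrite mulr0 mulr0 scaler0.
move=> x y; rewrite /additive_poly !horner_sum -big_split; apply: eq_bigr => j _ /=.
rewrite !hornerZ !hornerXn -mulrDr; congr (_ * _).
by apply: exprDn_pchar; rewrite pnatX (eq_pnat _ (pcharf_eq pk)) pnat_id.
Qed.

Section GroupHomomorphisms.
Variables (k : closedFieldType) (q : nat) (c : k) (L1 L2 : {poly k}).
Hypotheses (q_gt2 : (2 < q)%N) (c0 : c != 0) (g1 : additive_sep q L1) (g2 : additive_sep q L2).
Local Notation F := (homogenize (affine_eq c L1 L2)).
Local Notation aut_of_bir := (@aut_of_bir k q c L1 L2 q_gt2 c0 g1 g2).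

Definition bir_of_aut (sigma : AutX F) : Bir F :=
  projT1 (cid (aut_of_bir_surj q_gt2 c0 g1 g2 sigma)).

Lemma bir_of_autK : cancel bir_of_aut aut_of_bir.
Proof. by move=> sigma; rewrite /bir_of_aut; case: cid. Qed.

Lemma aut_of_birK : cancel aut_of_bir bir_of_aut.
Proof. by move=> b; apply: (@aut_of_bir_inj _ _ _ _ _ q_gt2 c0 g1 g2); rewrite bir_of_autK. Qed.

Lemma bir_of_autM : {morph bir_of_aut : s t / (s * t)%g}.
Proof.
move=> s t; apply: (@aut_of_bir_inj _ _ _ _ _ q_gt2 c0 g1 g2).
by rewrite aut_of_birM !bir_of_autK.
Qed.

HB.instance Definition _ := isMultiplicative.Build (AutX F) (Bir F) bir_of_aut bir_of_autM.

HB.instance Definition _ := isMultiplicative.Build (Bir F) (PGL 3 k)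
  (PGL_of_bir q_gt2 c0 g1 g2) (@PGL_of_birM k q c L1 L2 q_gt2 c0 g1 g2).

Lemma bir_of_aut_bij : bijective bir_of_aut.
Proof. by exists aut_of_bir; [exact: bir_of_autK | exact: aut_of_birK]. Qed.

Lemma bir_of_aut_induces sigma : induces sigma (bir_of_aut sigma).
Proof. by rewrite -{1}[sigma]bir_of_autK; exact: aut_of_bir_induces. Qed.
End GroupHomomorphisms.

Local Close Scope quotient_scope.

Theorem theorem1 (k : closedFieldType) (p e : nat) (c : k)
    (alpha1 alpha2 : 'I_e.+1 -> k) :
  p \in [pchar k] -> (1 <= e)%N -> (2 < p ^ e)%N -> c != 0 ->
  alpha1 ord_max * alpha1 ord0 != 0 ->
  alpha2 ord_max * alpha2 ord0 != 0 ->
  let L1 := additive_poly p alpha1 in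
  let L2 := additive_poly p alpha2 in
  let f : {mpoly k[2]} := horner_alg 'X_0 L1 * horner_alg 'X_1 L2 + c%:MP in
  let F := homogenize f in
  exists (theta : {multiplicative AutX F -> Bir F})
         (rho : {multiplicative Bir F -> PGL 3 k}),
    [/\ bijective theta, forall sigma, induces sigma (theta sigma)
      & injective rho].
Proof.
move=> pk _ q_gt2 c0 /(additive_poly_sep pk) g1 /(additive_poly_sep pk) g2 L1 L2 f F.
exists (bir_of_aut q_gt2 c0 g1 g2), (PGL_of_bir q_gt2 c0 g1 g2); split.
- exact: bir_of_aut_bij.
- exact: bir_of_aut_induces.
exact: PGL_of_bir_inj.
Qed.
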